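(* Let $d\in\mathbb{N}$, $d\ge2$, $1<q<\infty$, $1<p_j<\infty$, $r_j>0$ for $j=1,\dots,d$, let $\frac{\langle\overline{r}\rangle}{d}+\frac1q-\frac{\langle\overline{r}\rangle}{\langle\overline{p}\circ\overline{r}\rangle}>0$, and let $p_j\ge q$ for all $1\le j\le d$. Suppose that the condition $$\sum_{i=1}^d\frac1{r_i}\left(\frac1{p_i}-\frac1{p_j}\right)<1,\qquad j=1,\dots,d,$$ fails (i.e. the inequality is violated for at least one $j\in\{1,\dots,d\}$). Then still $$d_n(W^{\overline{r}}_{\overline{p}}(\mathbb{T}^d),L_q(\mathbb{T}^d))\underset{\overline{r},\overline{p},q,d}{\asymp}n^{-\langle\overline{r}\rangle/d},\qquad n\in\mathbb{N}.$$
   Context: Kolmogorov width: for a normed space $X$, $M\subset X$ and $n\in\mathbb{Z}_+$, $d_n(M,X)=\inf_{L}\sup_{x\in M}\inf_{y\in L}\|x-y\|$, where $L$ ranges over all linear subspaces of $X$ of dimension at most $n$. Function class: $\mathbb{T}^d=[0,2\pi]^d$; $\mathcal{S}'(\mathbb{T}^d)$ is the space of periodic distributions (test functions: infinitely smooth periodic functions); each $f\in\mathcal{S}'(\mathbb{T}^d)$ has a Fourier series $f=\sum_{\overline{k}\in\mathbb{Z}^d}c_{\overline{k}}(f)e^{i(\overline{k},\cdot)}$. Let $\mathring{\mathbb{Z}}^d=\{\overline{k}\in\mathbb{Z}^d: k_1k_2\cdots k_d\ne0\}$ and let $\mathring{\mathcal{S}}'(\mathbb{T}^d)$ be the set of $f\in\mathcal{S}'(\mathbb{T}^d)$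 with $c_{\overline{k}}(f)=0$ for all $\overline{k}\notin\mathring{\mathbb{Z}}^d$. The Weyl derivative of order $r_j$ in the variable $x_j$ of $f\in\mathring{\mathcal{S}}'(\mathbb{T}^d)$ is $\partial_j^{r_j}f=\sum_{\overline{k}\in\mathring{\mathbb{Z}}^d}c_{\overline{k}}(f)(ik_j)^{r_j}e^{i(\overline{k},\cdot)}$, where $(ik_j)^{r_j}=|k_j|^{r_j}e^{\mathrm{sgn}(k_j)\, i\pi r_j/2}$. With $\overline{p}=(p_1,\dots,p_d)$, $\overline{r}=(r_1,\dots,r_d)$, $$W^{\overline{r}}_{\overline{p}}(\mathbb{T}^d)=\{f\in\mathring{\mathcal{S}}'(\mathbb{T}^d):\ \|\partial_j^{r_j}f\|_{L_{p_j}(\mathbb{T}^d)}\le1,\ 1\le j\le d\}.$$ Notation: $\langle\overline{a}\rangle=\dfrac{d}{1/a_1+\dots+1/a_d}$ is the harmonic mean of $a_1,\dots,a_d$, and $\overline{a}\circ\overline{b}=(a_1b_1,\dots,a_db_d)$. For nonnegative functions, $f_1(x,y)\underset{y}{\lesssim}f_2(x,y)$ means that for each $y$ there is $c(y)>0$ with $f_1(x,y)\le c(y)f_2(x,y)$ for all $x$; $f_1\underset{y}{\asymp}f_2$ means $f_1\underset{y}{\lesssim}f_2$ and $f_2\underset{y}{\lesssim}f_1$. *)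

(* Defs.v *)
From HB Require Import structures.
From mathcomp Require Import all_boot all_order all_algebra.
From mathcomp Require Import finmap complex.
From mathcomp Require Import all_classical all_reals all_analysis.
From mathcomp Require Import showcase.summability ring.

Set Implicit Arguments.
Unset Strict Implicit.
Unset Printing Implicit Defensive.

Import Order.TTheory GRing.Theory Num.Theory.
Import numFieldNormedType.Exports.

Local Open Scope classical_set_scope.
Local Open Scope ring_scope.
Local Open Scope complex_scope.

(* All function spaces are over the complex numbers [R[i]].  The functional
   [N] is allowed to take the value [+oo]; the normed space in which widths
   are taken is [fin_space N], the subspace of [V] on which [N] is finite. *)
Section kolmogorov_width.
Variables (R : realType) (V : lmodType R[i]) (N : V -> \bar R).

Definition fin_space : set V := [set v | (N v < +oo)%E].

Definition lin_span n (e : 'I_n -> V) : set V :=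
  [set \sum_(i < n) a i *: e i | a in [set: 'I_n -> R[i]]].

(* The linear subspaces of dimension at most [n] of the normed space. *)
Definition subspaces_dim_le n : set (set V) :=
  [set L | L `<=` fin_space /\ exists e : 'I_n -> V, L = lin_span e].

Definition kolmogorov_width (M : set V) (n : nat) : \bar R :=
  ereal_inf [set ereal_sup [set ereal_inf [set N (x - y) | y in L]
                           | x in M]
            | L in subspaces_dim_le n].

End kolmogorov_width.

(* The n-fold product of a finite measure, on n-tuples. *)
Section product_power.
Context (dp : measure_display) (T : measurableType dp) (R : realType).
Variable mu : {finite_measure set T -> \bar R}.

Definition cons_point n (x : T * n.-tuple T) : n.+1.-tuple T :=
  [tuple of x.1 :: x.2].

Lemma measurable_cons_point n : measurable_fun [set: _] (@cons_point n).
Proof.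
by apply: measurable_cons; [exact: measurable_fst|exact: measurable_snd].
Qed.

Section product_cons.
Variables (n : nat) (m : {finite_measure set (n.-tuple T) -> \bar R}).
Local Open Scope ereal_scope.

Definition product_cons : set (n.+1.-tuple T) -> \bar R :=
  pushforward (mu \x m) (@cons_point n).

Let mpre (A : set (n.+1.-tuple T)) :
  measurable A -> measurable (@cons_point n @^-1` A).
Proof.
by move=> mA; rewrite -[X in measurable X]setTI; exact: measurable_cons_point.
Qed.

Let product_cons0 : product_cons set0 = 0.
Proof. by rewrite /product_cons /pushforward preimage_set0 measure0. Qed.

Let product_cons_ge0 A : 0 <= product_cons A.
Proof. by rewrite /product_cons /pushforward integral_ge0. Qed.

Let product_cons_sigma_additive : semi_sigma_additive product_cons.
Proof.
move=> F mF tF mUF; rewrite /product_cons /pushforward preimage_bigcup.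
apply: measure_semi_sigma_additive.
- by move=> k; exact: mpre.
- apply/trivIsetP => /= i j _ _ ij; rewrite -preimage_setI.
  by move/trivIsetP : tF => /(_ _ _ _ _ ij) ->//; rewrite preimage_set0.
- by rewrite -preimage_bigcup; exact: mpre.
Qed.

HB.instance Definition _ := isMeasure.Build _ _ _
  product_cons product_cons0 product_cons_ge0 product_cons_sigma_additive.

Let product_cons_fin : fin_num_fun product_cons.
Proof.
move=> A mA; rewrite ge0_fin_numE//.
have /le_lt_trans : product_cons A <= product_cons setT.
  by apply: le_measure; rewrite ?inE.
apply; rewrite /product_cons /pushforward preimage_setT -setXTT.
rewrite product_measure1E//.
by rewrite lte_mul_pinfty ?fin_num_measure// ltey_eq fin_num_measure.
Qed.

HB.instance Definition _ :=
  Measure_isFinite.Build _ _ _ product_cons product_cons_fin.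

End product_cons.

Fixpoint product_power n : {finite_measure set (n.-tuple T) -> \bar R} :=
  match n with
  | 0 => dirac [tuple]
  | m.+1 => product_cons (product_power m)
  end.

End product_power.

Section torus.
Variable R : realType.

Definition period_interval : set (measurableTypeR R) := `[0, 2 * pi].

Lemma measurable_period_interval : measurable period_interval.
Proof. exact: measurable_itv. Qed.

Lemma period_interval_lty : (lebesgue_measure period_interval < +oo)%E.
Proof.
by rewrite /period_interval lebesgue_measure_itv /=; case: ifP; rewrite ?ltry.
Qed.

(* Lebesgue measure on [0, 2 pi]^d. *)
Definition torus_measure (d : nat) :
    {finite_measure set (d.-tuple (measurableTypeR R)) -> \bar R} :=
  product_power (mfrestr measurable_period_interval period_interval_lty) d.

End torus.

Section test_functions.
Variables (R : realType) (d : nat).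

(* Iterated partial derivative of [u] in the coordinate directions listed
   in [s]. *)
Definition pderivs (s : seq 'I_d) (u : 'rV[R]_d -> R) : 'rV[R]_d -> R :=
  foldr (fun j v => 'D_(delta_mx 0 j) v) u s.

Definition smooth (u : 'rV[R]_d -> R) : Prop := forall s : seq 'I_d,
  continuous (pderivs s u) /\
  forall j x, derivable (pderivs s u) x (delta_mx 0 j).

Definition smooth_periodic (phi : 'rV[R]_d -> R[i]) : Prop :=
  [/\ smooth (fun x => complex.Re (phi x)),
      smooth (fun x => complex.Im (phi x)) &
      forall j x, phi (x + (2 * pi) *: delta_mx 0 j) = phi x].

Definition test := {phi : 'rV[R]_d -> R[i] | smooth_periodic phi}.

Definition test_fun (phi : test) : 'rV[R]_d -> R[i] := sval phi.
Coercion test_fun : test >-> Funclass.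

Definition expi (t : R) : R[i] := cos t +i* sin t.

Definition phase (k : 'rV[int]_d) (x : 'rV[R]_d) : R :=
  \sum_(j < d) (k 0 j)%:~R * x 0 j.

Definition fourier_exp (k : 'rV[int]_d) (x : 'rV[R]_d) : R[i] :=
  expi (phase k x).

Lemma phaseDZ k x j h :
  phase k (x + h *: delta_mx 0 j) = phase k x + (k 0 j)%:~R * h.
Proof.
rewrite /phase.
under eq_bigr do rewrite !mxE eqxx /= mulrDr.
rewrite big_split /= (bigD1 j) //= (bigD1 (P := xpredT) j) //= eqxx mulr1.
by rewrite [X in _ + (_ + X)]big1 ?addr0// => i /negPf ->; rewrite !mulr0.
Qed.

Lemma continuous_phase k : continuous (phase k).
Proof.
apply: (@continuous_big R^o 'I_d +%R 0 xpredT).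
  exact: add_continuous.
move=> j _ x.
apply: (@cvgM _ _ (nbhs x) _ (fun=> (k 0 j)%:~R) (fun x : 'rV[R]_d => x 0 j)).
  exact: cvg_cst.
exact: coord_continuous.
Qed.

Let wave (a t : R) k x := a * cos (phase k x + t).

Let is_derive_wave a t k x j :
  is_derive x (delta_mx 0 j) (wave a t k)
    (wave (a * (k 0 j)%:~R) (t + pi / 2) k x).
Proof.
set c := (k 0 j)%:~R : R.
have H : is_derive (0 : R) 1 (fun h => a * cos (c * h + (phase k x + t)))
    (wave (a * c) (t + pi / 2) k x).
  apply: is_derive_eq.
  rewrite /wave mulr0 add0r addrA cosDpihalf /GRing.scale /=.
  by rewrite ?mul0r ?mulr0 ?mulr1 ?addr0 ?add0r; ring.
have E (h : R) : wave a t k (h *: delta_mx 0 j + x) =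
    a * cos (c * (h *: (1 : R) + 0) + (phase k x + t)).
  by rewrite /wave [_ + x]addrC phaseDZ addr0 /GRing.scale /= mulr1 -/c;
     congr (_ * cos _); ring.
have E0 : wave a t k x = a * cos (c * 0 + (phase k x + t)).
  by rewrite /wave mulr0 add0r.
have Q : (fun h : R => h^-1 *: ((wave a t k \o shift x) (h *: delta_mx 0 j) -
        wave a t k x)) =
    (fun h : R => h^-1 *: (((fun h => a * cos (c * h + (phase k x + t)))
        \o shift 0) (h *: (1 : R)) - a * cos (c * 0 + (phase k x + t)))).
  by apply/funext => h; rewrite /= E0 E.
by have [dH vH] := H; split; rewrite ?/derivable ?/derive Q.
Qed.

Let pderivs_wave k s a t : exists b u, pderivs s (wave a t k) = wave b u k.
Proof.
elim: s => [|j s [b [u IH]]]; first by exists a, t.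
exists (b * (k 0 j)%:~R), (u + pi / 2); rewrite /= IH.
by apply/funext => x; have [_ ->] := is_derive_wave b u k x j.
Qed.

Let smooth_wave a t k : smooth (wave a t k).
Proof.
move=> s; have [b [u ->]] := pderivs_wave k s a t; split.
  move=> x.
  apply: (@cvgM _ _ (nbhs x) _ (fun=> b) (fun x => cos (phase k x + u))).
    exact: cvg_cst.
  apply: (@continuous_comp _ _ _ (fun x => phase k x + u) cos).
    apply: (@cvgD _ _ _ (nbhs x) _ (phase k) (fun=> u)).
      exact: continuous_phase.
    exact: cvg_cst.
  exact: continuous_cos.
by move=> j x; have [] := is_derive_wave b u k x j.
Qed.

Let expi_period (t : R) (m : int) : expi (t + m%:~R * (2 * pi)) = expi t.
Proof.
have Dn (s : R) n : expi (s + n%:R * (2 * pi)) = expi s.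
  elim: n => [|n IH]; first by rewrite mul0r addr0.
  rewrite -natr1 mulrDl mul1r addrA -[RHS]IH /expi.
  by rewrite (mulr_natl pi 2) cosD2pi sinD2pi.
case: m => n; first exact: Dn.
by rewrite NegzE -[LHS](Dn _ n.+1) mulrNz mulNr subrK.
Qed.

Lemma fourier_exp_smooth_periodic k : smooth_periodic (fourier_exp k).
Proof.
split.
- have := smooth_wave 1 0 k; congr smooth; apply/funext => x.
  by rewrite /wave mul1r addr0.
- have := smooth_wave 1 (- (pi / 2)) k; congr smooth; apply/funext => x.
  by rewrite /wave mul1r cosBpihalf.
- by move=> j x; rewrite /fourier_exp phaseDZ expi_period.
Qed.

Definition fourier_test (k : 'rV[int]_d) : test :=
  exist _ (fourier_exp k) (fourier_exp_smooth_periodic k).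

End test_functions.

Section distributions.
Variables (R : realType) (d : nat).

(* Complex-valued functionals on test functions, with the pointwise complex
   vector space structure. *)
Definition functional := test R d -> R[i]^o.
HB.instance Definition _ := GRing.Lmodule.on functional.

Definition linear_functional (T : functional) : Prop :=
  forall (a : R[i]) (phi psi chi : test R d),
    (forall x, chi x = a * phi x + psi x) -> T chi = a * T phi + T psi.

(* Continuity for the topology given by the seminorms
   [max_(|s| <= N) sup_x |D^s phi x|], [N] a natural number: [T] is bounded by
   a multiple of one of them. *)
Definition continuous_functional (T : functional) : Prop :=
  exists (N : nat) (C : R), forall (phi : test R d) (B : R),
    (forall s : seq 'I_d, (size s <= N)%N -> forall x,
      Normc.normc (pderivs s (fun y => complex.Re (phi y)) x +i*
                   pderivs s (fun y => complex.Im (phi y)) x) <= B) ->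
    Normc.normc (T phi) <= C * B.

Definition periodic_distribution (T : functional) : Prop :=
  linear_functional T /\ continuous_functional T.

Definition torus_point (x : d.-tuple (measurableTypeR R)) : 'rV[R]_d :=
  \row_(j < d) tnth x j.

Definition torus_integral (f : d.-tuple (measurableTypeR R) -> R[i]) : R[i] :=
  (\int[torus_measure R d]_x complex.Re (f x)) +i*
  (\int[torus_measure R d]_x complex.Im (f x)).

(* The functional defined by the function [g]. *)
Definition regular_functional (g : d.-tuple (measurableTypeR R) -> R[i]) :
    functional :=
  fun phi => torus_integral (fun x => g x * phi (torus_point x)).

Definition fun_norm (p : R) (g : d.-tuple (measurableTypeR R) -> R[i]) :
    \bar R :=
  Lnorm (torus_measure R d) p%:E (fun x => (Normc.normc (g x))%:E).

Definition Lp_fun (p : R) : set (d.-tuple (measurableTypeR R) -> R[i]) :=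
  [set g | [/\ measurable_fun setT (fun x => complex.Re (g x)),
               measurable_fun setT (fun x => complex.Im (g x)) &
               (fun_norm p g < +oo)%E]].

(* [L_p] is seen inside the space of distributions.  The value is [+oo] when
   [T] is not given by a function of [L_p]; when it is, that function is
   unique up to equality almost everywhere, so that the infimum is over a
   single value and the functionals of finite norm form the normed space
   [L_p], functions equal almost everywhere being identified. *)
Definition Lp_norm (p : R) (T : functional) : \bar R :=
  ereal_inf [set fun_norm p g | g in
    [set g | Lp_fun p g /\ T = regular_functional g]].

Definition fourier_coef (T : functional) (k : 'rV[int]_d) : R[i] :=
  ((2 * pi) ^- d)%:C * T (fourier_test R (- k)).

Definition nonzero_freq (k : 'rV[int]_d) : bool := [forall j, k 0 j != 0].

Definition distribution_nonzero_freq (T : functional) : Prop :=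
  periodic_distribution T /\
  forall k, ~~ nonzero_freq k -> fourier_coef T k = 0.

(* [(i k)^r] for a nonzero integer [k]. *)
Definition weyl_factor (r : R) (k : int) : R[i] :=
  (`|k%:~R| `^ r)%:C * expi ((Num.sg k)%:~R * (pi * r / 2)).

(* [g] is the sum, in the space of distributions, of the Fourier series
   defining the Weyl derivative of order [r] of [f] in the [j]-th variable. *)
Definition is_weyl_derivative (j : 'I_d) (r : R) (f g : functional) : Prop :=
  forall phi : test R d,
    partial_sum (fun k : 'rV[int]_d =>
      if nonzero_freq k then
        fourier_coef f k * weyl_factor r (k 0 j) *
        regular_functional (fun x => fourier_exp k (torus_point x)) phi
      else 0) @ totally --> g phi.

Definition sobolev_class (r p : 'I_d -> R) : set functional :=
  [set f | distribution_nonzero_freq f /\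
    forall j, exists2 g, is_weyl_derivative j (r j) f g
                       & (Lp_norm (p j) g <= 1)%E].

Definition vec_harmonic_mean (a : 'I_d -> R) : R :=
  d%:R / \sum_(j < d) (a j)^-1.

End distributions.

(* Main.v *)
Require Import Defs.
From HB Require Import structures.
From mathcomp Require Import all_boot all_order all_algebra.
From mathcomp Require Import finmap complex.
From mathcomp Require Import all_classical all_reals all_analysis.
From mathcomp Require Import showcase.summability measurable_realfun ring lra zify.

(** Put [rho = <r>/d = 1 / sum_j 1/r_j].

    Upper bound: the de la Vallee Poussin mean of [f] at the anisotropic scales
    [2^(m_j) ~ n^(rho/r_j)] lies in the span of at most [n] exponentials.  Passing
    from the scales [2^(m_j+s)] to [2^(m_j+s+1)] one coordinate at a time, each step
    is the convolution of a Weyl derivative of [f] with a kernel dominated by a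
    positive kernel of mass [O(n^-rho 2^(-rho s))]; by Young's inequality in [L_q]
    the steps sum to [O(n^-rho)], the Weyl derivatives being bounded in [L_q]
    because [q <= p_j].

    Lower bound: let [t_1, ..., t_m], [m >= 2n], be a grid of mesh [~ n^(-rho/r_j)].
    Given [n] functionals, an extreme point of the set of [z] with [|z_l| <= 1] such
    that [h = sum_l z_l psi(. - t_l)] is annihilated by them has at least [m - n]
    unimodular coordinates.  A multiple [f] of [sum_l conj(z_l) phi(. - t_l)] by
    [~ n^-rho / m] is in the class, and since [phi] and [psi] are dual on the grid,
    [f(h) >= c m n^-rho], whereas [|h| = O(m)]. *)

Set Implicit Arguments.
Unset Strict Implicit.
Unset Printing Implicit Defensive.

Import Order.TTheory GRing.Theory Num.Theory.
Import numFieldNormedType.Exports.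

Local Open Scope classical_set_scope.
Local Open Scope ring_scope.
Local Open Scope complex_scope.

(** * Exponential sums and positive kernels *)

(** An L_1 bound for a kernel is never computed as an integral: a trigonometric polynomial dominated
    in modulus by a nonnegative one has mean modulus at most the zeroth coefficient of the latter.
    All multiplier estimates thus become arithmetic on coefficient sequences, stable under sums and
    products. The basic positive kernels are Fejer kernels, whose coefficients form triangles.

    The Weyl factor is singular at frequency zero and changes phase there. This is why the dyadic
    steps are split into a positive and a negative half, each a combination of shifted triangles,
    and why phi has its frequencies between N and 3N in each variable.

    Duality on the grid is exact: the coefficients of psi equal 1 on the reflected support of phi,
    so the product of the two is again a triangle, of order equal to the number of grid points in
    that variable, and its kernel vanishes at the difference of two distinct grid points.

    The sum of the steps is a function while f is a distribution. They are compared through Fourier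
    coefficients, which determine a distribution because trigonometric polynomials are dense in the
    test functions. *)

Section exponential.
Variable R : realType.
Implicit Types s t : R.

Lemma expiD s t : expi (s + t) = expi s * expi t.
Proof.
rewrite /expi cosD sinD; apply/eqP; rewrite eq_complex /=.
by apply/andP; split; apply/eqP; ring.
Qed.

Lemma expi0 : expi 0 = 1 :> R[i].
Proof. by rewrite /expi cos0 sin0. Qed.

Lemma conjc_expi t : (expi t)^* = expi (- t).
Proof. by rewrite /expi cosN sinN. Qed.

Lemma norm_expi t : `|expi t| = 1.
Proof. by rewrite normc_def /= cos2Dsin2 sqrtr1. Qed.

Lemma expi_neq0 t : expi t != 0.
Proof. by rewrite -normr_eq0 norm_expi oner_eq0. Qed.

Lemma expiX t n : expi t ^+ n = expi (n%:R * t).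
Proof.
elim: n => [|n IH]; first by rewrite expr0 mul0r expi0.
by rewrite exprS IH -expiD -[n.+1]addn1 natrD mulrDl mul1r addrC.
Qed.

Lemma expi_sum (I : Type) (s : seq I) (P : pred I) (F : I -> R) :
  expi (\sum_(i <- s | P i) F i) = \prod_(i <- s | P i) expi (F i).
Proof. by elim/big_rec2: _ => [|i y x _ <-]; rewrite ?expi0// expiD. Qed.

Lemma expi_2pi_int (m : int) : expi (m%:~R * (2 * pi)) = 1 :> R[i].
Proof.
have E1 : expi (2 * pi) = 1 :> R[i].
  by rewrite /expi mulr_natl cos2pi sin2pi.
have En n : expi (n%:R * (2 * pi)) = 1 :> R[i] by rewrite -expiX E1 expr1n.
case: m => n; first exact: En.
by rewrite NegzE mulrNz mulNr -conjc_expi En conjc1.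
Qed.

Lemma expi_period t (m : int) : expi (t + m%:~R * (2 * pi)) = expi t.
Proof. by rewrite expiD expi_2pi_int mulr1. Qed.

Lemma expi_neq1 t : 0 < t -> t < 2 * pi -> expi t != 1.
Proof.
move=> t0 t2; rewrite /expi; apply/negP; rewrite eq_complex /= => /andP[/eqP c1 _].
have s0 : 0 < sin (t / 2) by apply: sin_gt0_pi; rewrite divr_gt0//= ltr_pdivrMr// mulrC.
have := cosD (t / 2) (t / 2); rewrite -splitr c1 -!expr2 cos2sin2.
by have := exprn_gt0 2 s0 => H; nra.
Qed.

(** The sum is geometric, its ratio [z] is an [L]-th root of unity, and [z] equals 1 exactly when
    [L] divides [c]. *)
Lemma sum_expi_grid L (c : int) t : (0 < L)%N ->
  \sum_(l < L) expi (c%:~R * (t - 2 * pi * l%:R / L%:R)) =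
  if (L%:Z %| c)%Z then L%:R * expi (c%:~R * t) else 0.
Proof.
move=> L0; have L0R : (L%:R : R) != 0 by rewrite pnatr_eq0 -lt0n.
pose z : R[i] := expi (- (c%:~R * (2 * pi / L%:R))).
have -> : \sum_(l < L) expi (c%:~R * (t - 2 * pi * l%:R / L%:R)) =
    expi (c%:~R * t) * \sum_(l < L) z ^+ l.
  rewrite mulr_sumr; apply: eq_bigr => l _.
  by rewrite /z expiX -expiD; congr expi; field.
(* Reducing [c] modulo [L] puts the argument of a nontrivial [z] strictly between 0 and one period,
   up to sign, where [expi_neq1] applies. *)
have zE : z = expi (- ((c %% L)%Z%:~R * (2 * pi / L%:R))).
  rewrite /z {1}(divz_eq c L) intrD intrM.
  rewrite -(expi_period _ (c %/ L)%Z); congr expi.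
  by rewrite -pmulrn; field.
have zL : z ^+ L = 1.
  rewrite /z expiX -(expi_2pi_int (- c)); congr expi.
  by rewrite mulrNz; field.
case: ifPn => [Lc|nLc].
  have -> : z = 1.
    by move/dvdz_mod0P: Lc; rewrite zE => ->; rewrite mul0r oppr0 expi0.
  under eq_bigr do rewrite expr1n.
  by rewrite sumr_const card_ord mulrC.
have z1 : z != 1.
  have c0 : 0 < (c %% L)%Z.
    rewrite lt_neqAle modz_ge0 ?andbT; last by case: (L) L0.
    by rewrite eq_sym; apply: contra nLc => /eqP h; apply/dvdz_mod0P.
  have cL : (c %% L)%Z < L by apply: ltz_pmod; rewrite ltz_nat.
  rewrite zE -conjc_expi; apply/negP => /eqP/(congr1 conjc); rewrite conjcK conjc1.
  apply/eqP/expi_neq1.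
    by rewrite mulr_gt0 ?ltr0z// divr_gt0 ?mulr_gt0 ?pi_gt0// ltr0n.
  rewrite mulrA ltr_pdivrMr ?ltr0n// mulrC ltr_pM2l ?mulr_gt0 ?pi_gt0//.
  by rewrite -[_%:R]/(L%:~R) ltr_int.
have /eqP : (z - 1) * (\sum_(l < L) z ^+ l) = 0 by rewrite -subrX1 zL subrr.
by rewrite mulf_eq0 subr_eq0 (negPf z1) /= => /eqP ->; rewrite mulr0.
Qed.

End exponential.

(** * Trigonometric sums in one variable and their positive majorants *)

Section trig_sums.
Variable R : realType.
Notation C := R[i].
Implicit Types (K m n : nat) (a b p : int -> C) (A B t : R) (k c : int).

Definition freq K (i : 'I_(2 * K).+1) : int := i%:Z - K%:Z.

Definition tsum K a t : C :=
  \sum_(i < (2 * K).+1) a (freq i) * expi ((freq i)%:~R * t).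

Lemma freq_inj K : injective (@freq K).
Proof. by move=> i j /addIr [] /val_inj. Qed.

Lemma absz_freq K (i : 'I_(2 * K).+1) : (`|freq i| <= K)%N.
Proof. by rewrite /freq; have := ltn_ord i; lia. Qed.

Lemma freqP K k : (`|k| <= K)%N -> exists i : 'I_(2 * K).+1, freq i = k.
Proof.
move=> kK; have h : (`|(k + K%:Z)%R| < (2 * K).+1)%N by lia.
by exists (Ordinal h); rewrite /freq /=; lia.
Qed.

Lemma eq_tsum K a b t : (forall k, (`|k| <= K)%N -> a k = b k) ->
  tsum K a t = tsum K b t.
Proof. by move=> ab; apply: eq_bigr => i _; rewrite ab ?absz_freq. Qed.

Lemma tsum_dirac K c t : (`|c| <= K)%N ->
  tsum K (fun k => (k == c)%:R) t = expi (c%:~R * t).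
Proof.
move=> /freqP[i ic]; rewrite /tsum (bigD1 i)//= ic eqxx mul1r big1 ?addr0// => j ji.
rewrite -ic; case: eqP => [/freq_inj e|]; last by rewrite mul0r.
by rewrite e eqxx in ji.
Qed.

Lemma tsum_sum K (I : Type) (s : seq I) (P : pred I) (a_ : I -> int -> C) t :
  tsum K (fun k => \sum_(i <- s | P i) a_ i k) t =
  \sum_(i <- s | P i) tsum K (a_ i) t.
Proof.
by rewrite exchange_big; apply: eq_bigr => i _; rewrite mulr_suml.
Qed.

Lemma tsumZ K x a t : tsum K (fun k => x * a k) t = x * tsum K a t.
Proof. by rewrite mulr_sumr; apply: eq_bigr => i _; rewrite mulrA. Qed.

Lemma tsumD K a b t : tsum K (fun k => a k + b k) t = tsum K a t + tsum K b t.
Proof. by rewrite -big_split; apply: eq_bigr => i _; rewrite mulrDl. Qed.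

(* Multiplying coefficients is convolving; the convolution is taken over an
   equidistant grid with more points than there are frequencies. *)
Lemma tsumM K a b t : let L := (2 * K).+1 in
  tsum K (fun k => a k * b k) t = L%:R^-1 * \sum_(l < L)
    tsum K a (t + (0 - 2 * pi * l%:R / L%:R)) *
    tsum K b (- (0 - 2 * pi * l%:R / L%:R)).
Proof.
move=> L; have L0 : (L%:R : C) != 0 by rewrite pnatr_eq0.
pose x (l : 'I_L) : R := 0 - 2 * pi * l%:R / L%:R.
have E l : tsum K a (t + x l) * tsum K b (- x l) =
    \sum_(i < L) \sum_(j < L) a (freq i) * b (freq j) * expi ((freq i)%:~R * t) *
      expi ((freq i - freq j)%:~R * x l).
  rewrite /tsum mulr_suml; apply: eq_bigr => i _.
  rewrite mulr_sumr; apply: eq_bigr => j _.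
  rewrite [in RHS]intrB mulrBl expiD mulrDr expiD mulrN; ring.
under eq_bigr do rewrite E.
rewrite exchange_big /= mulr_sumr; apply: eq_bigr => i _.
rewrite exchange_big /= (bigD1 i)//= [X in _ + X]big1.
  rewrite addr0 subrr; under eq_bigr do rewrite mul0r expi0 mulr1.
  by rewrite sumr_const card_ord -mulr_natl; field.
move=> j ji; rewrite -mulr_sumr sum_expi_grid// ifN ?mulr0//.
apply: contra ji => /dvdzP[q]; rewrite /freq => H; apply/eqP/val_inj => /=.
have := ltn_ord i; have := ltn_ord j; rewrite /L in H * => hj hi.
have : q = 0 by nia.
by move=> q0; rewrite q0 in H; lia.
Qed.

(** The nonnegative polynomial with coefficients [p] dominates the kernel, so the mean modulus of
    the kernel is at most [p 0], hence at most [A]. The bound on the other coefficients and the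
    support below [m] serve to sum translates of the majorant over a grid. *)
Definition majorized K m A a := exists p, [/\ forall k, `|p k| <= A%:C,
  forall k, (m <= `|k|)%N -> p k = 0 &
  forall t, `|tsum K a t| <= tsum K p t].

Lemma majorized_ext K m A a b : (forall k, (`|k| <= K)%N -> a k = b k) ->
  majorized K m A a -> majorized K m A b.
Proof. by move=> ab [p [pA pm ap]]; exists p; split=> // t; rewrite -(eq_tsum t ab). Qed.

Lemma majorized_le K m m' A A' a : (m <= m')%N -> A <= A' ->
  majorized K m A a -> majorized K m' A' a.
Proof.
move=> mm' AA' [p [pA pm ap]]; exists p; split=> //.
  by move=> k; apply: le_trans (pA k) _; rewrite lecR.
by move=> k mk; apply: pm; exact: leq_trans mk.
Qed.

Lemma majorized0 K m : majorized K m 0 (fun=> 0).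
Proof.
exists (fun=> 0); split=> // [k|t]; first by rewrite normr0.
by rewrite /tsum big1 ?normr0// => i _; rewrite mul0r.
Qed.

Lemma majorizedD K m A B a b : majorized K m A a -> majorized K m B b ->
  majorized K m (A + B) (fun k => a k + b k).
Proof.
move=> [p [pA pm ap]] [q [qB qm bq]]; exists (fun k => p k + q k); split.
- by move=> k; rewrite rmorphD; apply: le_trans (ler_normD _ _) _; exact: lerD.
- by move=> k mk; rewrite pm// qm// addr0.
- by move=> t; rewrite !tsumD; apply: le_trans (ler_normD _ _) _; exact: lerD.
Qed.

Lemma majorizedZ K m A a (x : C) (B : R) : `|x| <= B%:C -> majorized K m A a ->
  majorized K m (B * A) (fun k => x * a k).
Proof.
move=> xB [p [pA pm ap]]; exists (fun k => B%:C * p k); split.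
- move=> k; rewrite normrM rmorphM ler_pM// ger0_norm//.
  exact: le_trans xB.
- by move=> k mk; rewrite pm// mulr0.
- by move=> t; rewrite !tsumZ normrM ler_pM.
Qed.

Lemma majorized_sum K m (I : Type) (s : seq I) (A_ : I -> R) (a_ : I -> int -> C) :
  (forall i, majorized K m (A_ i) (a_ i)) ->
  majorized K m (\sum_(i <- s) A_ i) (fun k => \sum_(i <- s) a_ i k).
Proof.
move=> H; elim: s => [|i s IH].
  by rewrite big_nil; apply: majorized_ext (majorized0 K m) => k _; rewrite big_nil.
rewrite big_cons; apply: majorized_ext (majorizedD (H i) IH) => k _.
by rewrite big_cons.
Qed.

(** In the grid mean of [tsumM] each factor can be dominated separately, and the dominating mean is
    again a convolution, with coefficients [p k * q k]. *)
Lemma majorizedM K m A B a b : majorized K m A a -> majorized K m B b ->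
  majorized K m (A * B) (fun k => a k * b k).
Proof.
move=> [p [pA pm ap]] [q [qB qm bq]]; exists (fun k => p k * q k); split.
- by move=> k; rewrite normrM rmorphM ler_pM.
- by move=> k mk; rewrite pm// mul0r.
- move=> t; rewrite !tsumM normrM normfV normr_nat ler_wpM2l ?invr_ge0 ?ler0n//.
  apply: le_trans (ler_norm_sum _ _ _) _; apply: ler_sum => l _.
  by rewrite normrM ler_pM.
Qed.

(** Summing over the [N] grid points keeps only the frequencies divisible by [N], each multiplied by
    [N]. The multiples of [N] that meet the support are among the [2 M + 1] ones with quotient at
    most [M] in modulus. *)
Lemma norm_tsum_grid K (M N : nat) A p t : (0 < N)%N -> (forall k, `|p k| <= A%:C) ->
  (forall k, (M * N <= `|k|)%N -> p k = 0) ->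
  `|\sum_(l < N) tsum K p (t - 2 * pi * l%:R / N%:R)| <= (A * (N * (2 * M).+1)%:R)%:C.
Proof.
move=> N0 pA pm; rewrite exchange_big /=.
have A0 : 0 <= A by rewrite -ler0c; exact: le_trans (pA 0).
under eq_bigr do rewrite -mulr_sumr sum_expi_grid//.
apply: le_trans (ler_norm_sum _ _ _) _.
(* Counts the multiples of [N] with small quotient that equal the frequency [i]; after exchanging
   the sums each quotient is met by at most one [i]. *)
pose b (i : 'I_(2 * K).+1) : C := \sum_(j < (2 * M).+1) (freq i == N%:Z * freq j)%:R.
apply: (@le_trans _ _ (\sum_i (A * N%:R)%:C * b i)).
  apply: ler_sum => i _; rewrite /b; case: ifPn => [Ni|_]; last first.
    rewrite mulr0 normr0 mulr_ge0 ?ler0c ?mulr_ge0//.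
    by apply: sumr_ge0 => j _; rewrite ler0n.
  rewrite !normrM norm_expi mulr1 normr_nat.
  have [mi|im] := leqP (M * N)%N `|freq i|%N.
    rewrite pm// normr0 mul0r mulr_ge0 ?ler0c ?mulr_ge0//.
    by apply: sumr_ge0 => j _; rewrite ler0n.
  have [q qE] := dvdzP Ni.
  have qM : (`|q| <= M)%N by nia.
  have [j jq] := freqP qM.
  rewrite (bigD1 j)//= jq qE [q * _]mulrC eqxx rmorphM rmorph_nat -[leLHS]mulr1.
  apply: ler_pM => //.
  - exact: ler_wpM2r.
  - by rewrite lerDl; apply: sumr_ge0 => ? _; rewrite ler0n.
have -> : (A * (N * (2 * M).+1)%:R)%:C = (A * N%:R)%:C * ((2 * M).+1)%:R.
  by rewrite natrM mulrA [LHS]rmorphM rmorph_nat.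
rewrite -mulr_sumr ler_wpM2l ?ler0c ?mulr_ge0// /b exchange_big /=.
apply: (@le_trans _ _ (\sum_(j < (2 * M).+1) 1)); last first.
  by rewrite sumr_const card_ord.
apply: ler_sum => j _; have [H|H] := leqP `|(N%:Z * freq j)%R|%N K.
  have [i0 <-] := freqP H; rewrite (bigD1 i0)//= eqxx big1 ?addr0// => i ii0.
  by case: eqP => // /freq_inj e; rewrite e eqxx in ii0.
rewrite big1 ?ler01// => i _; case: eqP => // E.
by move: H; rewrite -E ltnNge absz_freq.
Qed.

End trig_sums.

(** * Fejer triangles and truncated negative powers *)

Section triangles.
Variable R : realType.
Notation C := R[i].
Implicit Types (K m n N M : nat) (k c : int) (r s t : R).

(** Coefficients max(0, 1 - |k|/n) of the Fejer kernel; the truncated subtraction of naturals is the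
    positive part. *)
Definition tri n k : R := (n - `|k|)%N%:R / n%:R.

Lemma triN n k : tri n (- k) = tri n k.
Proof. by rewrite /tri abszN. Qed.

Lemma tri_out n k : (n <= `|k|)%N -> tri n k = 0.
Proof. by rewrite -subn_eq0 /tri => /eqP ->; rewrite mul0r. Qed.

Lemma tri_in n k : (0 < n)%N -> (`|k| <= n)%N -> tri n k = 1 - (`|k|%N)%:R / n%:R.
Proof.
by move=> n0 kn; rewrite /tri natrB// mulrBl divff// pnatr_eq0 -lt0n.
Qed.

Lemma tri_ge0 n k : 0 <= tri n k.
Proof. by rewrite divr_ge0. Qed.

Lemma tri_le1 n k : tri n k <= 1.
Proof.
case: n => [|n]; first by rewrite /tri invr0 mulr0 ler01.
by rewrite ler_pdivrMr ?ltr0n// mul1r ler_nat leq_subr.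
Qed.

(** The triangle is the autocorrelation of an interval of length [n], which is what makes the Fejer
    kernel a squared modulus. *)
Lemma tri_count n k :
  (n - `|k|)%N = (\sum_(i < n) \sum_(j < n) (k == (i%:Z - j%:Z)%R))%N.
Proof.
have H (x : nat) : (n - x = \sum_(j < n) \sum_(i < n) (i == j + x :> nat))%N.
  have E (j : nat) : (\sum_(i < n) (i == j + x :> nat) = (j < n - x))%N.
    rewrite ltn_subRL addnC; case: ltnP => jx.
      rewrite (bigD1 (Ordinal jx))//= eqxx big1 // => i.
      by rewrite -val_eqE /= => /negPf ->.
    by rewrite big1// => i _; case: eqP => // e; have := ltn_ord i; lia.
  under eq_bigr do rewrite E.
  rewrite -(big_mkord xpredT (fun j => nat_of_bool (j < n - x)%N)).
  rewrite -big_mkcond /=.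
  rewrite -[RHS](big_nat_widen 0 (n - x) n xpredT (fun=> 1%N)) ?leq_subr//.
  by rewrite big_const_nat iter_addn_0 mul1n subn0.
case: k => x.
  rewrite H exchange_big; apply: eq_bigr => i _; apply: eq_bigr => j _.
  by congr nat_of_bool; apply/eqP/eqP; lia.
rewrite H; apply: eq_bigr => i _; apply: eq_bigr => j _.
by congr nat_of_bool; apply/eqP/eqP; rewrite NegzE; lia.
Qed.

(** Fejer's formula; shifting the coefficients by [c] multiplies the kernel by a character. The
    condition on [c] and [n] says that the shifted triangle fits into the frequencies from -K to
    K. *)
Lemma tsum_tri K n c t : (0 < n)%N -> (`|c| + n <= K.+1)%N ->
  tsum K (fun k => (tri n (k - c))%:C) t =
  n%:R^-1 * expi (c%:~R * t) * `|\sum_(j < n) expi (j%:R * t)| ^+ 2.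
Proof.
move=> n0 cK.
have E k : (tri n (k - c))%:C =
    n%:R^-1 * \sum_(i < n) \sum_(j < n) (k == c + i%:Z - j%:Z)%:R :> C.
  rewrite /tri tri_count rmorphM fmorphV !rmorph_nat mulrC; congr (_ * _).
  rewrite natr_sum; apply: eq_bigr => i _; rewrite natr_sum; apply: eq_bigr => j _.
  by congr (nat_of_bool _)%:R; apply/eqP/eqP; lia.
rewrite (@eq_tsum _ K _ (fun k => n%:R^-1 * \sum_(i < n) \sum_(j < n) (k == c + i%:Z - j%:Z)%:R))//.
rewrite tsumZ tsum_sum -mulrA; congr (_ * _).
rewrite sqr_normc.
have -> : (\sum_(j < n) expi (j%:R * t))^* = \sum_(j < n) expi (- (j%:R * t)).
  by rewrite (rmorph_sum conjc); apply: eq_bigr => j _; rewrite -conjc_expi.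
rewrite mulr_suml mulr_sumr; apply: eq_bigr => i _.
rewrite tsum_sum !mulr_sumr; apply: eq_bigr => j _.
rewrite tsum_dirac; last by have := ltn_ord i; have := ltn_ord j; lia.
rewrite -!expiD; congr expi.
by rewrite intrB intrD -!pmulrn; ring.
Qed.

(** A shifted Fejer kernel has the same modulus as the centred one, which is therefore its majorant.
    Hence the support bound is [n], whatever the shift. *)
Lemma majorized_tri K n c : (0 < n)%N -> (`|c| + n <= K.+1)%N ->
  majorized K n 1 (fun k => (tri n (k - c))%:C).
Proof.
move=> n0 cK; exists (fun k => (tri n k)%:C); split.
- by move=> k; rewrite ger0_norm ?ler0c ?tri_ge0// lecR tri_le1.
- by move=> k nk; rewrite tri_out.
- move=> t; rewrite tsum_tri//.
  rewrite (@eq_tsum _ K (fun k => (tri n k)%:C) (fun k => (tri n (k - 0))%:C)); last first.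
    by move=> k _; rewrite subr0.
  rewrite tsum_tri// ?normr0 ?add0n; last by lia.
  rewrite mul0r expi0 mulr1 normrM (normrM n%:R^-1) norm_expi mulr1 normfV normr_nat.
  by rewrite (ger0_norm (exprn_ge0 _ (normr_ge0 _))).
Qed.

(** Abel summation applied twice. The terms in [al M] and [al M.+1] are boundary terms, which vanish
    for a sequence that is zero from [M] on. *)
Lemma abel_twice (al : nat -> R) M (k : nat) : (k <= M)%N ->
  \sum_(m < M) (m.+1 - k)%N%:R * (al m - 2 * al m.+1 + al m.+2) =
  al k + (M - k)%N%:R * al M.+1 - (M - k).+1%:R * al M.
Proof.
elim: M => [|M IH] kM.
  move: kM; rewrite leqn0 => /eqP ->.
  by rewrite big_ord0 subnn mul0r addr0 mul1r subrr.
rewrite big_ord_recr /=; have [kM'|Mk] := leqP k M.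
  rewrite IH// subSn// -!natr1; ring.
have -> : k = M.+1 by apply/eqP; rewrite eqn_leq kM.
rewrite subnn !mul0r addr0 mul1r addr0 subrr big1// => m _.
have -> : (m.+1 - M.+1 = 0)%N by have := ltn_ord m; lia.
by rewrite mul0r.
Qed.

(** By [abel_twice] an even sequence vanishing from [M] on is a combination of triangles, the one of
    order [m.+1] having weight [m.+1] times a second difference; each triangle has mass 1. *)
Lemma majorized_even K M (al : nat -> R) : (M <= K.+1)%N ->
  (forall k : nat, (M <= k)%N -> al k = 0) ->
  majorized K M (\sum_(m < M) m.+1%:R * `|al m - 2 * al m.+1 + al m.+2|)
    (fun k => (al `|k|%N)%:C).
Proof.
move=> MK alM.
pose D m := al m - 2 * al m.+1 + al m.+2.
apply: (@majorized_ext _ _ _ _ (fun k => \sum_(m < M)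
    (m.+1%:R * D m)%:C * (tri m.+1 (k - 0))%:C)) => [k _|].
  have E (m : 'I_M) : (m.+1%:R * D m)%:C * (tri m.+1 (k - 0))%:C =
      ((m.+1 - `|k|)%N%:R * D m)%:C.
    rewrite -rmorphM subr0 /tri; congr (_%:C).
    by field; rewrite addrC natr1 pnatr_eq0.
  under eq_bigr do rewrite E.
  rewrite -(rmorph_sum (real_complex R)) /=; congr (_%:C).
  have [kM|Mk] := leqP `|k|%N M.
    by rewrite abel_twice// (alM M)// (alM M.+1)// !mulr0 addr0 subr0.
  rewrite alM ?(ltnW Mk)// big1// => m _.
  have -> : (m.+1 - `|k|%N)%N = 0%N by have := ltn_ord m; lia.
  by rewrite mul0r.
apply: majorized_sum => m; rewrite -[_ * `|_|]mulr1.
apply: majorizedZ; first by rewrite normc_def /= expr0n addr0 sqrtr_sqr normrM normr_nat.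
apply: (@majorized_le _ _ m.+1 _ 1); rewrite ?lexx//.
by apply: majorized_tri => //; have := ltn_ord m; lia.
Qed.

(** The power k^(-s) frozen below [N], which removes the singularity at zero, and lowered by a
    constant so that it vanishes from [M] on. The constant is added back as a separate
    multiplier. *)
Definition clamped_power s N M (k : nat) : R :=
  (minn M (maxn N k))%:R `^ (- s) - M%:R `^ (- s).

Lemma clamped_power_in s N M (k : nat) : (N <= k)%N -> (k <= M)%N ->
  clamped_power s N M k = k%:R `^ (- s) - M%:R `^ (- s).
Proof. by move=> Nk kM; rewrite /clamped_power (maxn_idPr Nk) (minn_idPr kM). Qed.

Lemma clamped_power_out s N M (k : nat) : (M <= k)%N -> clamped_power s N M k = 0.
Proof.
move=> Mk; rewrite /clamped_power (minn_idPl _) ?subrr//.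
exact: leq_trans (leq_maxr _ _).
Qed.

Lemma clamped_power_low s N M (k : nat) : (k <= N)%N -> (N <= M)%N ->
  clamped_power s N M k = N%:R `^ (- s) - M%:R `^ (- s).
Proof. by move=> kN NM; rewrite /clamped_power (maxn_idPl kN) (minn_idPr NM). Qed.

Lemma le_powRN s (a b : R) : 0 <= s -> 0 < a -> a <= b -> b `^ (- s) <= a `^ (- s) :> R.
Proof.
move=> s0 a0 ab; rewrite !powRN lef_pV2 ?posrE ?powR_gt0//; last exact: lt_le_trans ab.
by rewrite ge0_ler_powR// nnegrE ltW//; exact: lt_le_trans ab.
Qed.

(* AM-GM, together with [k (k + 2) <= (k + 1)^2] *)
Lemma powRN_midconvex s (k : nat) : 0 <= s -> (0 < k)%N ->
  2 * k.+1%:R `^ (- s) <= k%:R `^ (- s) + k.+2%:R `^ (- s) :> R.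
Proof.
move=> s0 k0; have k0R : (0 : R) < k%:R by rewrite ltr0n.
set u : R := k%:R `^ (- s / 2); set v : R := k.+2%:R `^ (- s / 2).
have E (x : R) : 0 < x -> x `^ (- s) = x `^ (- s / 2) ^+ 2.
  by move=> x0; rewrite expr2 -powRD -?splitr//; apply/implyP => _; exact: lt0r_neq0.
rewrite (E k%:R)// (E k.+2%:R) ?ltr0n//.
have : k.+1%:R `^ (- s) <= u * v.
  rewrite /u /v -powRM ?ler0n// E ?ltr0n// expr2 -powRM ?ler0n//.
  rewrite mulNr le_powRN ?divr_ge0 ?mulr_gt0 ?ltr0n//.
  by rewrite -!natrM ler_nat; lia.
by have := sqr_ge0 (u - v); rewrite -/u -/v; nra.
Qed.

(** From exp x >= 1 + x and ln (1 + x) <= x. It bounds the slope at [N], the only corner where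
    [clamped_power] is not convex. *)
Lemma powRN_step s N : 0 <= s -> (0 < N)%N ->
  N%:R * (N%:R `^ (- s) - N.+1%:R `^ (- s)) <= s * N%:R `^ (- s) :> R.
Proof.
move=> s0 N0; have N0R : (0 : R) < N%:R by rewrite ltr0n.
have -> : N.+1%:R `^ (- s) = N%:R `^ (- s) * (1 + N%:R^-1) `^ (- s) :> R.
  rewrite -powRM ?ler0n ?addr_ge0 ?invr_ge0//; congr (_ `^ _).
  by rewrite -natr1; field; rewrite gt_eqF.
have H : 1 - s / N%:R <= (1 + N%:R^-1) `^ (- s).
  rewrite /powR gt_eqF; last by rewrite addr_gt0 ?invr_gt0.
  have iN0 : (0 : R) < N%:R^-1 by rewrite invr_gt0.
  have /(ler_wpM2l s0) := @le_ln1Dx R N%:R^-1 (lt_trans (ltrN10 _) iN0).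
  have := expR_ge1Dx (- s * ln (1 + N%:R^-1)); nra.
have P0 : 0 <= N%:R `^ (- s) :> R := powR_ge0 _ _.
rewrite -[X in X - _]mulr1 -mulrBr mulrCA mulrC ler_wpM2r//.
rewrite -ler_pdivlMl// mulrC; lra.
Qed.

(** The second differences are nonnegative except at the corner [N]. Their signed weighted sum
    collapses to the value at 0, and replacing the one negative term by its modulus costs at most
    [2 * s] times N^(-s), by [powRN_step]. *)
Lemma majorized_clamped_power K s N M : 0 <= s -> (0 < N)%N -> (N < M)%N -> (M <= K.+1)%N ->
  majorized K M ((1 + 2 * s) * N%:R `^ (- s)) (fun k => (clamped_power s N M `|k|%N)%:C).
Proof.
move=> s0 N0 NM MK; set al := clamped_power s N M.
have alM (k : nat) : (M <= k)%N -> al k = 0 by exact: clamped_power_out.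
apply: majorized_le (majorized_even MK alM) => //.
pose d := N%:R `^ (- s) - N.+1%:R `^ (- s) : R.
have d0 : 0 <= d by rewrite subr_ge0 le_powRN ?ltr0n// ler_nat.
have mono (i j : nat) : (i <= j)%N -> (N <= i)%N -> (j <= M)%N -> al j <= al i.
  move=> ij Ni jM; rewrite /al !clamped_power_in ?lerD2r ?le_powRN ?ler_nat ?ltr0n//; lia.
have key m : `|al m - 2 * al m.+1 + al m.+2| <=
    (al m - 2 * al m.+1 + al m.+2) + 2 * d *+ (m.+1 == N).
  have [mN|mN] := eqVneq m.+1 N.
    have -> : al m - 2 * al m.+1 + al m.+2 = - d.
      rewrite /al (@clamped_power_low _ _ _ m) ?(@clamped_power_low _ _ _ m.+1); try lia.
      by rewrite mN clamped_power_in; [rewrite /d; ring|lia|lia].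
    rewrite normrN ger0_norm// mulr1n; lra.
  rewrite mulr0n addr0 ger0_norm// /al.
  have [m2N|Nm] := leqP m.+2 N.
    by rewrite !clamped_power_low; try lia; lra.
  have Nm' : (N <= m)%N by lia.
  have [mM|Mm] := leqP m.+2 M.
    rewrite !clamped_power_in; try lia.
    have := @powRN_midconvex s m s0; have : (0 < m)%N by lia.
    by move=> -> /(_ isT); lra.
  rewrite [X in _ + X]clamped_power_out; last by lia.
  rewrite [X in _ - 2 * X]clamped_power_out; last by lia.
  have [mM|Mm'] := leqP m M.
    by have := mono m M mM Nm' (leqnn _); rewrite alM// /al; lra.
  by rewrite clamped_power_out ?(ltnW Mm')//; lra.
apply: (@le_trans _ _ (\sum_(m < M) (m.+1%:R * (al m - 2 * al m.+1 + al m.+2) +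
    m.+1%:R * (2 * d *+ (m.+1 == N))))).
  by apply: ler_sum => m _; rewrite -mulrDr ler_wpM2l.
rewrite big_split /=.
have -> : \sum_(m < M) m.+1%:R * (al m - 2 * al m.+1 + al m.+2) = al 0%N.
  by have := @abel_twice al M 0 isT; rewrite (alM M)// (alM M.+1)// !mulr0 addr0 subr0 => <-.
have NM' : (N.-1 < M)%N by lia.
rewrite (bigD1 (Ordinal NM'))//= prednK// eqxx big1; last first.
  move=> m; rewrite -val_eqE /= => mN; case: eqP => [e|_]; last by rewrite mulr0n mulr0.
  by move: mN; rewrite -e /= eqxx.
rewrite mulr1n addr0 /al clamped_power_low ?(ltnW NM)//.
have := powRN_step s0 N0; rewrite -/d => H.
have : 0 <= M%:R `^ (- s) :> R := powR_ge0 _ _.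
lra.
Qed.

End triangles.

(** * De la Vallee Poussin multipliers and Weyl factors *)

Section multipliers.
Variable R : realType.
Notation C := R[i].
Notation tri := (@tri R).
Implicit Types (K m n N M : nat) (k c : int) (r s t : R).

Lemma majorized_weaken K m m' (A A' : R) (a b : int -> C) : majorized K m A a ->
  (m <= m')%N -> A <= A' -> (forall k, a k = b k) -> majorized K m' A' b.
Proof. by move=> H mm' AA' ab; apply: majorized_ext (majorized_le mm' AA' H). Qed.

(** De la Vallee Poussin coefficients, equal to 1 up to 2^(m-1) and to 0 from 2^m on; at [m = 0]
    only frequency zero is kept. *)
Definition tau m k : R :=
  if m is m'.+1 then 2 * tri (2 ^ m) k - tri (2 ^ m') k else tri 1 k.

(** The positive half of [tau m.+1 - tau m]. For m >= 1 it is the piecewise linear hat that is 0 at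
    2^(m-1), 1 at 2^m and 0 at 2^(m+1); it is written with shifted triangles so that [majorized_tri]
    applies. *)
Definition hat m k : R :=
  if m is m'.+1 then tri (2 ^ m) (k - (2 ^ m)%N%:Z) - tri (2 ^ m') (k - (2 ^ m')%N%:Z) / 2
  else tri 1 (k - 1).

Lemma tau1 m k : (`|k| <= 2 ^ m.-1)%N -> (0 < m)%N -> tau m k = 1.
Proof.
case: m => //= m km _; have m0 : (0 < 2 ^ m)%N by rewrite expn_gt0.
rewrite /tau !tri_in ?expn_gt0//; last by rewrite expnS; lia.
rewrite expnS natrM; field.
by rewrite pnatr_eq0 -lt0n.
Qed.

Lemma tau_out m k : (2 ^ m <= `|k|)%N -> tau m k = 0.
Proof.
case: m => [|m] km; rewrite /tau tri_out// mulr0 tri_out ?subrr//.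
by apply: leq_trans km; rewrite leq_exp2l.
Qed.

Lemma tauN m k : tau m (- k) = tau m k.
Proof. by case: m => [|m]; rewrite /tau !triN. Qed.

Lemma tau_step m k : tau m.+1 k - tau m k = hat m k + hat m (- k).
Proof.
wlog k0 : k / 0 <= k => [H|].
  have [/H//|/ltW k0] := leP 0 k.
  by rewrite -(tauN m.+1) -(tauN m) H ?oppr_ge0// opprK addrC.
case: k k0 => // x _; case: m => [|m].
  rewrite /tau /hat expn1 expn0.
  case: x => [|[|x]].
  - by rewrite /tri /= !subn0 subnn; field.
  - by rewrite (@tri_out _ _ (- 1%:Z - 1))// !tri_in// ?subrr ?absz0 ?absz1; field.
  - by rewrite !tri_out; try lia; ring.
rewrite /tau /hat; have : (0 < 2 ^ m)%N by rewrite expn_gt0.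
rewrite !expnS; move: (2 ^ m)%N => n n0.
rewrite (@tri_out _ _ (- x%:Z - _)); last by lia.
rewrite (@tri_out _ _ (- x%:Z - _)); last by lia.
rewrite mul0r !subr0 addr0.
have nR : (n%:R : R) != 0 by rewrite pnatr_eq0 -lt0n.
(* Both sides are piecewise linear in [x] with breaks at n, 2n and 4n, and are compared on each
   piece. *)
have [xn|nx] := leqP x n.

  rewrite !tri_in; try lia.
  have -> : (`|(x%:Z - n%:Z)%R| = n - x)%N by lia.
  have -> : (`|(x%:Z - (2 * n)%N%:Z)%R| = 2 * n - x)%N by lia.
  by rewrite /= !natrB ?natrM; try lia; field.
rewrite (@tri_out _ n x); last by lia.
have [x2n|n2x] := leqP x (2 * n).
  rewrite !tri_in; try lia.
  have -> : (`|(x%:Z - n%:Z)%R| = x - n)%N by lia.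
  have -> : (`|(x%:Z - (2 * n)%N%:Z)%R| = 2 * n - x)%N by lia.
  by rewrite /= !natrB ?natrM; try lia; field.
rewrite (@tri_out _ (2 * n) x); last by lia.
rewrite (@tri_out _ n (x%:Z - n%:Z)); last by lia.
have [x4n|n4x] := leqP x (2 * (2 * n)).
  rewrite !tri_in; try lia.
  have -> : (`|(x%:Z - (2 * n)%N%:Z)%R| = x - 2 * n)%N by lia.
  by rewrite /= !natrB ?natrM; try lia; field.
rewrite !tri_out; try lia.
by ring.
Qed.

Lemma hat_out m k : ~~ ((2 ^ m.-1)%N%:Z <= k <= (2 ^ m.+1)%N%:Z) -> hat m k = 0.
Proof.
rewrite /hat; case: m => [|m] /=.
  by rewrite expn0 expn1 => H; rewrite tri_out//; lia.
rewrite !expnS; have : (0 < 2 ^ m)%N by rewrite expn_gt0.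
move: (2 ^ m)%N => n n0 H.
have [nk|kn] := leP n%:Z k.
  by rewrite !tri_out ?mul0r ?subr0//; lia.
have nR : (n%:R : R) != 0 by rewrite pnatr_eq0 -lt0n.
have [k0|k0] := leP k 0.
  by rewrite !tri_out ?mul0r ?subr0//; lia.
case: k H kn k0 => // x H kn k0.
rewrite !tri_in; try lia.
have -> : (`|(x%:Z - n%:Z)%R| = n - x)%N by lia.
have -> : (`|(x%:Z - (2 * n)%N%:Z)%R| = 2 * n - x)%N by lia.
by rewrite /= !natrB ?natrM; try lia; field.
Qed.

Lemma majorized_tau K m : (2 ^ m <= K.+1)%N -> majorized K (2 ^ m) 3 (fun k => (tau m k)%:C).
Proof.
case: m => [|m] mK.
  apply: (@majorized_le _ _ 1 _ 1); rewrite ?ler1n//.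
  apply: majorized_ext (@majorized_tri _ K 1 0 isT _) => [k _|]; first by rewrite subr0.
  by rewrite absz0 add0n.
have m0 : (0 < 2 ^ m)%N by rewrite expn_gt0.
have mm : (2 ^ m <= 2 ^ m.+1)%N by rewrite expnS; lia.
have H1 : majorized K (2 ^ m.+1) (2 * 1) (fun k => 2%:R%:C * (tri (2 ^ m.+1) (k - 0))%:C).
  apply: majorizedZ; first by rewrite rmorph_nat normr_nat.
  by apply: majorized_tri; rewrite ?expn_gt0.
have H2 : majorized K (2 ^ m.+1) (1 * 1) (fun k => - 1 * (tri (2 ^ m) (k - 0))%:C).
  apply: majorizedZ; first by rewrite normrN1.
  apply: (@majorized_le _ _ (2 ^ m) _ 1) => //.
  by apply: majorized_tri => //; rewrite absz0 add0n; exact: leq_trans mK.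
apply: majorized_weaken (majorizedD H1 H2) _ _ _; [exact: leqnn|by lra|].
by move=> k; rewrite !subr0 /tau [in RHS]rmorphB [in RHS]rmorphM mulN1r.
Qed.

Lemma majorized_hat K m : (2 ^ m.+1 <= K.+1)%N ->
  majorized K (2 ^ m.+1) (3 / 2) (fun k => (hat m k)%:C) /\
  majorized K (2 ^ m.+1) (3 / 2) (fun k => (hat m (- k))%:C).
Proof.
have T c n : (0 < n)%N -> (`|c| + n <= K.+1)%N ->
    majorized K n 1 (fun k => (tri n (k - c))%:C) /\
    majorized K n 1 (fun k => (tri n (- k - c))%:C).
  move=> n0 h; split; first exact: majorized_tri.
  apply: majorized_ext (@majorized_tri _ K n (- c) n0 _) => [k _|]; last by rewrite abszN.
  by rewrite /= -triN; congr (tri n _)%:C; ring.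
case: m => [|m] mK.
  have [|T1 T2] := T 1 1%N isT; first by rewrite absz1; move: mK; rewrite expn1.
  by split; apply: (@majorized_le _ _ 1 _ 1) => //; lra.
have m0 : (0 < 2 ^ m)%N by rewrite expn_gt0.
have [||T1 T1'] := T (2 ^ m.+1)%N (2 ^ m.+1)%N; rewrite ?expn_gt0//.
  by move: mK; rewrite !expnS /=; lia.
have [||T2 T2'] := T (2 ^ m)%N (2 ^ m)%N; rewrite ?expn_gt0//.
  by move: mK; rewrite !expnS /=; lia.
have L1 : (2 ^ m.+1 <= 2 ^ m.+2)%N by rewrite !expnS; lia.
have L2 : (2 ^ m <= 2 ^ m.+2)%N by rewrite !expnS; lia.
have Hc : `|(- 2^-1 : R)%:C| <= (2^-1 : R)%:C :> C.
  by rewrite normc_def /= expr0n addr0 sqrtr_sqr normrN ger0_norm.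
split.
  have H1 := majorized_le L1 (lexx _) T1.
  have H2 := majorizedZ Hc (majorized_le L2 (lexx _) T2).
  apply: majorized_weaken (majorizedD H1 H2) _ _ _; [exact: leqnn|by lra|].
  by move=> k; rewrite -rmorphM -rmorphD; congr (_%:C); rewrite /hat; field.
have H1 := majorized_le L1 (lexx _) T1'.
have H2 := majorizedZ Hc (majorized_le L2 (lexx _) T2').
apply: majorized_weaken (majorizedD H1 H2) _ _ _; [exact: leqnn|by lra|].
by move=> k; rewrite -rmorphM -rmorphD; congr (_%:C); rewrite /hat; field.
Qed.

Lemma weyl_factor_pos r (k : nat) : (0 < k)%N ->
  weyl_factor r k = (k%:R `^ r)%:C * expi (pi * r / 2).
Proof.
by move=> k0; rewrite /weyl_factor gtr0_sg ?ltz_nat// mul1r -pmulrn ger0_norm.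
Qed.

Lemma weyl_factor_neg r (k : nat) : (0 < k)%N ->
  weyl_factor r (- k%:Z) = (k%:R `^ r)%:C * expi (- (pi * r / 2)).
Proof.
move=> k0; rewrite /weyl_factor sgrN gtr0_sg ?ltz_nat// mulN1r.
by rewrite mulrNz normrN -pmulrn ger0_norm.
Qed.

(** The two halves of the hat have total mass 3. This is multiplied by (1 + 2r) for the clamped
    power plus 1 for the constant restored, and 2^r comes from the lower end 2^(m-1) of the
    support. *)
Definition tau_const r : R := 6 * (1 + r) * 2 `^ r.

(** On each half of the frequencies the inverse Weyl factor is |k|^(-r) times a constant phase, so
    the step is the product of two half hats, carrying their phases, with a function that agrees
    with |k|^(-r) on their support. *)
Lemma majorized_tau_step K m r : 0 < r -> (2 ^ m.+1 <= K.+1)%N ->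
  majorized K (2 ^ m.+1) (tau_const r * (2 ^ m)%N%:R `^ (- r))
   (fun k => (tau m.+1 k - tau m k)%:C * (weyl_factor r k)^-1).
Proof.
move=> r0 mK; have [H1 H2] := majorized_hat mK.
set N := (2 ^ m.-1)%N; set M := (2 ^ m.+1)%N.
have N0 : (0 < N)%N by rewrite expn_gt0.
have NM : (N < M)%N by rewrite ltn_exp2l//; lia.
pose th : R := pi * r / 2.
have E1 := @majorizedZ _ _ _ _ _ (expi (- th)) 1 _ H1.
have E2 := @majorizedZ _ _ _ _ _ (expi th) 1 _ H2.
have H := majorizedD (E1 _) (E2 _); rewrite !norm_expi !mul1r in H.
have {E1 E2}H := H (lexx _) (lexx _).
have HW := majorizedM H (majorized_clamped_power (ltW r0) N0 NM mK).
have MR : `|(M%:R `^ (- r))%:C| <= (M%:R `^ (- r))%:C :> C.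
  by rewrite ger0_norm ?ler0c ?powR_ge0.
have HM := majorizedZ MR H.
apply: majorized_weaken (majorizedD HW HM) _ _ _ => //.
  have -> : tau_const r * (2 ^ m)%N%:R `^ (- r) =
      6 * (1 + r) * ((2 ^ m)%N%:R / 2) `^ (- r).
    rewrite /tau_const powRM ?invr_ge0 ?ler0n//.
    rewrite -powR_inv1 ?ler0n// -powRrM mulN1r opprK; ring.
  have P1 : N%:R `^ (- r) <= ((2 ^ m)%N%:R / 2) `^ (- r) :> R.
    rewrite le_powRN ?(ltW r0) ?divr_gt0 ?ltr0n ?expn_gt0//.
    rewrite ler_pdivrMr ?ltr0n// -natrM ler_nat /N; case: (m) => [|m'] //=.
    by rewrite expnS mulnC.
  have P2 : M%:R `^ (- r) <= N%:R `^ (- r) :> R.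
    by rewrite le_powRN ?(ltW r0) ?ltr0n ?ler_nat ?(ltnW NM).
  by nra.
move=> k.
(* On the support of the hat the constant subtracted in [clamped_power] is restored; outside it both
   sides vanish. *)
have key j : (hat m j)%:C * (clamped_power r N M `|j|%N)%:C
     + (M%:R `^ (- r))%:C * (hat m j)%:C = (hat m j)%:C * ((`|j|%N)%:R `^ (- r))%:C.
  have [/andP[Nj jM]|/hat_out ->] := boolP ((2 ^ m.-1)%N%:Z <= j <= (2 ^ m.+1)%N%:Z).
    rewrite clamped_power_in; [|by rewrite /N; lia|by rewrite /M; lia].
    by rewrite rmorphB; ring.
  by rewrite !mul0r mulr0 addr0.
rewrite tau_step [in RHS]rmorphD.
case: (ltgtP k 0) => [k0|k0|->].
- have Z : hat m k = 0 by apply: hat_out; rewrite negb_and -!ltNge; apply/orP; left; apply: lt_le_trans k0 _.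
  have [x kx x0] : exists2 x : nat, k = - x%:Z & (0 < x)%N by exists `|k|%N; lia.
  have kk : (hat m x)%:C * (clamped_power r N M x)%:C + (M%:R `^ (- r))%:C * (hat m x)%:C =
    (hat m x)%:C * (x%:R `^ (- r))%:C := key x.
  rewrite Z {Z}kx opprK weyl_factor_neg// abszN.
  rewrite !mulr0 !add0r invfM -(rmorphV (real_complex R)) ?unitfE ?gt_eqF ?powR_gt0 ?ltr0n//.
  rewrite -powRN -(conjc_expi (pi * r / 2)) -/th.
  have -> : ((expi th)^* )^-1 = expi th :> C.
    apply: (mulIf (expi_neq0 (- th))).
    by rewrite -conjc_expi mulVf ?conjc_eq0 ?expi_neq0// conjc_expi -expiD subrr expi0.
  by rewrite [RHS]mulrA -kk; ring.
- have Z : hat m (- k) = 0 by apply: hat_out; rewrite negb_and -!ltNge; apply/orP; left; rewrite ltrNl; apply: le_lt_trans k0; rewrite oppr_le0.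
  have [x kx x0] : exists2 x : nat, k = x%:Z & (0 < x)%N by exists `|k|%N; lia.
  have kk : (hat m x)%:C * (clamped_power r N M x)%:C + (M%:R `^ (- r))%:C * (hat m x)%:C =
    (hat m x)%:C * (x%:R `^ (- r))%:C := key x.
  rewrite Z {Z}kx weyl_factor_pos//.
  rewrite !mulr0 !addr0 invfM -(rmorphV (real_complex R)) ?unitfE ?gt_eqF ?powR_gt0 ?ltr0n//.
  rewrite -powRN -/th.
  have -> : (expi th)^-1 = expi (- th) :> C.
    by apply: (mulIf (expi_neq0 th)); rewrite mulVf ?expi_neq0// -expiD addNr expi0.
  by rewrite [RHS]mulrA -kk; ring.
- have Z : hat m 0 = 0 by apply: hat_out; move: N0; rewrite /N; lia.
  by rewrite oppr0 Z !mulr0 !addr0 !mul0r mulr0 addr0.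
Qed.

(** For |k| <= X one has |k| = X (1 - tri X k), so multiplying by |k| amounts to subtracting the
    product with a triangle and scaling by [X]. *)
Lemma majorized_mul_abs K m X A (b : int -> C) : (0 < X)%N -> (X <= K.+1)%N -> (X <= m)%N ->
  (forall k, (X < `|k|)%N -> b k = 0) -> majorized K m A b ->
  majorized K m (2 * X%:R * A) (fun k => (`|k|%N)%:R * b k).
Proof.
move=> X0 XK Xm bX bA.
have T := majorized_le Xm (lexx _) (@majorized_tri R K X 0 X0 XK).
have Xb : `|(X%:R : C)| <= X%:R%:C by rewrite normr_nat rmorph_nat.
have NXb : `|(- X%:R : C)| <= X%:R%:C by rewrite normrN normr_nat rmorph_nat.
have H := majorizedD (majorizedZ Xb bA) (majorizedZ NXb (majorizedM T bA)).
apply: majorized_weaken H _ _ _; [exact: leqnn|by lra|] => k.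
have [kX|/bX ->] := leqP `|k|%N X; last by rewrite !mulr0 addr0.
rewrite subr0 tri_in// rmorphB rmorphM fmorphV !rmorph_nat rmorph1; field.
by rewrite pnatr_eq0 -lt0n.
Qed.

(** With L the integer [(Num.truncn r).+1] and s = L - r: the factor 6^L comes from L
    multiplications by |k| at cost 2 (3N) each, and 2 + 2s from the power k^(-s). *)
Definition weyl_const r : R := 6 ^+ (Num.truncn r).+1 * (2 + 2 * ((Num.truncn r).+1%:R - r)).

(** Clamped powers give negative exponents only, so |k|^r is written |k|^L |k|^(-s) with L an
    integer above r; the integer power is built by [majorized_mul_abs]. The triangle lives strictly
    between N and 3N, where the phase of the Weyl factor is constant. *)
Lemma majorized_weyl K N r : (0 < N)%N -> (3 * N <= K.+1)%N -> 0 < r ->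
  majorized K (3 * N) (weyl_const r * N%:R `^ r)
    (fun k => (tri N (k - (2 * N)%N%:Z))%:C * weyl_factor r k).
Proof.
move=> N0 NK r0; set L := (Num.truncn r).+1; set s := L%:R - r.
have s0 : 0 < s by rewrite subr_gt0 truncnS_gt.
have N0R : (0 : R) < N%:R by rewrite ltr0n.
pose a k := (tri N (k - (2 * N)%N%:Z))%:C.
have aP k : a k = 0 \/ exists2 x : nat, k = x%:Z & (N < x < 3 * N)%N.
  have [nk|kn] := leqP N `|(k - (2 * N)%N%:Z)%R|%N.
    by left; rewrite /a tri_out.
  by right; exists `|k|%N; lia.
have Ha : majorized K (3 * N) 1 a.
  apply: (@majorized_le _ _ N _ 1) => //; first by lia.
  by apply: majorized_tri => //; rewrite absz_nat; lia.
pose b k := ((`|k|%N)%:R `^ (- s))%:C * a k.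
have Hb : majorized K (3 * N) ((2 + 2 * s) * N%:R `^ (- s)) b.
  have W := majorized_clamped_power (ltW s0) N0 (_ : (N < 3 * N)%N) NK.
  have MR : `|((3 * N)%N%:R `^ (- s))%:C| <= ((3 * N)%N%:R `^ (- s))%:C :> C.
    by rewrite ger0_norm ?ler0c ?powR_ge0.
  have H := majorizedD (majorizedM (W _) Ha) (majorizedZ MR Ha).
  apply: majorized_weaken (H _) _ _ _; [lia|exact: leqnn| |].
    have : (3 * N)%N%:R `^ (- s) <= N%:R `^ (- s) :> R.
      by rewrite le_powRN ?(ltW s0) ?ler_nat ?leq_pmull.
    lra.
  move=> k; case: (aP k) => [e|[x -> /andP[Nx xN]]]; first by rewrite /b e !mulr0 addr0.
  by rewrite /b clamped_power_in ?(ltnW Nx) ?(ltnW xN)// rmorphB absz_nat; ring.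
have HL n : majorized K (3 * N) ((2 * (3 * N)%N%:R) ^+ n * ((2 + 2 * s) * N%:R `^ (- s)))
    (fun k => (`|k|%N)%:R ^+ n * b k).
  elim: n => [|n IH].
    by apply: majorized_weaken Hb _ _ _ => [//||k]; rewrite expr0 mul1r.
  have N3 : (0 < 3 * N)%N by lia.
  have out k : (3 * N < `|k|)%N -> (`|k|%N)%:R ^+ n * b k = 0.
    case: (aP k) => [e _|[x -> /andP[Nx xN]]]; first by rewrite /b e !mulr0.
    by rewrite absz_nat ltnNge ltnW.
  have H := majorized_mul_abs N3 NK (leqnn _) out IH.
  apply: majorized_weaken H _ _ _ => [//||k]; first by rewrite exprS -[leRHS]mulrA.
  by rewrite exprS -[RHS]mulrA.
have E1 : `|expi (pi * r / 2) : C| <= 1%:C by rewrite norm_expi.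
apply: majorized_weaken (majorizedZ E1 (HL L)) _ _ _; [exact: leqnn| |].
  rewrite mul1r /weyl_const -/L -/s le_eqVlt; apply/orP; left; apply/eqP.
  have -> : N%:R `^ r = N%:R ^+ L * N%:R `^ (- s) :> R.
    rewrite -powR_mulrn ?ler0n// -powRD; first by congr (_ `^ _); rewrite /s; ring.
    by apply/implyP => _; exact: lt0r_neq0.
  have -> : (2 * (3 * N)%N%:R) ^+ L = 6 ^+ L * N%:R ^+ L :> R.
    by rewrite -exprMn natrM; congr (_ ^+ _); ring.
  by ring.
move=> k; case: (aP k) => [e|[x -> /andP[Nx xN]]]; first by rewrite /b -/(a k) e !mulr0 mul0r.
have x0 : (0 < x)%N by exact: leq_ltn_trans Nx.
have x0R : (0 : R) < x%:R by rewrite ltr0n.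
rewrite -/(a x) weyl_factor_pos// /b !absz_nat -(rmorph_nat (real_complex R)) -rmorphXn/=.
have -> : x%:R `^ r = x%:R ^+ L * x%:R `^ (- s) :> R.
  rewrite -powR_mulrn ?ler0n// -powRD; first by congr (_ `^ _); rewrite /s; ring.
  by apply/implyP => _; exact: lt0r_neq0.
by rewrite rmorphM; ring.
Qed.

End multipliers.

(** * Integration on the torus *)

Section torus_measure_theory.
Variable R : realType.
Local Notation mT := (measurableTypeR R).
Local Notation m1 := (mfrestr (@measurable_period_interval R) (@period_interval_lty R)).
Implicit Types (d : nat).

Lemma bounded_integrable dd (T : measurableType dd) (mu : {finite_measure set T -> \bar R})
    (f : T -> R) M : measurable_fun setT f -> (forall x, `|f x| <= M) ->
  mu.-integrable setT (EFin \o f).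
Proof.
move=> mf fM; apply: measurable_bounded_integrable => //.
  by rewrite -ge0_fin_numE// fin_num_measure.
exists M; split; first exact: num_real.
by move=> y My x _; exact: le_trans (fM x) (ltW My).
Qed.

Lemma integral_period (f : mT -> R) M : measurable_fun setT f -> (forall x, `|f x| <= M) ->
  (\int[m1]_x (f x)%:E = \int[lebesgue_measure]_(x in `[0%R, (2 * pi)%R]) (f x)%:E)%E.
Proof.
move=> mf fM.
have mI : measurable (`[0%R, (2 * pi)%R] : set mT) by exact: measurable_itv.
rewrite (@negligible_integral _ _ _ m1 setT (~` `[0%R, (2 * pi)%R])) //.
- rewrite setTD setCK; apply: eq_measure_integral => A mA AI.
  by rewrite /= /mfrestr /mrestr /period_interval setIidl.
- exact: measurableC.
- exact: bounded_integrable fM.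
- by rewrite /= /mfrestr /mrestr /period_interval setICl measure0.
Qed.

Lemma integral_period_deriv (F f : R -> R) M : (forall t : R, is_derive t 1 F (f t)) ->
  continuous f -> (forall x, `|f x| <= M) -> F (2 * pi) = F 0 ->
  (\int[m1]_x (f x)%:E = 0)%E.
Proof.
move=> Ff cf fM F0.
have cF : continuous F.
  by move=> x; apply/differentiable_continuous/derivable1_diffP; have [] := Ff x.
rewrite (integral_period (M := M))//; last exact: continuous_measurable_fun.
rewrite (@continuous_FTC2 _ f F)//.
- by rewrite F0 subee.
- by rewrite mulr_gt0 ?pi_gt0.
- exact: continuous_subspaceT.
- split.
  + by move=> x _; have [] := Ff x.
  + by apply: cvg_at_right_filter; exact: cF.
  + by apply: cvg_at_left_filter; exact: cF.
- by move=> x _; rewrite derive1E; have [_ ->] := Ff x.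
Qed.

Section fubini.
Variables (d : nat) (h : d.+1.-tuple mT -> R) (M : R).
Hypothesis mh : measurable_fun setT h.
Hypothesis hM : forall x, `|h x| <= M.

Let prod_int :
  (m1 \x torus_measure R d)%E.-integrable setT (fun z => (h (cons_point z))%:E).
Proof.
have mf : measurable_fun setT (fun z => h (@cons_point _ mT d z)).
  by apply: measurableT_comp => //; exact: measurable_cons_point.
have fin : ((m1 \x torus_measure R d) setT < +oo)%E.
  rewrite -setXTT product_measure1E//.
  by rewrite lte_mul_pinfty ?fin_num_measure// ltey_eq fin_num_measure.
apply: measurable_bounded_integrable => //.
exists M; split; first exact: num_real.
by move=> y My x _; exact: le_trans (hM _) (ltW My).
Qed.

Let torus_cons : (\int[torus_measure R d.+1]_x (h x)%:E =
  \int[m1 \x torus_measure R d]_z (h (cons_point z))%:E)%E.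
Proof.
have -> : (\int[torus_measure R d.+1]_x (h x)%:E =
   \int[pushforward (m1 \x torus_measure R d) (@cons_point _ mT d)]_x (h x)%:E)%E by [].
pose phi : {mfun (mT * d.-tuple mT)%type >-> d.+1.-tuple mT} :=
  HB.pack (@cons_point _ mT d) (isMeasurableFun.Build _ _ _ _ _ (@measurable_cons_point _ mT d)).
rewrite (@integral_pushforward _ _ _ _ _ phi)//.
  exact/measurable_EFinP.
Qed.

Lemma torus_fubini1 : (\int[torus_measure R d.+1]_x (h x)%:E =
  \int[m1]_t \int[torus_measure R d]_x (h [tuple of t :: x])%:E)%E.
Proof. by rewrite torus_cons -integral12_prod_meas1. Qed.

Lemma torus_fubini2 : (\int[torus_measure R d.+1]_x (h x)%:E =
  \int[torus_measure R d]_x \int[m1]_t (h [tuple of t :: x])%:E)%E.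
Proof. by rewrite torus_cons -integral21_prod_meas1. Qed.

End fubini.

Definition set_coord d (x : d.-tuple mT) (j : 'I_d) (t : mT) : d.-tuple mT :=
  [tuple if i == j then t else tnth x i | i < d].

Lemma torus_integral_coord0 d (j : 'I_d) (h : d.-tuple mT -> R) M :
  measurable_fun setT h -> (forall x, `|h x| <= M) ->
  (forall x, \int[m1]_t (h (set_coord x j t))%:E = 0)%E ->
  (\int[torus_measure R d]_x (h x)%:E = 0)%E.
Proof.
elim: d j h => [[]//|d IH] j h mh hM h0.
have mcons t : measurable_fun setT (fun x : d.-tuple mT => [tuple of t :: x]).
  by apply: measurable_cons; [exact: measurable_cst|exact: measurable_id].
have [j' jE|jE] := unliftP ord0 j.
  rewrite (torus_fubini1 mh hM); apply: integral0_eq => t _.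
  apply: (IH j') => [|x|x]; first by apply: measurableT_comp.
    exact: hM.
  rewrite -[RHS](h0 [tuple of t :: x]); apply: eq_integral => s _; congr (h _)%:E.
  apply: eq_from_tnth => i; rewrite tnth_mktuple jE.
  have [i' ->|->] := unliftP ord0 i.
    by rewrite (inj_eq lift_inj) !tnthS tnth_mktuple.
  by rewrite !tnth0; case: eqP => // e; have := neq_lift ord0 j'; rewrite e eqxx.
rewrite (torus_fubini2 mh hM); apply: integral0_eq => x _.
rewrite -[RHS](h0 [tuple of 0 :: x]); apply: eq_integral => s _; congr (h _)%:E.
apply: eq_from_tnth => i; rewrite tnth_mktuple jE.
have [i' ->|->] := unliftP ord0 i; last by rewrite tnth0.
by rewrite !tnthS; case: eqP => // e; have := neq_lift ord0 i'; rewrite e eqxx.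
Qed.

Lemma torus_measureT d : (torus_measure R d setT = ((2 * pi) ^+ d)%:E)%E.
Proof.
elim: d => [|d IH].
  by rewrite /= diracE in_setT expr0.
have -> : torus_measure R d.+1 setT = (m1 \x torus_measure R d)%E setT by [].
transitivity (m1 setT * torus_measure R d setT)%E.
  by rewrite -setXTT product_measure1E.
rewrite IH /=.
rewrite /mfrestr /mrestr /period_interval setTI lebesgue_measure_itv /= lte_fin.
by rewrite mulr_gt0 ?pi_gt0// sube0 -EFinM exprS.
Qed.

End torus_measure_theory.

(** * Integrals of complex functions *)

Section complex_integral.
Variables (R : realType) (d : nat).
Local Notation mT := (measurableTypeR R).
Local Notation T := (d.-tuple mT).
Local Notation mu := (torus_measure R d).
Local Notation C := R[i].
Implicit Types (f g u : T -> C) (a z : C).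

Lemma complexP z w : complex.Re z = complex.Re w -> complex.Im z = complex.Im w -> z = w.
Proof. by case: z w => [? ?] [? ?] /= -> ->. Qed.

Lemma ReM z w : complex.Re (z * w) =
  complex.Re z * complex.Re w - complex.Im z * complex.Im w.
Proof. by case: z w => [? ?] [? ?]. Qed.

Lemma ImM z w : complex.Im (z * w) =
  complex.Re z * complex.Im w + complex.Im z * complex.Re w.
Proof. by case: z w => [? ?] [? ?]. Qed.

Lemma ReD z w : complex.Re (z + w) = complex.Re z + complex.Re w.
Proof. by case: z w => [? ?] [? ?]. Qed.

Lemma ImD z w : complex.Im (z + w) = complex.Im z + complex.Im w.
Proof. by case: z w => [? ?] [? ?]. Qed.

Lemma Re_le_normc z : `|complex.Re z| <= Normc.normc z.
Proof. by rewrite -lecR; exact: normc_ge_Re. Qed.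

Lemma Im_le_normc z : `|complex.Im z| <= Normc.normc z.
Proof.
have := Re_le_normc (z * 'i); rewrite ReiNIm normrN Normc.normcM.
by rewrite {2}/Normc.normc /= expr0n add0r expr1n sqrtr1 mulr1.
Qed.

Lemma normc_ge0 z : 0 <= Normc.normc z.
Proof. exact: le_trans (normr_ge0 _) (Re_le_normc z). Qed.

Lemma normc_le z : Normc.normc z <= `|complex.Re z| + `|complex.Im z|.
Proof.
rewrite -ler_sqr ?nnegrE ?normc_ge0 ?addr_ge0//.
case: z => x y /=; rewrite sqr_sqrtr ?addr_ge0 ?sqr_ge0// sqrrD !real_normK ?num_real//.
by have : 0 <= `|x| * `|y| by []; lra.
Qed.

Definition cmeas g := measurable_fun setT (fun x => complex.Re (g x)) /\
  measurable_fun setT (fun x => complex.Im (g x)).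

Definition cintegrable g :=
  mu.-integrable setT (EFin \o (fun x => complex.Re (g x))) /\
  mu.-integrable setT (EFin \o (fun x => complex.Im (g x))).

Lemma cmeasD f g : cmeas f -> cmeas g -> cmeas (fun x => f x + g x).
Proof.
move=> [f1 f2] [g1 g2]; split.
- by under eq_fun do rewrite ReD; exact: measurable_funD.
- by under eq_fun do rewrite ImD; exact: measurable_funD.
Qed.

Lemma cmeasM f g : cmeas f -> cmeas g -> cmeas (fun x => f x * g x).
Proof.
move=> [f1 f2] [g1 g2]; split.
- by under eq_fun do rewrite ReM; apply: measurable_funB; exact: measurable_funM.
- by under eq_fun do rewrite ImM; apply: measurable_funD; exact: measurable_funM.
Qed.

Lemma cmeas_cst a : cmeas (fun=> a).
Proof. by split; exact: measurable_cst. Qed.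

Lemma cmeas_sum I (s : seq I) (F : I -> T -> C) : (forall i, cmeas (F i)) ->
  cmeas (fun x => \sum_(i <- s) F i x).
Proof.
move=> mF; elim: s => [|i s IH].
  by under [X in cmeas X]eq_fun do rewrite big_nil; exact: cmeas_cst.
by under [X in cmeas X]eq_fun do rewrite big_cons; exact: cmeasD.
Qed.

Lemma measurable_normc g : cmeas g -> measurable_fun setT (fun x => Normc.normc (g x)).
Proof.
move=> [m1 m2].
have -> : (fun x => Normc.normc (g x)) =
    (fun x => Num.sqrt (complex.Re (g x) ^+ 2 + complex.Im (g x) ^+ 2)).
  by apply/funext => x; case: (g x).
apply: (measurableT_comp (f := @Num.sqrt R)).
  exact: continuous_measurable_fun (@sqrt_continuous R).
by apply: measurable_funD; exact: measurable_funX.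
Qed.

Lemma cintegrable_cmeas g : cintegrable g -> cmeas g.
Proof. by move=> [/measurable_int/measurable_EFinP ? /measurable_int/measurable_EFinP ?]. Qed.

Lemma cintegrable_le f (b : T -> R) : cmeas f -> mu.-integrable setT (EFin \o b) ->
  (forall x, Normc.normc (f x) <= b x) -> cintegrable f.
Proof.
move=> [m1 m2] ib fb; split; apply: (le_integrable _ _ _ ib) => //=; try exact/measurable_EFinP.
- by move=> x _; rewrite lee_fin (le_trans (Re_le_normc _))// (le_trans (fb x))// ler_norm.
- by move=> x _; rewrite lee_fin (le_trans (Im_le_normc _))// (le_trans (fb x))// ler_norm.
Qed.

Lemma bounded_cintegrable f M : cmeas f -> (forall x, Normc.normc (f x) <= M) -> cintegrable f.
Proof.
move=> mf fM; apply: (@cintegrable_le _ (fun=> M)) => //.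
exact: (@bounded_integrable _ _ _ _ (fun=> M) `|M|).
Qed.

Lemma integrable_normc g : cintegrable g ->
  mu.-integrable setT (EFin \o (fun x => Normc.normc (g x))).
Proof.
move=> ig; have [i1 i2] := ig.
have h : mu.-integrable setT (EFin \o (fun x => `|complex.Re (g x)| + `|complex.Im (g x)|)).
  have := integrableD measurableT (integrable_norm i1) (integrable_norm i2).
  exact: eq_integrable.
apply: (le_integrable _ _ _ h) => //.
  by apply/measurable_EFinP; exact: (measurable_normc (cintegrable_cmeas ig)).
move=> x _;
  change (`|Normc.normc (g x)|%:E <= `|(`|complex.Re (g x)| + `|complex.Im (g x)|)|%:E)%E.
rewrite lee_fin (ger0_norm (normc_ge0 _)) (ger0_norm (addr_ge0 (normr_ge0 _) (normr_ge0 _))).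
exact: normc_le.
Qed.

Lemma cintegrableM g u M : cintegrable g -> cmeas u -> (forall x, Normc.normc (u x) <= M) ->
  cintegrable (fun x => g x * u x).
Proof.
move=> ig mu_ uM; apply: (@cintegrable_le _ (fun x => Normc.normc (g x) * M)).
- by apply: cmeasM => //; exact: cintegrable_cmeas.
- have := integrableZl measurableT M (integrable_normc ig).
  by under [in X in X -> _]eq_fun do rewrite /= -EFinM mulrC.
- by move=> x; rewrite Normc.normcM ler_wpM2l ?normc_ge0.
Qed.

Lemma cintegrable_lin f g a : cintegrable f -> cintegrable g ->
  cintegrable (fun x => a * f x + g x).
Proof.
move=> fi gi; have mf := cintegrable_cmeas fi; have mg := cintegrable_cmeas gi.
apply: (@cintegrable_le _ (fun x => Normc.normc a * Normc.normc (f x) + Normc.normc (g x))).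
- by apply: cmeasD => //; apply: cmeasM => //; exact: cmeas_cst.
- have h1 := integrableZl measurableT (Normc.normc a) (integrable_normc fi).
  have := integrableD measurableT h1 (integrable_normc gi).
  exact: eq_integrable.
- move=> x; rewrite -Normc.normcM; exact: le_normcD.
Qed.

Lemma torus_integral_lin f g a : cintegrable f -> cintegrable g ->
  torus_integral (fun x => a * f x + g x) = a * torus_integral f + torus_integral g.
Proof.
move=> [f1 f2] [g1 g2]; apply: complexP.
- rewrite ReD ReM /=; under eq_Rintegral do rewrite ReD ReM.
  have i1 := integrableZl measurableT (complex.Re a) f1.
  have i2 := integrableZl measurableT (complex.Im a) f2.
  rewrite RintegralD//; last exact: (integrableB measurableT i1 i2).
  by rewrite RintegralB// !RintegralZl.
- rewrite ImD ImM /=; under eq_Rintegral do rewrite ImD ImM.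
  have i1 := integrableZl measurableT (complex.Re a) f2.
  have i2 := integrableZl measurableT (complex.Im a) f1.
  rewrite RintegralD//; last exact: (integrableD measurableT i1 i2).
  by rewrite RintegralD// !RintegralZl.
Qed.

Lemma cintegrable0 : cintegrable (fun=> 0).
Proof.
by apply: (@bounded_cintegrable _ 0); [exact: cmeas_cst|move=> x; rewrite Normc.normc0].
Qed.

Lemma torus_integral0 : torus_integral (fun _ : T => (0 : C)) = 0.
Proof. by apply: complexP; rewrite /= Rintegral_cst// mul0r. Qed.

Lemma cintegrableZ f a : cintegrable f -> cintegrable (fun x => a * f x).
Proof.
move=> fi; have := cintegrable_lin a fi cintegrable0.
by congr cintegrable; apply/funext => x; rewrite addr0.
Qed.

Lemma torus_integralZ f a : cintegrable f ->
  torus_integral (fun x => a * f x) = a * torus_integral f.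
Proof.
move=> fi; have := torus_integral_lin a fi cintegrable0.
rewrite torus_integral0 addr0 => <-; congr torus_integral.
by apply/funext => x; rewrite addr0.
Qed.

Lemma cintegrableD f g : cintegrable f -> cintegrable g -> cintegrable (fun x => f x + g x).
Proof.
move=> fi gi; have := cintegrable_lin 1 fi gi.
by congr cintegrable; apply/funext => x; rewrite mul1r.
Qed.

Lemma torus_integralD f g : cintegrable f -> cintegrable g ->
  torus_integral (fun x => f x + g x) = torus_integral f + torus_integral g.
Proof.
move=> fi gi; have := torus_integral_lin 1 fi gi; rewrite mul1r => <-.
by congr torus_integral; apply/funext => x; rewrite mul1r.
Qed.

Lemma cintegrable_sum I (s : seq I) (F : I -> T -> C) : (forall i, cintegrable (F i)) ->
  cintegrable (fun x => \sum_(i <- s) F i x).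
Proof.
move=> mF; elim: s => [|i s IH].
  by under [X in cintegrable X]eq_fun do rewrite big_nil; exact: cintegrable0.
by under [X in cintegrable X]eq_fun do rewrite big_cons; exact: cintegrableD.
Qed.

Lemma torus_integral_sum I (s : seq I) (F : I -> T -> C) : (forall i, cintegrable (F i)) ->
  torus_integral (fun x => \sum_(i <- s) F i x) = \sum_(i <- s) torus_integral (F i).
Proof.
move=> mF; elim: s => [|i s IH].
  by under [X in torus_integral X]eq_fun do rewrite big_nil; rewrite big_nil torus_integral0.
under [X in torus_integral X]eq_fun do rewrite big_cons.
by rewrite torus_integralD ?big_cons ?IH//; exact: cintegrable_sum.
Qed.

(* Rotate the value of the integral onto the positive real axis. *)
Lemma normc_torus_integral f : cintegrable f ->
  Normc.normc (torus_integral f) <= \int[mu]_x Normc.normc (f x).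
Proof.
move=> fi; set z := torus_integral f.
have [->|z0] := eqVneq z 0.
  by rewrite Normc.normc0; apply: Rintegral_ge0 => x _; exact: normc_ge0.
pose w := `|z|^-1 * z^*.
have w1 : Normc.normc w = 1.
  by apply: complexI; rewrite -[LHS]/(`|w|) normrM normfV normr_id normcJ mulVf ?normr_eq0.
have wz : w * z = `|z|.
  by rewrite /w -mulrA [_^* * _]mulrC -sqr_normc expr2 mulKf// normr_eq0.
have -> : Normc.normc z = complex.Re (torus_integral (fun x => w * f x)).
  by rewrite torus_integralZ// wz.
apply: le_Rintegral => //.
- by have [] := cintegrableZ w fi.
- exact: integrable_normc.
- move=> x _; apply: le_trans (ler_norm _) _; apply: le_trans (Re_le_normc _) _.
  by rewrite Normc.normcM w1 mul1r.
Qed.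

Section measurable_continuous.
Variable u : 'rV[R]_d -> R.
Hypothesis cu : continuous u.

Let cell (n : nat) (x : T) : 'rV[int]_d :=
  \row_(j < d) Num.floor (n.+1%:R * (tnth x j : R)).

Let corner (n : nat) (k : 'rV[int]_d) : 'rV[R]_d :=
  \row_(j < d) ((k 0 j)%:~R / n.+1%:R).

Let measurable_cell n k : measurable [set x : T | cell n x = k].
Proof.
have -> : [set x : T | cell n x = k] = \big[setI/setT]_(j < d)
    ((fun x : T => tnth x j) @^-1` `[(k 0 j)%:~R / n.+1%:R, (k 0 j + 1)%:~R / n.+1%:R[%classic).
  rewrite -bigcap_seq; apply/seteqP; split => x.
  - move=> /= <- j _ /=; rewrite in_itv /= mxE.
    have := @floor_itv R (n.+1%:R * (tnth x j : R)).
    by rewrite ler_pdivrMr ?ltr0n// ltr_pdivlMr ?ltr0n// ![_ * n.+1%:R]mulrC.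
  - move=> /= H; apply/rowP => j; rewrite mxE.
    have := H j (mem_index_enum _); rewrite /= in_itv /=.
    rewrite ler_pdivrMr ?ltr0n// ltr_pdivlMr ?ltr0n// ![_ * n.+1%:R]mulrC => h.
    exact: floor_def.
apply: bigsetI_measurable => j _; rewrite -[X in measurable X]setTI.
by apply: measurable_tnth => //; exact: measurable_itv.
Qed.

(** The sigma-algebra is the product one on tuples, so [u] is approximated pointwise by functions
    constant on the countably many cubes of side 1/(n+1), which are measurable in it. *)
Lemma measurable_torus_continuous : measurable_fun setT (fun x : T => u (torus_point x)).
Proof.
apply: (@measurable_fun_cvg _ _ _ _ (fun n x => u (corner n (cell n x)))).
  move=> n _ Y mY; rewrite setTI.
  rewrite [X in measurable X](_ : _ =
      \bigcup_(k : 'rV[int]_d) [set x | cell n x = k /\ Y (u (corner n k))]).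
    apply: countable_bigcupT_measurable => // k.
    have [h|h] := pselect (Y (u (corner n k))).
      rewrite [X in measurable X](_ : _ = [set x : T | cell n x = k])//.
      by apply/seteqP; split => x /= => [[]|].
    rewrite [X in measurable X](_ : _ = set0)//.
    by apply/seteqP; split => x //= [].
  apply/seteqP; split => x /=; first by exists (cell n x).
  by move=> [k _ [<-]].
move=> x _; apply: continuous_cvg; first exact: cu.
apply/cvg_ballP => e e0; near=> n.
rewrite /ball /= /mx_ball; split=> // i j; rewrite ord1 !mxE /ball /=.
have n0 : (0 : R) < n.+1%:R by rewrite ltr0n.
set t := tnth x j : R.
have /andP[h1 h2] : (Num.floor (n.+1%:R * t))%:~R <= n.+1%:R * t < (Num.floor (n.+1%:R * t) + 1)%:~R.
  by rewrite floor_itv.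
have ne : 1 < e * n.+1%:R.
  rewrite mulrC -ltr_pdivrMr// div1r.
  near: n; exists (Num.truncn e^-1) => // n /= Nn.
  by apply: lt_le_trans (truncnS_gt _) _; rewrite ler_nat ltnS.
rewrite -(ltr_pM2r n0) -[X in _ * X < _](ger0_norm (ltW n0)) -normrM mulrBl.
rewrite divfK ?gt_eqF// mulrC ger0_norm ?subr_ge0//.
by move: h2; rewrite intrD; lra.
Unshelve. all: by end_near. Qed.

End measurable_continuous.

End complex_integral.

(** * Periodic functions, partial derivatives and orthogonality of exponentials *)

Section rows.
Variables (R : realType) (d : nat).
Local Notation V := 'rV[R]_d.
Local Notation C := R[i].
Local Notation mT := (measurableTypeR R).
Local Notation T := (d.-tuple mT).
Local Notation mu := (torus_measure R d).
Local Notation "'e_ j" := (delta_mx 0 j : V) (at level 8, j at level 2, format "''e_' j").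
Implicit Types (x y : V) (j : 'I_d) (k : 'rV[int]_d).

Definition lattice_periodic (A : Type) (u : V -> A) := forall j x, u (x + (2 * pi) *: 'e_j) = u x.

Lemma periodic_lattice A (u : V -> A) (m : 'I_d -> int) x : lattice_periodic u ->
  u (x + \sum_j ((m j)%:~R * (2 * pi)) *: 'e_j) = u x.
Proof.
move=> pu.
have nat_mul j (n : nat) y : u (y + (n%:R * (2 * pi)) *: 'e_j) = u y.
  elim: n => [|n IH]; first by rewrite mul0r scale0r addr0.
  by rewrite -natr1 mulrDl mul1r scalerDl addrA pu IH.
have int_mul j (n : int) y : u (y + (n%:~R * (2 * pi)) *: 'e_j) = u y.
  case: n => n; first exact: nat_mul.
  by rewrite NegzE mulrNz mulNr scaleNr -[LHS](nat_mul j n.+1) subrK.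
elim: (index_enum _) x => [|j s IH] x; first by rewrite big_nil addr0.
by rewrite big_cons addrA IH int_mul.
Qed.

(** Every point is translated by a lattice vector into the compact period cube. *)
Lemma bounded_periodic (u : V -> R) : continuous u -> lattice_periodic u ->
  exists M, forall x, `|u x| <= M.
Proof.
move=> cu pu.
pose K := [set v : V | forall i, (`[0, 2 * pi] : set R)%classic (v ord0 i)].
have cK : compact K.
  apply: (@rV_compact R d (fun=> (`[0, 2 * pi] : set R)%classic)) => i.
  exact: segment_compact.
have /compact_bounded : compact (u @` K).
  by apply: continuous_compact => //; exact: continuous_subspaceT.
move=> [M [_ HM]]; exists (M + 1) => x.
have p2 : (0 : R) < 2 * pi by rewrite mulr_gt0 ?pi_gt0.
pose m j := - Num.floor (x 0 j / (2 * pi)).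
rewrite -(periodic_lattice m x pu); apply: (HM (M + 1)); first by rewrite ltrDl.
eexists; last by []; move=> j /=.
rewrite (_ : (x + _) _ _ = x 0 j - (Num.floor (x 0 j / (2 * pi)))%:~R * (2 * pi)).
  have /andP[h1 h2] := floor_itv (x 0 j / (2 * pi)).
  move: h1 h2; rewrite ler_pdivlMr// ltr_pdivrMr// intrD mulrDl mul1r => h1 h2.
  by rewrite in_itv /=; apply/andP; split; lra.
rewrite mxE summxE (bigD1 j)//= big1 => [|i ij]; rewrite !mxE ord1 eqxx /=.
  by rewrite eqxx mulr1 addr0 /m mulrNz mulNr.
by rewrite eq_sym (negPf ij) mulr0.
Qed.

Lemma is_derive_line (u : V -> R) x j (t du : R) :
  is_derive (x + t *: 'e_j) 'e_j u du -> is_derive t 1 (fun s : R => u (x + s *: 'e_j)) du.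
Proof.
move=> [dH vH].
have Q : (fun h : R => h^-1 *: ((u \o shift (x + t *: 'e_j)) (h *: 'e_j) - u (x + t *: 'e_j))) =
  (fun h : R => h^-1 *: (((fun s : R => u (x + s *: 'e_j)) \o shift t) (h *: (1 : R)) -
     u (x + t *: 'e_j))).
  have scaler1 (h : R) : h *: (1 : R) = h by exact: mulr1.
  by apply/funext => h /=; rewrite scaler1 scalerDl addrCA.
by split; rewrite ?/derivable ?/derive -Q.
Qed.

(** The fundamental theorem of calculus in the [j]-th variable alone. Orthogonality of exponentials
    and integration by parts both rest on it. *)
Lemma torus_integral_deriv j (w w' : V -> R) : (forall x, is_derive x 'e_j w (w' x)) ->
  continuous w' -> lattice_periodic w' -> lattice_periodic w ->
  (\int[mu]_x (w' (torus_point x))%:E = 0)%E.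
Proof.
move=> dw cw' pw' pw; have [M HM] := bounded_periodic cw' pw'.
apply: (@torus_integral_coord0 _ _ j _ M) => //.
  exact: measurable_torus_continuous.
move=> x; pose y := torus_point (set_coord x j 0).
have E t : torus_point (set_coord x j t) = y + t *: 'e_j.
  apply/rowP => i; rewrite !mxE !tnth_mktuple eqxx /=.
  by case: eqP => _ /=; rewrite ?mulr1 ?mulr0 ?add0r ?addr0.
under eq_integral do rewrite E.
apply: (@integral_period_deriv _ (fun t => w (y + t *: 'e_j)) _ M) => //.
- by move=> t; exact: is_derive_line.
- move=> t; apply: (@continuous_comp _ _ _ (fun t : R => y + t *: 'e_j) w'); last exact: cw'.
  apply: (@cvgD _ _ _ (nbhs t) _ (fun=> y) (fun t : R => t *: 'e_j)); first exact: cvg_cst.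
  by apply: (@cvgZr_tmp _ _ _ (nbhs t) _ (fun t : R => t)); exact: cvg_id.
- by rewrite scale0r addr0 pw.
Qed.

Definition cderiv j (f g : V -> C) := forall x,
  is_derive x 'e_j (fun y => complex.Re (f y)) (complex.Re (g x)) /\
  is_derive x 'e_j (fun y => complex.Im (f y)) (complex.Im (g x)).

Definition ccont (f : V -> C) :=
  continuous (fun x => complex.Re (f x)) /\ continuous (fun x => complex.Im (f x)).

Lemma periodic_ReIm (f : V -> C) : lattice_periodic f ->
  lattice_periodic (fun x => complex.Re (f x)) /\ lattice_periodic (fun x => complex.Im (f x)).
Proof. by move=> pf; split => j x; rewrite pf. Qed.

Lemma bounded_cperiodic (f : V -> C) : ccont f -> lattice_periodic f ->
  exists M, forall x, Normc.normc (f x) <= M.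
Proof.
move=> [c1 c2] /periodic_ReIm[p1 p2].
have [M1 H1] := bounded_periodic c1 p1; have [M2 H2] := bounded_periodic c2 p2.
exists (M1 + M2) => x; exact: le_trans (normc_le _) (lerD (H1 x) (H2 x)).
Qed.

Lemma cmeas_ccont (f : V -> C) : ccont f -> cmeas (fun x : T => f (torus_point x)).
Proof.
by move=> [c1 c2]; split; [exact: (measurable_torus_continuous c1)|exact: (measurable_torus_continuous c2)].
Qed.

Lemma cintegrable_ccont (f : V -> C) : ccont f -> lattice_periodic f ->
  cintegrable (fun x : T => f (torus_point x)).
Proof.
move=> cf pf; have [M HM] := bounded_cperiodic cf pf.
by apply: (@bounded_cintegrable _ _ _ M) => //; exact: cmeas_ccont.
Qed.

Lemma torus_cintegral_deriv j (f g : V -> C) : cderiv j f g -> ccont g -> lattice_periodic g ->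
  lattice_periodic f -> torus_integral (fun x : T => g (torus_point x)) = 0.
Proof.
move=> fg [c1 c2] /periodic_ReIm[p1 p2] /periodic_ReIm[q1 q2].
apply: complexP.
- by apply: (congr1 fine (torus_integral_deriv (j := j) _ c1 p1 q1)) => x; have [] := fg x.
- by apply: (congr1 fine (torus_integral_deriv (j := j) _ c2 p2 q2)) => x; have [] := fg x.
Qed.

Lemma cderivD j f f' g g' : cderiv j f f' -> cderiv j g g' ->
  cderiv j (fun x => f x + g x) (fun x => f' x + g' x).
Proof.
move=> Hf Hg x; have [f1 f2] := Hf x; have [g1 g2] := Hg x; split.
- under eq_fun do rewrite ReD; rewrite ReD; exact: is_deriveD.
- under eq_fun do rewrite ImD; rewrite ImD; exact: is_deriveD.
Qed.

Lemma cderivM j f f' g g' : cderiv j f f' -> cderiv j g g' ->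
  cderiv j (fun x => f x * g x) (fun x => f' x * g x + f x * g' x).
Proof.
move=> Hf Hg x; have [f1 f2] := Hf x; have [g1 g2] := Hg x; split.
- under eq_fun do rewrite ReM.
  have H := is_deriveB (is_deriveM f1 g1) (is_deriveM f2 g2).
  apply: (is_derive_eq H).
  by rewrite ReD !ReM /GRing.scale /=; ring.
- under eq_fun do rewrite ImM.
  have H := is_deriveD (is_deriveM f1 g2) (is_deriveM f2 g1).
  apply: (is_derive_eq H).
  by rewrite ImD !ImM /GRing.scale /=; ring.
Qed.

Lemma cderiv_cst j a : cderiv j (fun=> a) (fun=> 0).
Proof. by move=> x; split; exact: is_derive_cst. Qed.

Lemma cderivZ j f f' a : cderiv j f f' -> cderiv j (fun x => a * f x) (fun x => a * f' x).
Proof.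
move=> Hf; have := cderivM (cderiv_cst j a) Hf.
by congr cderiv; apply/funext => x; rewrite mul0r add0r.
Qed.

Lemma cderiv_sum j I (s : seq I) (F G : I -> V -> C) : (forall i, cderiv j (F i) (G i)) ->
  cderiv j (fun x => \sum_(i <- s) F i x) (fun x => \sum_(i <- s) G i x).
Proof.
move=> H; elim: s => [|i s IH].
  have := cderiv_cst j 0.
  by congr cderiv; apply/funext => x; rewrite big_nil.
have := cderivD (H i) IH.
by congr cderiv; apply/funext => x; rewrite big_cons.
Qed.

Lemma ccontD f g : ccont f -> ccont g -> ccont (fun x => f x + g x).
Proof.
move=> [f1 f2] [g1 g2]; split => x.
- under eq_fun do rewrite ReD.
  exact: (@cvgD _ _ _ (nbhs x) (nbhs_filter x) _ _ _ _ (f1 x) (g1 x)).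
- under eq_fun do rewrite ImD.
  exact: (@cvgD _ _ _ (nbhs x) (nbhs_filter x) _ _ _ _ (f2 x) (g2 x)).
Qed.

Lemma ccontM f g : ccont f -> ccont g -> ccont (fun x => f x * g x).
Proof.
move=> [f1 f2] [g1 g2]; split => x.
- under eq_fun do rewrite ReM.
  apply: (@cvgB _ _ _ (nbhs x) (nbhs_filter x)).
    exact: (@cvgM _ _ (nbhs x) (nbhs_filter x) _ _ _ _ (f1 x) (g1 x)).
  exact: (@cvgM _ _ (nbhs x) (nbhs_filter x) _ _ _ _ (f2 x) (g2 x)).
- under eq_fun do rewrite ImM.
  apply: (@cvgD _ _ _ (nbhs x) (nbhs_filter x)).
    exact: (@cvgM _ _ (nbhs x) (nbhs_filter x) _ _ _ _ (f1 x) (g2 x)).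
  exact: (@cvgM _ _ (nbhs x) (nbhs_filter x) _ _ _ _ (f2 x) (g1 x)).
Qed.

Lemma ccont_cst a : ccont (fun=> a).
Proof. by split; exact: cst_continuous. Qed.

Lemma ccont_fourier_exp k : ccont (fourier_exp (R := R) k).
Proof.
have [h1 h2 _] := @fourier_exp_smooth_periodic R d k.
by split; [case: (h1 [::])|case: (h2 [::])].
Qed.

Lemma periodic_fourier_exp k : lattice_periodic (fourier_exp (R := R) k).
Proof. by have [_ _ h] := @fourier_exp_smooth_periodic R d k. Qed.

Lemma phase_shift k x j (h : R) : phase k (h *: 'e_j + x) = (k 0 j)%:~R * h + phase k x.
Proof. by rewrite addrC phaseDZ addrC. Qed.

Lemma is_derive_phase k x j (F : R -> R) (dF : R) : is_derive (phase k x) 1 F dF ->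
  is_derive x 'e_j (fun y => F (phase k y)) ((k 0 j)%:~R * dF).
Proof.
move=> HF; set c := (k 0 j)%:~R : R.
have HF0 : is_derive (c * 0 + phase k x) 1 F dF by rewrite mulr0 add0r.
have H : is_derive (0 : R) 1 (fun h : R => F (c * h + phase k x)) (c * dF).
  have Hl : is_derive (0 : R) 1 (fun h : R => c * h + phase k x) c.
    by apply: is_derive_eq; rewrite /GRing.scale /= mulr1 addr0.
  by rewrite mulrC; exact: (is_derive1_comp (g := fun h : R => c * h + phase k x)).
have Q : (fun h : R => h^-1 *: (((fun y => F (phase k y)) \o shift x) (h *: 'e_j) - F (phase k x))) =
    (fun h : R => h^-1 *: (((fun h => F (c * h + phase k x)) \o shift 0) (h *: (1 : R)) -
      F (c * 0 + phase k x))).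
  apply/funext => h /=; rewrite phase_shift -/c addr0 mulr0 add0r.
  by rewrite (_ : h *: (1 : R) = h)//; exact: mulr1.
by have [dH vH] := H; split; rewrite ?/derivable ?/derive Q.
Qed.

Lemma cderiv_fourier_exp k j :
  cderiv j (fourier_exp k) (fun x => ('i * (k 0 j)%:~R) * fourier_exp k x).
Proof.
move=> x; have -> : (k 0 j)%:~R = ((k 0 j)%:~R : R)%:C :> C by rewrite rmorph_int.
split.
- apply: is_derive_eq; first exact: (@is_derive_phase k x j (@cos R)).
  by rewrite ReM /=; ring.
- apply: is_derive_eq; first exact: (@is_derive_phase k x j (@sin R)).
  by rewrite ImM /=; ring.
Qed.

(** If k_j is nonzero, the exponential is its own [j]-th derivative up to the nonzero factor i k_j,
    and a derivative has integral zero. *)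
Lemma torus_integral_fourier_exp k :
  torus_integral (fun x : T => fourier_exp k (torus_point x)) =
  if k == 0 then ((2 * pi) ^+ d)%:C else 0.
Proof.
case: eqP => [->|/eqP k0].
  have -> : (fun x : T => fourier_exp 0 (torus_point x)) = (fun=> (1 : C)).
    apply/funext => x; rewrite /fourier_exp /phase big1 ?expi0// => j _.
    by rewrite mxE mul0r.
  apply: complexP => /=; rewrite Rintegral_cst// ?mul0r// mul1r.
  by rewrite /= torus_measureT.
have [j kj] : exists j, k 0 j != 0.
  apply/existsP; apply: contraNT k0; rewrite negb_exists => /forallP H.
  by apply/eqP/rowP => j; rewrite mxE; apply/eqP; have := H j; rewrite negbK.
have := torus_cintegral_deriv (cderiv_fourier_exp k j).
have c1 := ccontM (ccont_cst ('i * (k 0 j)%:~R)) (ccont_fourier_exp k).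
have p1 : lattice_periodic (fun x => 'i * (k 0 j)%:~R * fourier_exp k x).
  by move=> i x; rewrite periodic_fourier_exp.
move=> /(_ c1 p1 (@periodic_fourier_exp k)).
rewrite torus_integralZ; last exact: (cintegrable_ccont (ccont_fourier_exp k) (@periodic_fourier_exp k)).
move/eqP; rewrite mulf_eq0 mulf_eq0 intr_eq0 (negPf kj) orbF => /orP[|/eqP//].
by rewrite eq_complex /= oner_eq0 andbF.
Qed.

End rows.

(** * Convolution and Young's inequality *)

Section convolution.
Variables (R : realType) (d : nat).
Local Notation V := 'rV[R]_d.
Local Notation C := R[i].
Local Notation mT := (measurableTypeR R).
Local Notation T := (d.-tuple mT).
Implicit Types (K : nat) (a p : 'I_d -> int -> C) (g : T -> C) (k : 'rV[int]_d).

Local Notation box K := {ffun 'I_d -> 'I_(2 * K).+1}.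

Definition box_freq K (i : box K) : 'rV[int]_d := \row_j freq (i j).

Definition kernel_of K a (x : V) : C := \prod_j tsum K (a j) (x 0 j).

Definition fcoef g k : C := ((2 * pi) ^- d)%:C *
  torus_integral (fun y : T => g y * fourier_exp (- k) (torus_point y)).

(** Convolution with the tensor kernel, defined on the frequency side so that it is a trigonometric
    polynomial by construction; [convE] gives the integral form. *)
Definition conv K a g (x : V) : C :=
  \sum_(i : box K) (\prod_j a j (freq (i j))) * fcoef g (box_freq i) * fourier_exp (box_freq i) x.

Lemma fourier_exp_prod k (x : V) : fourier_exp k x = \prod_j expi ((k 0 j)%:~R * x 0 j).
Proof. by rewrite /fourier_exp /phase expi_sum. Qed.

Lemma fourier_expD k k' (x : V) : fourier_exp (k + k') x = fourier_exp k x * fourier_exp k' x.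
Proof.
rewrite !fourier_exp_prod -big_split /=; apply: eq_bigr => j _.
by rewrite mxE intrD mulrDl expiD.
Qed.

Lemma fourier_expB k (x y : V) : fourier_exp k (x - y) = fourier_exp k x * fourier_exp (- k) y.
Proof.
rewrite !fourier_exp_prod -big_split /=; apply: eq_bigr => j _.
by rewrite !mxE -expiD; congr expi; rewrite mulrNz; ring.
Qed.

Lemma norm_fourier_exp k (x : V) : `|fourier_exp k x| = 1 :> C.
Proof. exact: norm_expi. Qed.

Lemma normc_fourier_exp k (x : V) : Normc.normc (fourier_exp k x : C) = 1.
Proof. by apply: complexI; exact: norm_fourier_exp. Qed.

Lemma kernel_ofE K a x :
  kernel_of K a x = \sum_(i : box K) (\prod_j a j (freq (i j))) * fourier_exp (box_freq i) x.
Proof.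
rewrite /kernel_of /tsum bigA_distr_bigA; apply: eq_bigr => i _.
rewrite big_split /= fourier_exp_prod; congr (_ * _).
by apply: eq_bigr => j _; rewrite mxE.
Qed.

Lemma cmeas_fourier_exp k : cmeas (fun y : T => fourier_exp k (torus_point y)).
Proof. exact: cmeas_ccont (@ccont_fourier_exp R d k). Qed.

Lemma cintegrable_fourier_exp k : cintegrable (fun y : T => fourier_exp k (torus_point y)).
Proof. exact: cintegrable_ccont (@ccont_fourier_exp R d k) (@periodic_fourier_exp R d k). Qed.

Lemma cintegrable_mul_exp g k : cintegrable g ->
  cintegrable (fun y : T => g y * fourier_exp k (torus_point y)).
Proof.
move=> ig; apply: (cintegrableM (M := 1)) => //; first exact: cmeas_fourier_exp.
by move=> y; rewrite normc_fourier_exp.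
Qed.

Lemma kernel_ofB K a (x y : V) : kernel_of K a (x - y) =
  \sum_(i : box K) ((\prod_j a j (freq (i j))) * fourier_exp (box_freq i) x) *
      fourier_exp (- box_freq i) y.
Proof. by rewrite kernel_ofE; apply: eq_bigr => i _; rewrite fourier_expB mulrA. Qed.

Let mul_kernel K a g x : (fun y : T => g y * kernel_of K a (x - torus_point y)) =
  (fun y => \sum_(i : box K) ((\prod_j a j (freq (i j))) * fourier_exp (box_freq i) x) *
      (g y * fourier_exp (- box_freq i) (torus_point y))).
Proof.
apply/funext => y; rewrite kernel_ofB mulr_sumr; apply: eq_bigr => i _; ring.
Qed.

Lemma cintegrable_mul_kernel K a g x : cintegrable g ->
  cintegrable (fun y => g y * kernel_of K a (x - torus_point y)).
Proof.
move=> ig; rewrite mul_kernel; apply: cintegrable_sum => i; apply: cintegrableZ.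
exact: cintegrable_mul_exp.
Qed.

Lemma convE K a g x : cintegrable g -> conv K a g x =
  ((2 * pi) ^- d)%:C * torus_integral (fun y => g y * kernel_of K a (x - torus_point y)).
Proof.
move=> ig; rewrite mul_kernel torus_integral_sum; last first.
  by move=> i; apply: cintegrableZ; exact: cintegrable_mul_exp.
rewrite mulr_sumr; apply: eq_bigr => i _.
rewrite torus_integralZ; last exact: cintegrable_mul_exp.
by rewrite /fcoef; ring.
Qed.

Lemma fcoef_fourier_exp k k' :
  fcoef (fun y => fourier_exp k (torus_point y)) k' = (k == k')%:R.
Proof.
rewrite /fcoef.
under [X in torus_integral X]eq_fun do rewrite -fourier_expD.
rewrite torus_integral_fourier_exp subr_eq0; case: eqP => _; last by rewrite mulr0.
rewrite -rmorphM mulVf ?rmorph1// expf_neq0// gt_eqF// mulr_gt0// pi_gt0//.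
Qed.

Lemma box_freq_inj K : injective (@box_freq K).
Proof.
move=> i i' /rowP H; apply/ffunP => j.
by have := H j; rewrite !mxE => /freq_inj.
Qed.

Lemma conv_fourier_exp K a k x : (forall j, (`|k ord0 j| <= K)%N) ->
  conv K a (fun y => fourier_exp k (torus_point y)) x = (\prod_j a j (k 0 j)) * fourier_exp k x.
Proof.
move=> kK.
have [i ik] : exists i : box K, box_freq i = k.
  have /choice[i Hi] : forall j, exists i : 'I_(2 * K).+1, freq i = k 0 j.
    by move=> j; exact: freqP.
  by exists (finfun i); apply/rowP => j; rewrite mxE ffunE Hi.
rewrite /conv (bigD1 i)//= [X in _ + X]big1 => [|i' i'i].
  rewrite addr0 fcoef_fourier_exp ik eqxx mulr1; congr (_ * _).
  by apply: eq_bigr => j _; rewrite -ik mxE.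
rewrite fcoef_fourier_exp -ik; case: eqP => [/box_freq_inj e|]; last by rewrite mulr0 mul0r.
by rewrite e eqxx in i'i.
Qed.

Lemma cintegrable_conv K a g : cintegrable (fun x : T => conv K a g (torus_point x)).
Proof.
apply: cintegrable_sum => i; apply: cintegrableZ; exact: cintegrable_fourier_exp.
Qed.

Lemma torus_integral_conv K a g : cintegrable g ->
  torus_integral (fun x => conv K a g (torus_point x)) = (\prod_j a j 0) * torus_integral g.
Proof.
move=> ig; rewrite torus_integral_sum; last first.
  by move=> i; apply: cintegrableZ; exact: cintegrable_fourier_exp.
transitivity (\sum_(i : box K) (\prod_j a j (freq (i j))) * fcoef g (box_freq i) *
    (if box_freq i == 0 then ((2 * pi) ^+ d)%:C else 0)).
  apply: eq_bigr => i _; rewrite torus_integralZ; last exact: cintegrable_fourier_exp.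
  by rewrite torus_integral_fourier_exp.
pose i0 : box K := [ffun=> inord K].
have f0 : freq (inord K : 'I_(2 * K).+1) = 0 by rewrite /freq inordK ?subrr//; lia.
have i00 : box_freq i0 = 0 by apply/rowP => j; rewrite !mxE ffunE f0.
rewrite (bigD1 i0)//= i00 eqxx [X in _ + X]big1 => [|i ii0]; last first.
  by rewrite ifN ?mulr0//; apply: contra ii0; rewrite -i00 => /eqP/box_freq_inj ->.
rewrite addr0 -mulrA; congr (_ * _).
  by apply: eq_bigr => j _; rewrite ffunE f0.
rewrite /fcoef mulrAC -rmorphM mulVf ?rmorph1 ?mul1r; last first.
  by rewrite expf_neq0// gt_eqF// mulr_gt0// pi_gt0.
congr torus_integral; apply/funext => y.
by rewrite oppr0 fourier_exp_prod big1 ?mulr1// => j _; rewrite mxE mul0r expi0.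
Qed.

Lemma kernel_of_majorized K a p x : (forall j t, `|tsum K (a j) t| <= tsum K (p j) t) ->
  `|kernel_of K a x| <= kernel_of K p x.
Proof.
move=> H; rewrite normr_prod; apply: ler_prod => j _.
by rewrite normr_ge0 H.
Qed.

Lemma kernel_of_ge0 K p x : (forall j t, 0 <= tsum K (p j) t) -> 0 <= kernel_of K p x.
Proof. by move=> H; apply: prodr_ge0 => j _; exact: H. Qed.

End convolution.

(** * Averages against a positive kernel *)

Section young.
Variables (R : realType) (d : nat).
Local Notation V := 'rV[R]_d.
Local Notation C := R[i].
Local Notation mT := (measurableTypeR R).
Local Notation T := (d.-tuple mT).
Local Notation mu := (torus_measure R d).
Implicit Types (K : nat) (a p : 'I_d -> int -> C) (g : T -> C) (G : T -> R) (k : 'rV[int]_d).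

Lemma twopi_gt0 : (0 : R) < (2 * pi) ^+ d.
Proof. by rewrite exprn_gt0// mulr_gt0// pi_gt0. Qed.

Lemma cintegrable_real G : mu.-integrable setT (EFin \o G) -> cintegrable (fun y => (G y)%:C).
Proof.
move=> iG; split; first exact: iG.
by apply: (@bounded_integrable _ _ _ _ _ 0) => [|x] /=; [exact: measurable_cst|rewrite normr0].
Qed.

Lemma torus_integral_real G : torus_integral (fun y => (G y)%:C) = (\int[mu]_y G y)%:C.
Proof. by apply: complexP => //=; rewrite Rintegral_cst// mul0r. Qed.

Section positive_kernel.
Variables (K : nat) (p : 'I_d -> int -> C).
Hypothesis p0 : forall j t, 0 <= tsum K (p j) t.

Local Notation P x := (complex.Re (kernel_of K p x)).

Let PE x : kernel_of K p x = (P x)%:C.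
Proof.
by rewrite RRe_real// realE kernel_of_ge0.
Qed.

Lemma kernel_Re_ge0 x : 0 <= P x.
Proof. by rewrite -ler0c -PE kernel_of_ge0. Qed.

Definition avg G (x : V) : R := ((2 * pi) ^- d) * \int[mu]_y (G y * P (x - torus_point y)).

Lemma integrable_mul_kernel G (x : V) : mu.-integrable setT (EFin \o G) ->
  mu.-integrable setT (EFin \o (fun y => G y * P (x - torus_point y))).
Proof.
move=> /cintegrable_real/(cintegrable_mul_kernel K p x)[+ _].
by congr (mu.-integrable _ (_ \o _)); apply/funext => y; rewrite ReM /= mul0r subr0.
Qed.

Lemma avgE G (x : V) : mu.-integrable setT (EFin \o G) ->
  (avg G x)%:C = conv K p (fun y => (G y)%:C) x.
Proof.
move=> iG; rewrite convE; last exact: cintegrable_real.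
transitivity (((2 * pi) ^- d)%:C * (\int[mu]_y (G y * P (x - torus_point y)))%:C).
  by rewrite /avg rmorphM.
rewrite -torus_integral_real; congr (_ * torus_integral _).
by apply/funext => y; rewrite [in RHS]PE; exact: rmorphM.
Qed.

Lemma le_avg G G' (x : V) : mu.-integrable setT (EFin \o G) ->
  mu.-integrable setT (EFin \o G') -> (forall y, G y <= G' y) -> avg G x <= avg G' x.
Proof.
move=> iG iG' GG'; rewrite ler_wpM2l ?invr_ge0 ?(ltW twopi_gt0)//.
apply: le_Rintegral => //; try exact: integrable_mul_kernel.
by move=> y _; rewrite ler_wpM2r ?kernel_Re_ge0.
Qed.

Lemma avg_lin G G' (b c : R) (x : V) : mu.-integrable setT (EFin \o G) ->
  mu.-integrable setT (EFin \o G') ->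
  avg (fun y => b * G y + c * G' y) x = b * avg G x + c * avg G' x.
Proof.
move=> iG iG'; rewrite /avg.
have i1 := integrable_mul_kernel x iG; have i2 := integrable_mul_kernel x iG'.
under eq_Rintegral do rewrite mulrDl -!mulrA.
rewrite RintegralD//; last first.
- exact: (integrableZl measurableT c i2).
- exact: (integrableZl measurableT b i1).
by rewrite !RintegralZl//; ring.
Qed.

Definition mass : R := avg (fun=> 1) 0.

Let i1 : mu.-integrable setT (EFin \o (fun _ : T => 1 : R)).
Proof. exact: (@bounded_integrable _ _ _ _ (fun=> 1) `|1|). Qed.

Lemma avg_cst (c : R) (x : V) : avg (fun=> c) x = c * mass.
Proof.
have E (y : V) : (avg (fun=> 1) y)%:C = \prod_j p j 0.
  rewrite avgE//.
  have -> : (fun _ : T => 1%:C) = (fun y : T => fourier_exp 0 (torus_point y) : C).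
    by apply/funext => z; rewrite fourier_exp_prod big1 ?rmorph1// => j _; rewrite mxE mul0r expi0.
  rewrite conv_fourier_exp => [|j]; last by rewrite mxE.
  rewrite fourier_exp_prod [X in _ * X]big1 => [|j _]; last by rewrite mxE mul0r expi0.
  by rewrite mulr1; apply: eq_bigr => j _; rewrite mxE.
have <- : avg (fun=> 1) x = mass by apply: complexI; rewrite !E.
have -> : avg (fun=> c) x = avg (fun=> c * 1 + 0 * 1) x.
  by congr avg; apply/funext => y; rewrite mulr1 mul0r addr0.
by rewrite (avg_lin c 0 x i1 i1) mul0r addr0.
Qed.

Lemma massE : mass%:C = \prod_j p j 0.
Proof.
rewrite avgE//.
have -> : (fun _ : T => 1%:C) = (fun y : T => fourier_exp 0 (torus_point y) : C).
  by apply/funext => z; rewrite fourier_exp_prod big1 ?rmorph1// => j _; rewrite mxE mul0r expi0.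
rewrite conv_fourier_exp => [|j]; last by rewrite mxE.
rewrite fourier_exp_prod [X in _ * X]big1 => [|j _]; last by rewrite mxE mul0r expi0.
by rewrite mulr1; apply: eq_bigr => j _; rewrite mxE.
Qed.

Lemma mass_ge0 : 0 <= mass.
Proof.
rewrite mulr_ge0 ?invr_ge0 ?(ltW twopi_gt0)//.
by apply: Rintegral_ge0 => y _; rewrite mul1r kernel_Re_ge0.
Qed.

(** Instead of exchanging two integrals: the average is a trigonometric polynomial in [x], and its
    integral reads off the frequency zero. *)
Lemma integral_avg G : mu.-integrable setT (EFin \o G) ->
  mu.-integrable setT (EFin \o (fun x => avg G (torus_point x))) /\
  \int[mu]_x avg G (torus_point x) = mass * \int[mu]_x G x.
Proof.
move=> iG; have iC := cintegrable_real iG.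
have E : (fun x => conv K p (fun y => (G y)%:C) (torus_point x)) =
   (fun x : T => (avg G (torus_point x))%:C) by apply/funext => x; rewrite avgE.
split.
  have [+ _] := cintegrable_conv K p (fun y => (G y)%:C).
  by congr (mu.-integrable _ (_ \o _)); apply/funext => x; rewrite -avgE.
apply: complexI; rewrite -torus_integral_real -E torus_integral_conv//.
by rewrite -massE torus_integral_real -rmorphM.
Qed.

Lemma norm_conv_le_avg a g (x : V) : (forall j t, `|tsum K (a j) t| <= tsum K (p j) t) ->
  cintegrable g -> Normc.normc (conv K a g x) <= avg (fun y => Normc.normc (g y)) x.
Proof.
move=> ap ig; rewrite convE// Normc.normcM.
have -> : Normc.normc ((2 * pi) ^- d : R)%:C = (2 * pi) ^- d.
  by rewrite /= expr0n addr0 sqrtr_sqr ger0_norm// invr_ge0 (ltW twopi_gt0).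
rewrite ler_wpM2l ?invr_ge0 ?(ltW twopi_gt0)//.
have i := cintegrable_mul_kernel K a x ig.
apply: le_trans (normc_torus_integral i) _; apply: le_Rintegral => //.
- exact: integrable_normc.
- by apply: integrable_mul_kernel; exact: integrable_normc.
- move=> y _; rewrite Normc.normcM ler_wpM2l ?normc_ge0//.
  by rewrite -lecR -PE; exact: kernel_of_majorized.
Qed.

(* Jensen's inequality, by integrating Young's inequality
   [t s <= t^q / q + s^q' / q'] with [s = (avg t / A)^(q - 1)] *)
Lemma avg_powR (t : T -> R) (q A : R) (x : V) : 1 < q -> 0 < A -> mass <= A ->
  (forall y, 0 <= t y) -> mu.-integrable setT (EFin \o t) ->
  mu.-integrable setT (EFin \o (fun y => t y `^ q)) ->
  avg t x `^ q <= A `^ (q - 1) * avg (fun y => t y `^ q) x.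
Proof.
move=> q1 A0 WA t0 it itq.
have q0 : 0 < q by lra.
set m := avg t x.
have m0 : 0 <= m.
  rewrite mulr_ge0 ?invr_ge0 ?(ltW twopi_gt0)//.
  by apply: Rintegral_ge0 => y _; rewrite mulr_ge0 ?t0 ?kernel_Re_ge0.
have [->|mN0] := eqVneq m 0.
  rewrite powR0 ?gt_eqF// mulr_ge0 ?powR_ge0// mulr_ge0 ?invr_ge0 ?(ltW twopi_gt0)//.
  by apply: Rintegral_ge0 => y _; rewrite mulr_ge0 ?powR_ge0 ?kernel_Re_ge0.
have mp : 0 < m by rewrite lt0r mN0.
set u := m / A; have u0 : 0 < u by rewrite divr_gt0.
pose q' := q / (q - 1).
have q'0 : 0 < q' by rewrite divr_gt0//; lra.
have qq' : q^-1 + q'^-1 = 1 by rewrite /q'; field; apply/andP; split; apply/eqP; lra.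
pose s := u `^ (q - 1).
have sq : s `^ q' = u `^ q.
  by rewrite /s -powRrM /q'; congr (_ `^ _); field; apply/eqP; lra.
have us : u * s = u `^ q.
  rewrite /s -{1}(powRr1 (ltW u0)) -powRD; first by congr (_ `^ _); ring.
  by apply/implyP => _; rewrite gt_eqF.
have H1 : s * m <= q^-1 * avg (fun y => t y `^ q) x + u `^ q / q' * mass.
  have -> : s * m = avg (fun y => s * t y + 0 * t y) x by rewrite avg_lin// mul0r addr0.
  rewrite -(avg_cst _ x).
  have -> : q^-1 * avg (fun y => t y `^ q) x + avg (fun=> u `^ q / q') x =
      avg (fun y => q^-1 * t y `^ q + (u `^ q / q') * 1) x.
    by rewrite avg_lin// !avg_cst; ring.
  apply: le_avg.
  - have := integrableZl measurableT s it.
    by congr (mu.-integrable _ _); apply/funext => y /=; rewrite mul0r addr0.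
  - have := integrableD measurableT (integrableZl measurableT q^-1 itq)
       (integrableZl measurableT (u `^ q / q') i1).
    by congr (mu.-integrable _ _); apply/funext => y /=.
  - move=> y; rewrite mul0r addr0 mulr1 mulrC.
    have := @conjugate_powR R (t y) s q q' (t0 y) (powR_ge0 _ _) q0 q'0 qq'.
    by rewrite sq; lra.
have uq0 : 0 < u `^ q by rewrite powR_gt0.
have mE : m = A * u by rewrite /u; field; rewrite gt_eqF.
have H2 : u `^ q / q' * mass <= u `^ q / q' * A.
  by rewrite ler_wpM2l// divr_ge0 ?(ltW uq0) ?(ltW q'0).
have H3 : s * m = A * u `^ q by rewrite mE -us; ring.
have q'E : q'^-1 = 1 - q^-1 by lra.
have H4 : q^-1 * (A * u `^ q) <= q^-1 * avg (fun y => t y `^ q) x.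
  by move: H1 H2; rewrite H3 q'E; nra.
have iq0 : 0 < q^-1 by rewrite invr_gt0.
rewrite ler_pM2l// in H4.
rewrite mE powRM ?(ltW A0) ?(ltW u0)//.
have -> : A `^ q = A `^ (q - 1) * A.
  rewrite -{3}(powRr1 (ltW A0)) -powRD; first by congr (_ `^ _); ring.
  by apply/implyP => _; rewrite gt_eqF.
by rewrite -mulrA ler_wpM2l ?powR_ge0.
Qed.

End positive_kernel.

Lemma bounded_conv K a g : exists M, forall x : V, Normc.normc (conv K a g x) <= M.
Proof.
exists (\sum_(i : {ffun 'I_d -> 'I_(2 * K).+1})
   Normc.normc ((\prod_j a j (freq (i j))) * fcoef g (box_freq i))) => x.
rewrite -lecR rmorph_sum -[leLHS]/(`|conv K a g x|) /conv.
apply: le_trans (ler_norm_sum _ _ _) _.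
by apply: ler_sum => i _; rewrite normrM norm_fourier_exp mulr1.
Qed.

Lemma cmeas_conv K a g : cmeas (fun x : T => conv K a g (torus_point x)).
Proof. by apply: cintegrable_cmeas; exact: cintegrable_conv. Qed.

Lemma integrable_powR_bounded (f : T -> C) (q M : R) : 0 <= q -> cmeas f ->
  (forall x, Normc.normc (f x) <= M) ->
  mu.-integrable setT (EFin \o (fun x => Normc.normc (f x) `^ q)).
Proof.
move=> q0 mf fM; apply: (@bounded_integrable _ _ _ _ _ (M `^ q)).
  apply: (measurableT_comp (f := fun x : R => x `^ q)); first exact: measurable_powR.
  exact: measurable_normc.
move=> x; rewrite ger0_norm ?powR_ge0// ge0_ler_powR ?nnegrE ?normc_ge0//.
exact: le_trans (normc_ge0 _) (fM x).
Qed.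

(** Jensen's inequality for the dominating average contributes B^(q-1), and integrating that average
    contributes the remaining factor B. The bound is stated for [B] instead of the product itself so
    that it may be taken positive when the product is zero. *)
Lemma young_conv K a g (m : 'I_d -> nat) (A : 'I_d -> R) (B q : R) : 1 < q ->
  (forall j, majorized K (m j) (A j) (a j)) -> 0 < B -> \prod_j A j <= B ->
  cintegrable g -> mu.-integrable setT (EFin \o (fun x => Normc.normc (g x) `^ q)) ->
  \int[mu]_x (Normc.normc (conv K a g (torus_point x)) `^ q) <=
  B `^ q * \int[mu]_x (Normc.normc (g x) `^ q).
Proof.
move=> q1 aA B0 AB ig igq; have q0 : 0 < q by lra.
have /choice[p Hp] := aA.
have ap j t : `|tsum K (a j) t| <= tsum K (p j) t by have [_ _] := Hp j; exact.
have p0 j t : 0 <= tsum K (p j) t by exact: le_trans (ap j t).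
(* The mass is the product of the zeroth coefficients of the majorants, each at most [A j]. *)
have WB : mass K p <= B.
  apply: le_trans AB; rewrite -lecR massE//.
  have -> : \prod_j p j 0 = `|\prod_j p j 0| by rewrite -(massE p0) ger0_norm ?ler0c ?mass_ge0.
  rewrite normr_prod rmorph_prod; apply: ler_prod => j _; rewrite normr_ge0.
  by have [-> _ _] := Hp j.
have itn := integrable_normc ig.
have [ia Ea] := integral_avg p0 igq.
have [M HM] := bounded_conv K a g.
apply: (@le_trans _ _ (\int[mu]_x (B `^ (q - 1) * avg K p (fun y => Normc.normc (g y) `^ q) (torus_point x)))).
  apply: le_Rintegral => //.
  - exact: integrable_powR_bounded (ltW q0) (cmeas_conv K a g) (fun x => HM (torus_point x)).
  - exact: (integrableZl measurableT (B `^ (q - 1)) ia).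
  - move=> x _; apply: le_trans (avg_powR p0 (torus_point x) q1 B0 WB _ itn igq); last first.
      by move=> y; exact: normc_ge0.
    rewrite ge0_ler_powR ?(ltW q0) ?nnegrE ?normc_ge0//; last exact: norm_conv_le_avg.
    exact: le_trans (normc_ge0 _) (norm_conv_le_avg p0 _ ap ig).
rewrite RintegralZl// Ea mulrA ler_wpM2r//.
  by apply: Rintegral_ge0 => x _; exact: powR_ge0.
have -> : B `^ q = B `^ (q - 1) * B.
  rewrite -{3}(powRr1 (ltW B0)) -powRD; first by congr (_ `^ _); ring.
  by apply/implyP => _; rewrite gt_eqF.
by rewrite ler_wpM2l ?powR_ge0.
Qed.

End young.

(** * Density of trigonometric polynomials *)

Section density.
Variables (R : realType) (d : nat).
Local Notation V := 'rV[R]_d.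
Local Notation C := R[i].
Local Notation mT := (measurableTypeR R).
Local Notation T := (d.-tuple mT).
Local Notation mu := (torus_measure R d).
Local Notation "'e_ j" := (delta_mx 0 j : V) (at level 8, j at level 2, format "''e_' j").
Implicit Types (K n : nat) (j : 'I_d) (s : seq 'I_d) (u v : V -> R) (f g : V -> C).

(** With t = h/4, doubling the angle twice gives 1 - cos h = 8 sin^2 t cos^2 t. On [0, pi/4] the
    squared cosine is at least 1/2, and sin t = t cos c for some c in between by the mean value
    theorem. *)
Lemma sqr_le_one_sub_cos (h : R) : `|h| <= pi -> h ^+ 2 / 8 <= 1 - cos h.
Proof.
wlog h0 : h / 0 <= h => [H|].
  case: (leP 0 h) => [/H//|/ltW hN] hpi.
  by rewrite -sqrrN -cosN; apply: H; rewrite ?oppr_ge0// normrN.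
rewrite ger0_norm// => hpi; have p0 := @pi_gt0 R.
have [->|hn0] := eqVneq h 0; first by rewrite cos0 subrr expr0n mul0r.
have hp : 0 < h by rewrite lt0r hn0.
set t := h / 4; have t0 : 0 < t by rewrite divr_gt0.
have tpi : t <= pi / 4 by rewrite ler_pM2r ?invr_gt0.
have c4 : cos (pi / 4) ^+ 2 = 2^-1 :> R.
  have := cos_mulr2n (pi / 4 : R); rewrite (_ : (pi / 4) *+ 2 = pi / 2); last by rewrite mulr2n; field.
  by rewrite cos_pihalf mulr2n; lra.
have c40 : 0 <= cos (pi / 4 : R) by apply: cos_ge0_pihalf; apply/andP; split; lra.
have cge (x : R) : 0 <= x -> x <= pi / 4 -> 2^-1 <= cos x ^+ 2.
  move=> x0 xpi; rewrite -c4 ler_sqr ?nnegrE//; last first.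
    by apply: cos_ge0_pihalf; apply/andP; split; lra.
  have [->//|xn] := eqVneq x (pi / 4).
  rewrite ltW// ltr_cos ?in_itv /=; first by rewrite lt_neqAle xn.
  - by apply/andP; split; lra.
  - by apply/andP; split; lra.
have [c /[!in_itv]/= /andP[c0 ct]] : exists2 c, c \in `]0, t[%R & sin t - sin 0 = cos c * (t - 0) :> R.
  apply: MVT => //; apply: continuous_subspaceT; exact: continuous_sin.
rewrite sin0 !subr0 => sE.
have h2 : h = (t *+ 2) *+ 2 by rewrite /t !mulr2n; field.
have -> : 1 - cos h = 8 * (sin t ^+ 2 * cos t ^+ 2).
  rewrite h2 cos_mulr2n cos2sin2 sin_mulr2n !mulr2n; ring.
have Hc := cge c (ltW c0) (le_trans (ltW ct) tpi).
have Ht := cge t (ltW t0) tpi.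
have -> : h ^+ 2 / 8 = 2 * t ^+ 2 by rewrite /t; field.
rewrite sE exprMn.
have : 2^-1 * 2^-1 <= cos c ^+ 2 * cos t ^+ 2 by rewrite ler_pM ?invr_ge0.
by have := sqr_ge0 t; nra.
Qed.

Lemma segment_lipschitz u (u' : V -> R) j (M : R) x (h : R) :
  (forall y, is_derive y 'e_j u (u' y)) -> (forall y, `|u' y| <= M) ->
  `|u (x + h *: 'e_j) - u x| <= M * `|h|.
Proof.
move=> du uM.
have dl (t : R) : is_derive t 1 (fun s : R => u (x + s *: 'e_j)) (u' (x + t *: 'e_j)).
  exact: is_derive_line.
have cl : continuous (fun s : R => u (x + s *: 'e_j)).
  by move=> t; apply/differentiable_continuous/derivable1_diffP; have [] := dl t.
have key (a b : R) : a <= b -> `|u (x + b *: 'e_j) - u (x + a *: 'e_j)| <= M * (b - a).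
  move=> ab.
  have [c _ ->] := @MVT_segment R (fun s : R => u (x + s *: 'e_j)) _ a b ab
    (fun t _ => dl t) (continuous_subspaceT cl).
  by rewrite normrM [X in _ * X]ger0_norm ?subr_ge0// ler_wpM2r ?subr_ge0.
have x0 : x = x + 0 *: 'e_j by rewrite scale0r addr0.
case: (leP 0 h) => [h0|/ltW h0].
  by rewrite {2}x0 (ger0_norm h0) -[X in M * X]subr0; exact: key.
by rewrite distrC {1}x0 (ler0_norm h0) -[X in M * X]sub0r; exact: key.
Qed.

(** The point [y] is replaced by its translate nearest to [x], the difference is travelled one
    coordinate at a time, and each step is bounded by |h| <= de + h^2/de, whose square is controlled
    by 1 - cos h. *)
Lemma periodic_lipschitz u (u' : 'I_d -> V -> R) (M de : R) x y : 0 < de ->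
  (forall j z, is_derive z 'e_j u (u' j z)) -> (forall j z, `|u' j z| <= M) ->
  lattice_periodic u -> 0 <= M ->
  `|u y - u x| <= M * \sum_j (de + 8 * (1 - cos (x 0 j - y 0 j)) / de).
Proof.
move=> de0 du uM pu M0; have p2 : (0 : R) < 2 * pi by rewrite mulr_gt0// pi_gt0.
(* Rounding to the nearest integer instead of down makes |h_j| <= pi. *)
pose m j := Num.floor ((x 0 j - y 0 j) / (2 * pi) + 2^-1).
pose h j := y 0 j + (m j)%:~R * (2 * pi) - x 0 j.
have -> : u y = u (x + \sum_j h j *: 'e_j).
  rewrite -(periodic_lattice m y pu); congr u.
  rewrite {1}[y]row_sum_delta -big_split /= [x in RHS]row_sum_delta -big_split /=.
  by apply: eq_bigr => j _; rewrite -!scalerDl /h; congr (_ *: _); ring.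
have step s z : `|u (z + \sum_(j <- s) h j *: 'e_j) - u z| <= M * \sum_(j <- s) `|h j|.
  elim: s z => [|j s IH] z; first by rewrite !big_nil addr0 subrr normr0 mulr0.
  rewrite !big_cons mulrDr addrA.
  have -> : u (z + h j *: 'e_j + \sum_(j <- s) h j *: 'e_j) - u z =
    (u (z + h j *: 'e_j + \sum_(j <- s) h j *: 'e_j) - u (z + h j *: 'e_j)) +
    (u (z + h j *: 'e_j) - u z) by ring.
  apply: le_trans (ler_normD _ _) _; rewrite [leRHS]addrC lerD//.
  exact: segment_lipschitz (du j) (uM j).
apply: le_trans (step _ _) _; rewrite ler_wpM2l//; apply: ler_sum => j _.
have hpi : `|h j| <= pi.
  have /andP[h1 h2] := floor_itv ((x 0 j - y 0 j) / (2 * pi) + 2^-1).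
  rewrite -/(m j) in h1 h2; rewrite intrD in h2.
  have qE : (x 0 j - y 0 j) / (2 * pi) * (2 * pi) = x 0 j - y 0 j by rewrite divfK ?gt_eqF.
  move: h1 h2 qE; set w := (x 0 j - y 0 j) / (2 * pi) => h1 h2 qE.
  have e1 := ler_wpM2r (ltW p2) h1.
  have e2 : (w + 2^-1) * (2 * pi) < ((m j)%:~R + 1%:~R) * (2 * pi) by rewrite ltr_pM2r.
  by rewrite ler_norml /h; apply/andP; split; lra.
have -> : cos (x 0 j - y 0 j) = cos (h j).
  have /(congr1 (@complex.Re R)) /= E := expi_period (y 0 j - x 0 j) (m j).
  by rewrite -[LHS]cosN opprB -E; congr cos; rewrite /h; ring.
have H := sqr_le_one_sub_cos hpi.
have H2 : h j ^+ 2 / de <= 8 * (1 - cos (h j)) / de.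
  by rewrite ler_pM2r ?invr_gt0//; lra.
apply: le_trans (lerD (lexx de) H2); rewrite -lerBlDl ler_pdivlMr//.
rewrite -(real_normK (num_real (h j))).
by have := sqr_ge0 (`|h j| - de); have := normr_ge0 (h j); nra.
Qed.

Lemma fcoef_lin (g g' : T -> C) (c : C) k : cintegrable g -> cintegrable g' ->
  fcoef (fun y => c * g y + g' y) k = c * fcoef g k + fcoef g' k.
Proof.
move=> ig ig'; rewrite /fcoef.
have -> : (fun y : T => (c * g y + g' y) * fourier_exp (- k) (torus_point y)) =
  (fun y => c * (g y * fourier_exp (- k) (torus_point y)) +
     g' y * fourier_exp (- k) (torus_point y)) by apply/funext => y; ring.
by rewrite torus_integral_lin; [ring|exact: cintegrable_mul_exp|exact: cintegrable_mul_exp].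
Qed.

Lemma conv_lin K a (g g' : T -> C) (c : C) (x : V) : cintegrable g -> cintegrable g' ->
  conv K a (fun y => c * g y + g' y) x = c * conv K a g x + conv K a g' x.
Proof.
move=> ig ig'; rewrite /conv mulr_sumr -big_split /=; apply: eq_bigr => i _.
by rewrite fcoef_lin//; ring.
Qed.

Let fejer n (j : 'I_d) (k : int) : C := (tri R n k)%:C.

Let fejer_ge0 K n : (0 < n)%N -> (n <= K.+1)%N -> forall j t, 0 <= tsum K (fejer n j) t.
Proof.
move=> n0 nK j t.
rewrite (_ : fejer n j = (fun k => (tri R n (k - 0))%:C)); last by apply/funext => k; rewrite subr0.
rewrite tsum_tri ?absz0// mul0r expi0 mulr1 mulr_ge0 ?invr_ge0 ?ler0n//.
Qed.

(** The cosine is half the sum of the exponentials of frequencies 1 and -1 in the [j]-th variable,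
    and the mean multiplies each of them by [tri R n 1]. *)
Let avg_cos K n j (x : V) : (0 < n)%N -> (n <= K.+1)%N -> (0 < K)%N ->
  avg K (fejer n) (fun y => cos (x 0 j - torus_point y 0 j)) x = tri R n 1.
Proof.
move=> n0 nK K0.
have tri0 : tri R n 0 = 1 by rewrite tri_in// absz0 mul0r subr0.
have ph (c : int) (y : V) : fourier_exp (c *: delta_mx 0 j : 'rV[int]_d) y = expi (c%:~R * y 0 j).
  rewrite fourier_exp_prod (bigD1 j)//= big1 => [|i ij]; rewrite !mxE ?eqxx /=.
    by rewrite mulr1 mulr1.
  by rewrite (negPf ij) mulr0 mul0r expi0.
apply: complexI; rewrite avgE; last 2 first.
- exact: fejer_ge0.
- apply: (@bounded_integrable _ _ _ _ _ 1) => [|y]; last exact: cos_max.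
  apply: (@measurable_torus_continuous R d (fun y => cos (x 0 j - y 0 j))) => y.
  apply: (@continuous_comp _ _ _ (fun y : V => x 0 j - y 0 j) cos); last exact: continuous_cos.
  apply: (@cvgB _ _ _ (nbhs y) (nbhs_filter y) (fun=> x 0 j) (fun y : V => y 0 j)).
    exact: cvg_cst.
  exact: coord_continuous.
pose E (c : int) := (fun y : T => fourier_exp (c *: delta_mx 0 j : 'rV[int]_d) (torus_point y) : C).
have -> : (fun y : T => (cos (x 0 j - torus_point y 0 j))%:C) =
    (fun y => (expi (- x 0 j) / 2) * E 1 y + (expi (x 0 j) / 2 * E (-1) y + 0)).
  apply/funext => y; rewrite /E !ph addr0 mul1r mulN1r.
  set yj := torus_point y 0 j; set th := x 0 j - yj.
  transitivity ((expi th + conjc (expi th)) / 2); first by rewrite addcJ mulrC mulKf.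
  rewrite conjc_expi (_ : - th = - x 0 j + yj); last by rewrite /th; ring.
  by rewrite /th !expiD; ring.
have cE (c : int) : (`|c| <= 1)%N -> conv K (fejer n) (E c) x =
    (tri R n c)%:C * expi (c%:~R * x 0 j).
  move=> c1; rewrite conv_fourier_exp => [|i]; last first.
    rewrite !mxE; case: (_ && _) => /=; last by rewrite mulr0 absz0.
    by rewrite mulr1; exact: leq_trans c1 K0.
  rewrite ph; congr (_ * _); rewrite (bigD1 j)//= big1 => [|i ij].
    by rewrite !mxE !eqxx /= mulr1 mulr1.
  by rewrite !mxE eqxx /= (negPf ij) mulr0 /fejer tri0.
rewrite conv_lin; last 2 first.
- exact: cintegrable_fourier_exp.
- by apply: cintegrable_lin; [exact: cintegrable_fourier_exp|exact: cintegrable0].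
rewrite conv_lin; [|exact: cintegrable_fourier_exp|exact: cintegrable0].
have -> : conv K (fejer n) (fun=> 0) x = 0.
  rewrite /conv big1// => i _; rewrite /fcoef.
  by under [X in torus_integral X]eq_fun do rewrite mul0r; rewrite torus_integral0 mulr0 mulr0 mul0r.
rewrite !cE// (triN R n 1) mul1r mulN1r addr0.
transitivity ((tri R n 1)%:C / 2 * (expi (- x 0 j) * expi (x 0 j)) +
  (tri R n 1)%:C / 2 * (expi (x 0 j) * expi (- x 0 j))); first by ring.
by rewrite -!expiD addNr subrr expi0; field.
Qed.

(* Korovkin's argument: [8 (1 - cos h) / de] controls the modulus of continuity
   away from [h = 0], and its Fejer mean is computed exactly. *)
Lemma fejer_approx n f (f' : 'I_d -> V -> C) (M de : R) x : (1 < n)%N -> 0 < de ->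
  ccont f -> lattice_periodic f -> (forall j, cderiv j f (f' j)) ->
  (forall j z, Normc.normc (f' j z) <= M) -> 0 <= M ->
  Normc.normc (conv n (fejer n) (fun y => f (torus_point y)) x - f x) <=
  2 * M * (d%:R * (de + 8 / (n%:R * de))).
Proof.
move=> n1 de0 cf pf df fM M0; have n0 : (0 < n)%N := ltnW n1.
have K0 := fejer_ge0 n0 (leqnSn n).
have ifT := cintegrable_ccont cf pf.
have i1 : cintegrable (fun _ : T => 1 : C).
  by apply: (bounded_cintegrable (M := Normc.normc (1 : C))) => //; exact: cmeas_cst.
have tri0 : tri R n 0 = 1 by rewrite tri_in// absz0 mul0r subr0.
have mass1 : mass n (fejer n) = 1.
  by apply: complexI; rewrite (massE K0) big1// => j _; rewrite /fejer tri0.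
have -> : conv n (fejer n) (fun y => f (torus_point y)) x - f x =
    conv n (fejer n) (fun y => - f x * 1 + f (torus_point y)) x.
  rewrite conv_lin// addrC mulNr; congr (- _ + _).
  have <- := avgE K0 x (@bounded_integrable _ _ _ mu (fun=> 1) `|1| (measurable_cst _) (fun=> lexx _)).
  by rewrite (avg_cst K0) mul1r mass1 mulr1.
have mid : Normc.normc (conv n (fejer n) (fun y => - f x * 1 + f (torus_point y)) x) <=
    avg n (fejer n) (fun y => Normc.normc (- f x * 1 + f (torus_point y))) x.
  apply: norm_conv_le_avg => //; last exact: cintegrable_lin.
  by move=> j t; rewrite ger0_norm ?K0.
apply: le_trans mid _.
have icos j (c : R) : mu.-integrable setT (EFin \o (fun y : T => c * cos (x 0 j - torus_point y 0 j))).
  apply: (@bounded_integrable _ _ _ _ _ `|c|) => [|y]; last first.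
    by rewrite normrM ler_piMr ?cos_max.
  apply: measurable_funM => //.
  apply: (@measurable_torus_continuous R d (fun y => cos (x 0 j - y 0 j))) => y.
  apply: (@continuous_comp _ _ _ (fun y : V => x 0 j - y 0 j) cos); last exact: continuous_cos.
  apply: (@cvgB _ _ _ (nbhs y) (nbhs_filter y) (fun=> x 0 j) (fun y : V => y 0 j)).
    exact: cvg_cst.
  exact: coord_continuous.
pose c0 := 2 * M * (d%:R * (de + 8 / de)).
pose c1 := - (2 * M * (8 / de)).
have isum s : mu.-integrable setT (EFin \o (fun y : T => \sum_(j <- s) cos (x 0 j - torus_point y 0 j))).
  elim: s => [|j s IH].
    apply: (@bounded_integrable _ _ _ _ _ 0) => [|y]; last by rewrite big_nil normr0.
    by under eq_fun do rewrite big_nil; exact: measurable_cst.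
  have := integrableD measurableT (icos j 1) IH.
  by congr (mu.-integrable _ _); apply/funext => y /=; rewrite big_cons mul1r.
have ione : mu.-integrable setT (EFin \o (fun _ : T => 1 : R)).
  exact: (@bounded_integrable _ _ _ _ (fun=> 1) `|1|).
apply: (@le_trans _ _ (avg n (fejer n) (fun y => c0 * 1 + c1 * \sum_j cos (x 0 j - torus_point y 0 j)) x)).
  apply: le_avg => //.
  - exact/integrable_normc/cintegrable_lin.
  - have := integrableD measurableT (integrableZl measurableT c0 ione)
      (integrableZl measurableT c1 (isum (index_enum _))).
    by congr (mu.-integrable _ _); apply/funext => y /=.
  - move=> y; set z := torus_point y.
    have [p1 p2] := periodic_ReIm pf.
    apply: le_trans (normc_le _) _.
    have rw w : complex.Re (- f x * 1 + w) = complex.Re w - complex.Re (f x) /\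
       complex.Im (- f x * 1 + w) = complex.Im w - complex.Im (f x).
      by rewrite mulr1 ReD ImD; case: (f x) => a b /=; split; rewrite addrC.
    have [-> ->] := rw (f z).
    have H1 := @periodic_lipschitz (fun x => complex.Re (f x)) (fun j x => complex.Re (f' j x))
      M de x z de0 (fun j w => (df j w).1) (fun j w => le_trans (Re_le_normc _) (fM j w)) p1 M0.
    have H2 := @periodic_lipschitz (fun x => complex.Im (f x)) (fun j x => complex.Im (f' j x))
      M de x z de0 (fun j w => (df j w).2) (fun j w => le_trans (Im_le_normc _) (fM j w)) p2 M0.
    apply: le_trans (lerD H1 H2) _.
    have -> : \sum_j (de + 8 * (1 - cos (x 0 j - z 0 j)) / de) =
       d%:R * (de + 8 / de) - 8 / de * \sum_j cos (x 0 j - z 0 j).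
      transitivity (\sum_j ((de + 8 / de) + (- (8 / de)) * cos (x 0 j - z 0 j))).
        by apply: eq_bigr => j _; ring.
      by rewrite big_split /= sumr_const card_ord -mulr_sumr mulNr -[_ *+ d]mulr_natl.
    by rewrite /c0 /c1; lra.
rewrite (avg_lin n (fejer n) c0 c1 x ione (isum _)) (avg_cst K0) mass1.
have -> : avg n (fejer n) (fun y => \sum_j cos (x 0 j - torus_point y 0 j)) x = d%:R * tri R n 1.
  have avs s : avg n (fejer n) (fun y => \sum_(j <- s) cos (x 0 j - torus_point y 0 j)) x =
      \sum_(j <- s) tri R n 1.
    elim: s => [|j s IH].
      rewrite big_nil; under [X in avg _ _ X]eq_fun do rewrite big_nil.
      by rewrite (avg_cst K0) mul0r.
    rewrite big_cons -IH.
    have -> : (fun y : T => \sum_(i <- j :: s) cos (x 0 i - torus_point y 0 i)) =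
      (fun y => 1 * cos (x 0 j - torus_point y 0 j) + 1 * \sum_(i <- s) cos (x 0 i - torus_point y 0 i)).
      by apply/funext => y; rewrite big_cons !mul1r.
    have icos1 : mu.-integrable setT (EFin \o (fun y : T => cos (x 0 j - torus_point y 0 j))).
      have := icos j 1; congr (mu.-integrable _ _).
      by apply/funext => y /=; rewrite mul1r.
    by rewrite (avg_lin n (fejer n) 1 1 x icos1 (isum s)) !mul1r avg_cos.
  by rewrite avs sumr_const card_ord mulr_natl.
rewrite tri_in// /c0 /c1 absz1.
rewrite le_eqVlt; apply/orP; left; apply/eqP; field.
by rewrite pnatr_eq0 -lt0n n0 gt_eqF.
Qed.

End density.

(** * Uniqueness of a distribution with given Fourier coefficients *)

Section test_density.
Variables (R : realType) (d : nat).
Local Notation V := 'rV[R]_d.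
Local Notation C := R[i].
Local Notation mT := (measurableTypeR R).
Local Notation T := (d.-tuple mT).
Local Notation "'e_ j" := (delta_mx 0 j : V) (at level 8, j at level 2, format "''e_' j").
Implicit Types (n : nat) (j : 'I_d) (s : seq 'I_d) (u v : V -> R) (f g : V -> C).

Lemma is_derive_pderivs u s j x : smooth u ->
  is_derive x 'e_j (pderivs s u) (pderivs (j :: s) u x).
Proof. by move=> su; have [_ h] := su s; exact: derivableP. Qed.

Lemma smooth_lin u v (a b : R) : smooth u -> smooth v ->
  smooth (fun x => a * u x + b * v x) /\
  forall s, pderivs s (fun x => a * u x + b * v x) = (fun x => a * pderivs s u x + b * pderivs s v x).
Proof.
move=> su sv.
have D s j x : is_derive x 'e_j (fun x => a * pderivs s u x + b * pderivs s v x)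
    (a * pderivs (j :: s) u x + b * pderivs (j :: s) v x).
  have du := is_derive_pderivs s j x su; have dv := is_derive_pderivs s j x sv.
  exact: (is_deriveD (is_deriveZ a du) (is_deriveZ b dv)).
have E s : pderivs s (fun x => a * u x + b * v x) = (fun x => a * pderivs s u x + b * pderivs s v x).
  elim: s => [//|j s IH]; apply/funext => x.
  by rewrite /= IH; have [_ ->] := D s j x.
split; last exact: E.
move=> s; rewrite E; split; last by move=> j x; have [] := D s j x.
have [cu _] := su s; have [cv _] := sv s => x.
apply: (@cvgD _ _ _ (nbhs x) (nbhs_filter x)).
  by apply: (@cvgM _ _ (nbhs x) (nbhs_filter x) (fun=> a)); [exact: cvg_cst|exact: cu].
by apply: (@cvgM _ _ (nbhs x) (nbhs_filter x) (fun=> b)); [exact: cvg_cst|exact: cv].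
Qed.

Lemma periodic_derive u j : lattice_periodic u -> lattice_periodic (fun x => 'D_('e_j) u x).
Proof.
move=> pu i x; rewrite /derive.
suff -> : (fun h : R => h^-1 *: ((u \o shift (x + (2 * pi) *: 'e_i)) (h *: 'e_j) -
    u (x + (2 * pi) *: 'e_i))) = (fun h => h^-1 *: ((u \o shift x) (h *: 'e_j) - u x)) by [].
by apply/funext => h /=; rewrite pu addrA pu.
Qed.

Lemma periodic_pderivs u s : lattice_periodic u -> lattice_periodic (pderivs s u).
Proof. by move=> pu; elim: s => [//|j s IH]; exact: periodic_derive. Qed.

Definition cD s f : V -> C := fun x =>
  pderivs s (fun y => complex.Re (f y)) x +i* pderivs s (fun y => complex.Im (f y)) x.

Lemma cD_nil f : cD [::] f = f.
Proof. by apply/funext => x; rewrite /cD /=; case: (f x). Qed.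

Definition smoothc f := smooth (fun y => complex.Re (f y)) /\ smooth (fun y => complex.Im (f y)).

Lemma smoothc_test (phi : test R d) : smoothc phi /\ lattice_periodic phi.
Proof. by case: phi => phi [s1 s2 p]; split; [split; [exact: s1|exact: s2]|exact: p]. Qed.

Lemma cderiv_cD f s j : smoothc f -> cderiv j (cD s f) (cD (j :: s) f).
Proof. by move=> [s1 s2] x; split; exact: is_derive_pderivs. Qed.

Lemma ccont_cD f s : smoothc f -> ccont (cD s f).
Proof. by move=> [s1 s2]; split; [have [] := s1 s|have [] := s2 s]. Qed.

Lemma periodic_cD f s : lattice_periodic f -> lattice_periodic (cD s f).
Proof.
by move=> /periodic_ReIm[p1 p2] j x; congr Complex; exact: periodic_pderivs.
Qed.

Lemma smoothc_lin f g (a : C) : smoothc f -> smoothc g ->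
  smoothc (fun x => a * f x + g x) /\
  forall s x, cD s (fun x => a * f x + g x) x = a * cD s f x + cD s g x.
Proof.
move=> [f1 f2] [g1 g2].
have [h1 e1] := smooth_lin (complex.Re a) (- complex.Im a) f1 f2.
have [h2 e2] := smooth_lin 1 1 h1 g1.
have [k1 e3] := smooth_lin (complex.Re a) (complex.Im a) f2 f1.
have [k2 e4] := smooth_lin 1 1 k1 g2.
have E1 : (fun x => complex.Re (a * f x + g x)) = (fun x => 1 *
   (complex.Re a * complex.Re (f x) + (- complex.Im a) * complex.Im (f x)) + 1 * complex.Re (g x)).
  by apply/funext => x; rewrite ReD ReM; ring.
have E2 : (fun x => complex.Im (a * f x + g x)) = (fun x => 1 *
   (complex.Re a * complex.Im (f x) + complex.Im a * complex.Re (f x)) + 1 * complex.Im (g x)).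
  by apply/funext => x; rewrite ImD ImM; ring.
split; first by split; [rewrite E1; exact: h2|rewrite E2; exact: k2].
move=> s x; rewrite /cD E1 E2 e2 e1 e4 e3; apply: complexP.
- by rewrite ReD ReM /=; ring.
- by rewrite ImD ImM /=; ring.
Qed.

Lemma test_lin (a : C) (phi psi : test R d) :
  exists chi : test R d, forall x, chi x = a * phi x + psi x.
Proof.
have [sp pp] := smoothc_test phi; have [sq pq] := smoothc_test psi.
have [[h1 h2] _] := smoothc_lin a sp sq.
have H : smooth_periodic (fun x => a * phi x + psi x).
  by split; [exact: h1|exact: h2|move=> j x; rewrite pp pq].
by exists (exist _ _ H).
Qed.

Lemma linear_functional0 (F : functional R d) (z : test R d) : linear_functional F ->
  (forall x, z x = 0) -> F z = 0.
Proof.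
move=> lF z0; have H := lF 1 z z z; rewrite mul1r in H.
have : F z = F z + F z by apply: H => x; rewrite z0 mul1r addr0.
by move/eqP; rewrite -subr_eq subrr eq_sym => /eqP.
Qed.

(** [linear_functional] relates values at three given test functions, so the sum is built one term
    at a time, starting from a difference that is identically zero. *)
Lemma trig_test (I : Type) (r : seq I) (c : I -> C) (k : I -> 'rV[int]_d) :
  exists chi : test R d, (forall x, chi x = \sum_(i <- r) c i * fourier_exp (k i) x) /\
    forall F : functional R d, linear_functional F ->
      F chi = \sum_(i <- r) c i * F (fourier_test R (k i)).
Proof.
elim: r => [|i r [chi [chiE chiF]]].
  have [z zE] := test_lin (-1) (fourier_test R (0 : 'rV[int]_d)) (fourier_test R 0).
  have z0 x : z x = 0 by rewrite zE mulN1r addNr.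
  exists z; split => [x|F lF]; rewrite big_nil ?z0//.
  exact: linear_functional0.
have [z zE] := test_lin (c i) (fourier_test R (k i)) chi.
exists z; split => [x|F lF]; rewrite big_cons; first by rewrite zE chiE.
by rewrite (lF _ _ _ _ zE) chiF.
Qed.

(** Integration by parts: the derivative of [f] times the exponential has integral zero. *)
Lemma fcoef_cderiv f g j k : cderiv j f g -> ccont f -> ccont g ->
  lattice_periodic f -> lattice_periodic g ->
  fcoef (fun y : T => g (torus_point y)) k =
  'i * (k 0 j)%:~R * fcoef (fun y : T => f (torus_point y)) k.
Proof.
move=> fg cf cg pf pg.
have D := cderivM fg (@cderiv_fourier_exp R d (- k) j).
have cE := @ccont_fourier_exp R d (- k); have pE := @periodic_fourier_exp R d (- k).
have cdE := ccontM (ccont_cst d ('i * ((- k) 0 j)%:~R)) cE.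
have H : torus_integral (fun y : T => g (torus_point y) * fourier_exp (- k) (torus_point y) +
    f (torus_point y) * ('i * ((- k) 0 j)%:~R * fourier_exp (- k) (torus_point y))) = 0.
  apply: (torus_cintegral_deriv D).
  - by apply: ccontD; exact: ccontM.
  - by move=> i x; rewrite pf pg pE.
  - by move=> i x; rewrite pf pE.
have i1 : cintegrable (fun y : T => f (torus_point y) * fourier_exp (- k) (torus_point y)).
  by apply: cintegrable_mul_exp; exact: cintegrable_ccont.
have i2 : cintegrable (fun y : T => g (torus_point y) * fourier_exp (- k) (torus_point y)).
  by apply: cintegrable_mul_exp; exact: cintegrable_ccont.
have E2 : (fun y : T => f (torus_point y) * ('i * ((- k) 0 j)%:~R * fourier_exp (- k) (torus_point y))) =
    (fun y : T => (- ('i * (k 0 j)%:~R)) * (f (torus_point y) * fourier_exp (- k) (torus_point y))).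
  by apply/funext => y; rewrite mxE mulrNz; ring.
rewrite torus_integralD// in H; last by rewrite E2; exact: cintegrableZ.
rewrite E2 torus_integralZ// in H.
rewrite /fcoef mulrCA; congr (_ * _).
by move/eqP: H; rewrite mulNr subr_eq0 => /eqP.
Qed.

(** Differentiating multiplies the coefficients on both sides by i k_j. Hence a mean that
    approximates a function also approximates its derivatives by the means of these. *)
Lemma cD_conv K a (phi : test R d) (chi : test R d) s :
  (forall x, chi x = conv K a (fun y => phi (torus_point y)) x) ->
  forall x, cD s chi x = conv K a (fun y => cD s phi (torus_point y)) x.
Proof.
move=> chiE; have [sc pc] := smoothc_test chi; have [sp pp] := smoothc_test phi.
elim: s => [|j s IH] x; first by rewrite !cD_nil chiE.
have D1 := cderiv_cD s j sc.
have D2 : cderiv j (cD s chi) (conv K a (fun y => cD (j :: s) phi (torus_point y))).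
  have -> : cD s chi = conv K a (fun y => cD s phi (torus_point y)) by apply/funext.
  have := cderiv_sum (index_enum _) (fun i : {ffun 'I_d -> 'I_(2 * K).+1} =>
    cderivZ ((\prod_j a j (freq (i j))) * fcoef (fun y => cD s phi (torus_point y)) (box_freq i))
      (@cderiv_fourier_exp R d (box_freq i) j)).
  congr cderiv; apply/funext => y; apply: eq_bigr => i _.
  rewrite (fcoef_cderiv _ (cderiv_cD s j sp)); first by ring.
  - exact: ccont_cD.
  - exact: ccont_cD.
  - exact: periodic_cD.
  - exact: periodic_cD.
have [[_ r1] [_ i1]] := D1 x; have [[_ r2] [_ i2]] := D2 x.
by apply: complexP; [rewrite -r1 r2|rewrite -i1 i2].
Qed.

(** Induction on the order. The derivative peeled off is the innermost one, the last entry of the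
    list, because its result is again a test function. *)
Lemma bounded_cD N (phi : test R d) :
  exists2 M : R, 0 <= M & forall s, (size s <= N)%N -> forall x, Normc.normc (cD s phi x) <= M.
Proof.
have [sp pp] := smoothc_test phi.
elim: N phi sp pp => [|N IH] phi sp pp.
  have [M HM] := bounded_cperiodic (ccont_cD [::] sp) (periodic_cD [::] pp).
  exists M; first exact: le_trans (normc_ge0 _) (HM 0).
  by move=> s; rewrite leqn0 size_eq0 => /eqP -> x; exact: HM.
have dtest j : exists psi : test R d, forall x, psi x = cD [:: j] phi x.
  have [[s1 s2] p1] := (sp, periodic_cD [:: j] pp).
  have cat u s : pderivs s (pderivs [:: j] u) = pderivs (rcons s j) u.
    by rewrite /pderivs -cats1 foldr_cat.
  have H : smooth_periodic (cD [:: j] phi).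
    split; last exact: p1.
    - by move=> s; have := s1 (rcons s j); rewrite -cat; exact.
    - by move=> s; have := s2 (rcons s j); rewrite -cat; exact.
  by exists (exist _ _ H).
have /choice[psi psiE] := dtest.
have Hpsi j : exists2 M : R, 0 <= M &
    forall s, (size s <= N)%N -> forall x, Normc.normc (cD s (psi j) x) <= M.
  by have [sq pq] := smoothc_test (psi j); exact: IH.
have [M0 M00 HM0] := IH phi sp pp.
have /choice[M HM] : forall j, exists M : R, 0 <= M /\
    forall s, (size s <= N)%N -> forall x, Normc.normc (cD s (psi j) x) <= M.
  by move=> j; have [M ? ?] := Hpsi j; exists M.
exists (M0 + \sum_j M j); first by rewrite addr_ge0// sumr_ge0// => j _; have [] := HM j.
move=> s; case/lastP: s => [|s j] sN x.
  apply: le_trans (HM0 [::] isT x) _; rewrite lerDl sumr_ge0// => j _.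
  by have [] := HM j.
have -> : cD (rcons s j) phi x = cD s (psi j) x.
  rewrite /cD.
  have e1 : (fun y => complex.Re (psi j y)) = pderivs [:: j] (fun y => complex.Re (phi y)).
    by apply/funext => y; rewrite psiE.
  have e2 : (fun y => complex.Im (psi j y)) = pderivs [:: j] (fun y => complex.Im (phi y)).
    by apply/funext => y; rewrite psiE.
  by rewrite e1 e2 /pderivs -cats1 !foldr_cat.
rewrite size_rcons ltnS in sN.
have [_ /(_ s sN x) h] := HM j; apply: le_trans h _.
rewrite (bigD1 j)//= addrCA lerDl addr_ge0// sumr_ge0// => i _.
by have [] := HM i.
Qed.

(** The functional kills every Fejer mean of [phi], and these means converge to [phi] in the
    seminorm that bounds it; the rate needs one derivative more, hence [N.+1]. *)
Lemma functional_eq0 (F : functional R d) : linear_functional F -> continuous_functional F ->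
  (forall k, F (fourier_test R k) = 0) -> forall phi, F phi = 0.
Proof.
move=> lF [N [c cF]] F0 phi.
have [sp pp] := smoothc_test phi.
have [M M0 HM] := bounded_cD N.+1 phi.
suff H n : (1 < n)%N -> Normc.normc (F phi) <= `|c| * (2 * M * (d%:R * 9)) / n%:R.
  apply: Normc.eq0_normc; apply: le_anti; rewrite normc_ge0 andbT.
  set B := `|c| * (2 * M * (d%:R * 9)) in H.
  rewrite leNgt; apply/negP => Fp.
  have := H (maxn 2 (Num.truncn (B / Normc.normc (F phi))).+1) (leq_maxl _ _).
  rewrite leNgt => /negP; apply.
  set n := maxn _ _.
  have n0 : (0 : R) < n%:R by rewrite ltr0n (leq_trans _ (leq_maxl _ _)).
  rewrite ltr_pdivrMr// mulrC -ltr_pdivrMr//.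
  by apply: lt_le_trans (truncnS_gt _) _; rewrite ler_nat leq_maxr.
move=> n1; have n0 : (0 : R) < n%:R by rewrite ltr0n ltnW.
(* Order n^2 together with modulus 1/n balances the two error terms 1/n and 8 n/n^2 of
   [fejer_approx], whence the 9. *)
pose a (j : 'I_d) (k : int) : C := (tri R (n * n) k)%:C.
have [chi [chiE chiF]] := trig_test (index_enum {ffun 'I_d -> 'I_(2 * (n * n)).+1})
  (fun i => (\prod_j a j (freq (i j))) * fcoef (fun y => phi (torus_point y)) (box_freq i))
  (@box_freq d (n * n)).
have chi0 : F chi = 0 by rewrite chiF// big1// => i _; rewrite F0 mulr0.
have [ze zeE] := test_lin (-1) phi chi.
have Fze : F ze = - F phi by rewrite (lF _ _ _ _ zeE) chi0 addr0 mulN1r.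
rewrite -normcN -Fze.
have [sch pch] := smoothc_test chi.
apply: (@le_trans _ _ (c * (2 * M * (d%:R * 9) / n%:R))); last first.
  by rewrite -[leRHS]mulrA; apply: ler_wpM2r; [rewrite divr_ge0 ?mulr_ge0|exact: ler_norm].
apply: cF => s sN x.
rewrite -[X in Normc.normc X]/(cD s ze x).
have -> : cD s ze x = conv (n * n) a (fun y => cD s phi (torus_point y)) x - cD s phi x.
  have zf : (ze : V -> C) = (fun x => -1 * phi x + chi x) by apply/funext.
  have [_ e] := smoothc_lin (-1) sp sch.
  rewrite zf e mulN1r addrC; congr (_ - _); exact: cD_conv.
have nn : (1 < n * n)%N by rewrite (ltn_trans n1)// ltn_Pmull// ltnW.
apply: le_trans (@fejer_approx R d (n * n) (cD s phi) (fun j => cD (j :: s) phi) M (n%:R^-1) x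
   nn _ _ _ _ _ M0) _.
- by rewrite invr_gt0.
- exact: ccont_cD.
- exact: periodic_cD.
- by move=> j; exact: cderiv_cD.
- by move=> j z; apply: HM.
- rewrite le_eqVlt; apply/orP; left; apply/eqP; rewrite natrM; field.
  by rewrite gt_eqF.
Qed.

End test_density.

(** * Functions and functionals *)

Section Lq_series.
Variable R : realType.

Lemma geometric_tail (u : nat -> R) (b z : R) : 0 <= b -> 0 < z < 1 ->
  (forall s, `|u s| <= b * z ^+ s) ->
  cvgn (series u) /\ forall S, `|limn (series u) - series u S| <= b * z ^+ S / (1 - z).
Proof.
move=> b0 /andP[z0 z1] ub.
have nz : `|z| < 1 by rewrite ger0_norm// ltW.
have cu : cvgn (series u).
  apply: (@normed_cvg R R^o); apply: (@series_le_cvg _ _ (geometric b z)) => //.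
  - by move=> n /=.
  - by move=> n; rewrite /= mulr_ge0// exprn_ge0// ltW.
  - exact: is_cvg_geometric_series.
split=> // S.
have step n : `|series u (S + n)%N - series u S| <= b * z ^+ S / (1 - z).
  apply: (@le_trans _ _ (series (geometric (b * z ^+ S) z) n)); last first.
    by apply: geometric_le_lim => //; rewrite mulr_ge0// exprn_ge0// ltW.
  elim: n => [|n IH]; first by rewrite addn0 subrr normr0 /series/= big_nil.
  rewrite addnS /series /= !big_nat_recr //= -/(series u (S + n)) -/(series u S).
  rewrite addrAC; apply: le_trans (ler_normD _ _) _; apply: lerD => //.
  by apply: le_trans (ub _) _; rewrite exprD mulrA.
have cS : (fun n => `|series u (S + n)%N - series u S|) @ \oo --> `|limn (series u) - series u S|.
  apply: cvg_norm; apply: cvgB; last exact: cvg_cst.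
  rewrite (_ : (fun n => series u (S + n)%N) = [sequence series u (n + S)%N]_n).
    by rewrite cvg_shiftn.
  by apply/funext => n /=; rewrite addnC.
have <- := cvg_lim (@Rhausdorff R) cS.
apply: limr_le; first by apply/cvg_ex; eexists; exact: cS.
by apply: nearW => n; exact: step.
Qed.

Variable d : nat.
Local Notation C := R[i].
Local Notation mT := (measurableTypeR R).
Local Notation T := (d.-tuple mT).
Local Notation mu := (torus_measure R d).

Lemma ReB (a b : C) : complex.Re (a - b) = complex.Re a - complex.Re b.
Proof. by case: a b => [? ?] [? ?]. Qed.

Lemma ImB (a b : C) : complex.Im (a - b) = complex.Im a - complex.Im b.
Proof. by case: a b => [? ?] [? ?]. Qed.

Lemma Re_sum I (r : seq I) (F : I -> C) :
  complex.Re (\sum_(i <- r) F i) = \sum_(i <- r) complex.Re (F i).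
Proof. by elim/big_rec2: _ => [//|i x y _ <-]; rewrite ReD. Qed.

Lemma Im_sum I (r : seq I) (F : I -> C) :
  complex.Im (\sum_(i <- r) F i) = \sum_(i <- r) complex.Im (F i).
Proof. by elim/big_rec2: _ => [//|i x y _ <-]; rewrite ImD. Qed.

(** The majorant takes extended values so that it can be a series of nonnegative terms that diverges
    at some points. *)
Lemma Rintegral_le_ereal (f : T -> R) (F : T -> \bar R) (B : R) :
  measurable_fun setT f -> (forall x, 0 <= f x) -> measurable_fun setT F ->
  (forall x, (f x)%:E <= F x)%E -> (\int[mu]_x F x <= B%:E)%E ->
  mu.-integrable setT (EFin \o f) /\ \int[mu]_x f x <= B.
Proof.
move=> mf f0 mF fF FB.
have I0 : (\int[mu]_x (f x)%:E <= B%:E)%E.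
  apply: le_trans FB; apply: ge0_le_integral => //.
  - by move=> x _; rewrite lee_fin.
  - exact/measurable_EFinP.
have i : mu.-integrable setT (EFin \o f).
  apply/integrableP; split; first exact/measurable_EFinP.
  apply: le_lt_trans (ltry B); apply: le_trans I0; apply: ge0_le_integral => //.
  - by apply/measurableT_comp => //; exact/measurable_EFinP.
  - exact/measurable_EFinP.
  - by move=> x _; rewrite /= ger0_norm.
split=> //; rewrite -lee_fin fineK//; exact: integrable_fin_num.
Qed.

(* With weights [z^s] the majorant [H = sum_s z^(-qs) |delta_s|^q] is integrable,
   and wherever it is finite the series is dominated by a geometric one. *)
Lemma Lq_series (del : nat -> T -> C) (q z c : R) : 1 < q -> 0 < z < 1 -> 0 <= c ->
  (forall s, cmeas (del s)) ->
  (forall s, mu.-integrable setT (EFin \o (fun x => Normc.normc (del s x) `^ q))) ->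
  (forall s, \int[mu]_x (Normc.normc (del s x) `^ q) <= c * (z ^+ s) `^ q * (z ^+ s) `^ q) ->
  exists h : T -> C, [/\ cmeas h,
    mu.-integrable setT (EFin \o (fun x => Normc.normc (h x) `^ q)),
    \int[mu]_x (Normc.normc (h x) `^ q) <= (2 / (1 - z)) `^ q / (1 - z `^ q) * c &
    exists B : R, forall S,
      mu.-integrable setT (EFin \o (fun x => Normc.normc (h x - \sum_(s < S) del s x))) /\
      \int[mu]_x Normc.normc (h x - \sum_(s < S) del s x) <= B * z ^+ S].
Proof.
move=> q1 z01 c0 mdel idel Idel.
have q0 : 0 < q by lra.
have /andP[z0 z1] := z01.
have zq0 : 0 < z `^ q by rewrite powR_gt0.
have zq1 : z `^ q < 1.
  by have <- : 1 `^ q = 1 :> R; [rewrite powR1|rewrite gt0_ltr_powR// nnegrE ltW].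
have zs0 s : 0 < z ^+ s by rewrite exprn_gt0.
(* One of the two factors (z^s)^q in the hypothesis is spent on this weight; the other one makes the
   integrals of the weighted terms summable. *)
pose w s := (z ^+ s) `^ (- q).
have w0 s : 0 < w s by rewrite powR_gt0.
pose t s x := w s * Normc.normc (del s x) `^ q.
have t0 s x : 0 <= t s x by rewrite mulr_ge0 ?(ltW (w0 s)) ?powR_ge0.
have it s : mu.-integrable setT (EFin \o t s).
  exact: (integrableZl measurableT (w s) (idel s)).
have mt s : measurable_fun setT (fun x => (t s x)%:E) by apply/measurable_int/(it s).
pose H x := (\sum_(s <oo) (t s x)%:E)%E.
have mH : measurable_fun setT H by apply: ge0_emeasurable_sum => // s x _ _; rewrite lee_fin.
have H0 x : (0 <= H x)%E by apply: nneseries_ge0 => s _ _; rewrite lee_fin.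
have IH : (\int[mu]_x H x <= (c / (1 - z `^ q))%:E)%E.
  rewrite integral_nneseries//; last by move=> s x _; rewrite lee_fin.
  apply: (@le_trans _ _ (\sum_(s <oo) (geometric c (z `^ q) s)%:E)%E).
    apply: lee_nneseries => [s _ _|s _]; first by apply: integral_ge0 => x _; rewrite lee_fin.
    have -> : (\int[mu]_x (t s x)%:E = (\int[mu]_x t s x)%:E)%E.
      by rewrite fineK//; exact: (integrable_fin_num measurableT (it s)).
    rewrite lee_fin RintegralZl//.
    apply: le_trans (ler_wpM2l (ltW (w0 s)) (Idel s)) _.
    have e : (z ^+ s) `^ q = (z `^ q) ^+ s.
      elim: (s) => [|n IHn]; first by rewrite !expr0 powR1.
      by rewrite !exprS powRM ?exprn_ge0 ?(ltW z0)// IHn.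
    have we : w s * (z ^+ s) `^ q = 1 by rewrite /w powRN mulVf// gt_eqF// powR_gt0.
    have -> : w s * (c * (z ^+ s) `^ q * (z ^+ s) `^ q) = (w s * (z ^+ s) `^ q) * (c * (z ^+ s) `^ q) by ring.
    by rewrite we mul1r e.
  apply: lime_le.
    by apply: is_cvg_nneseries => s *; rewrite lee_fin /= mulr_ge0// exprn_ge0// ltW.
  apply: nearW => n; rewrite sumEFin lee_fin -/(series (geometric c (z `^ q)) n).
  by apply: geometric_le_lim => //; rewrite ger0_norm// ltW.
pose E := [set x | (H x < +oo)%E].
pose b x := fine (H x) `^ q^-1.
have b0 x : 0 <= b x by exact: powR_ge0.
have delb s x : E x -> Normc.normc (del s x) <= b x * z ^+ s.
  move=> Ex.
  have tH : t s x <= fine (H x).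
    rewrite -lee_fin fineK ?ge0_fin_numE//.
    have := @nneseries_lim_ge R (fun s => (t s x)%:E) xpredT 0 s.+1.
    have tp (n : nat) : (0 <= n)%N -> true -> (0 <= (t n x)%:E)%E by rewrite lee_fin.
    move=> /(_ tp)/(le_trans _); apply.
    rewrite sumEFin lee_fin big_nat_recr//= lerDr.
    by apply: sumr_ge0 => i _; exact: t0.
  have e (y : R) : 0 <= y -> y = (y `^ q) `^ q^-1.
    by move=> y0; rewrite -powRrM mulfV ?gt_eqF// powRr1.
  have nz : 0 <= Normc.normc (del s x) / z ^+ s by rewrite divr_ge0 ?normc_ge0// ltW.
  rewrite -ler_pdivrMr// (e _ nz) ge0_ler_powR ?invr_ge0 ?(ltW q0) ?nnegrE ?powR_ge0//.
    by rewrite fine_ge0.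
  apply: le_trans tH; rewrite /t /w powRM ?normc_ge0// ?invr_ge0 ?(ltW (zs0 s))// mulrC.
  by rewrite powRN -powR_inv1 ?(ltW (zs0 s))// -powRrM mulN1r powRN.
have reb x : E x -> forall s, `|complex.Re (del s x)| <= b x * z ^+ s.
  by move=> Ex s; exact: le_trans (Re_le_normc _) (delb s x Ex).
have imb x : E x -> forall s, `|complex.Im (del s x)| <= b x * z ^+ s.
  by move=> Ex s; exact: le_trans (Im_le_normc _) (delb s x Ex).
(* Where [H] is infinite the terms are replaced by zero, so that the series converges at every point
   and its limit is measurable. *)
pose re s x := if (H x < +oo)%E then complex.Re (del s x) else 0.
pose im s x := if (H x < +oo)%E then complex.Im (del s x) else 0.
pose h x := limn (series (re^~ x)) +i* limn (series (im^~ x)).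
have mE : measurable E.
  rewrite /E -[X in measurable X]setTI; exact: measurable_lte.
have mif (f : T -> R) : measurable_fun setT f ->
    measurable_fun setT (fun x => if (H x < +oo)%E then f x else 0).
  move=> mf; apply: measurable_fun_ifT => //.
  apply: (@measurable_fun_bool _ _ _ _ true).
  by rewrite setTI; rewrite [X in measurable X](_ : _ = E)//; apply/seteqP; split.
have reE x : E x -> re^~ x = (fun s => complex.Re (del s x)).
  by move=> Ex; apply/funext => s; rewrite /re Ex.
have imE x : E x -> im^~ x = (fun s => complex.Im (del s x)).
  by move=> Ex; apply/funext => s; rewrite /im Ex.
have out x : ~ E x -> re^~ x = (fun=> 0) /\ im^~ x = (fun=> 0).
  by move=> Ex; split; apply/funext => s; rewrite /re /im ifF//; apply/negbTE/negP.
have series0 : series (fun=> 0 : R) = (fun=> 0).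
  by apply/funext => n; rewrite /series /= big1.
have cre x : cvgn (series (re^~ x)).
  have [Ex|/out[-> _]] := pselect (E x).
    by rewrite reE//; have [] := geometric_tail (b0 x) z01 (reb x Ex).
  by rewrite series0; exact: is_cvg_cst.
have cim x : cvgn (series (im^~ x)).
  have [Ex|/out[_ ->]] := pselect (E x).
    by rewrite imE//; have [] := geometric_tail (b0 x) z01 (imb x Ex).
  by rewrite series0; exact: is_cvg_cst.
have mh : cmeas h.
  split.
  - apply: (@measurable_fun_cvg _ _ _ _ (fun n x => series (re^~ x) n)) => [n|x _]; last exact: cre.
    by apply: measurable_sum => s; apply: mif; have [] := mdel s.
  - apply: (@measurable_fun_cvg _ _ _ _ (fun n x => series (im^~ x) n)) => [n|x _]; last exact: cim.
    by apply: measurable_sum => s; apply: mif; have [] := mdel s.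
have tail x S : E x -> Normc.normc (h x - \sum_(s < S) del s x) <= 2 / (1 - z) * b x * z ^+ S.
  move=> Ex; apply: le_trans (normc_le _) _.
  have [_ /(_ S) r] := geometric_tail (b0 x) z01 (reb x Ex).
  have [_ /(_ S) i] := geometric_tail (b0 x) z01 (imb x Ex).
  rewrite -reE// in r; rewrite -imE// in i.
  have eR : complex.Re (h x - \sum_(s < S) del s x) = limn (series (re^~ x)) - series (re^~ x) S.
    by rewrite ReB; congr (_ - _); rewrite reE// /series /= big_mkord Re_sum.
  have eI : complex.Im (h x - \sum_(s < S) del s x) = limn (series (im^~ x)) - series (im^~ x) S.
    by rewrite ImB; congr (_ - _); rewrite imE// /series /= big_mkord Im_sum.
  rewrite eR eI; apply: le_trans (lerD r i) _.
  rewrite le_eqVlt; apply/orP; left; apply/eqP; field.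
  by rewrite subr_eq0 gt_eqF.
have hb x : E x -> Normc.normc (h x) <= 2 / (1 - z) * b x.
  by move=> Ex; have := tail x 0%N Ex; rewrite big_ord0 subr0 expr0 mulr1.
have h0 x : ~ E x -> h x = 0.
  move=> /out[e1 e2]; rewrite /h e1 e2 series0.
  by have -> : limn (fun=> 0 : R) = 0 by exact: (cvg_lim _ (cvg_cst _)).
have zz0 : 0 < 2 / (1 - z) by rewrite divr_gt0// subr_gt0.
have bq x : b x `^ q = fine (H x).
  by rewrite /b -powRrM mulVf ?gt_eqF// powRr1// fine_ge0.
have Hmul (v : R) : 0 <= v -> (\int[mu]_x (v%:E * H x) <= (v * (c / (1 - z `^ q)))%:E)%E.
  by move=> v0; rewrite ge0_integralZl//; rewrite EFinM lee_wpmul2l// lee_fin.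
have HE x : E x -> H x = (fine (H x))%:E by move=> Ex; rewrite fineK// ge0_fin_numE.
have vq0 : 0 < (2 / (1 - z)) `^ q by rewrite powR_gt0.
have [iq Iq] : mu.-integrable setT (EFin \o (fun x => Normc.normc (h x) `^ q)) /\
    \int[mu]_x (Normc.normc (h x) `^ q) <= (2 / (1 - z)) `^ q * (c / (1 - z `^ q)).
  apply: (@Rintegral_le_ereal _ (fun x => ((2 / (1 - z)) `^ q)%:E * H x)%E).
  - apply: (measurableT_comp (f := fun x : R => x `^ q)); first exact: measurable_powR.
    exact: measurable_normc.
  - by move=> x; exact: powR_ge0.
  - exact: measurable_funeM.
  - move=> x; have [Ex|nEx] := pselect (E x).
      rewrite HE// -EFinM lee_fin -bq -powRM ?(ltW zz0)//.
      apply: (ge0_ler_powR (ltW q0)); last exact: hb.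
        by rewrite nnegrE normc_ge0.
      by rewrite nnegrE mulr_ge0// ltW.
    rewrite h0// Normc.normc0 powR0 ?gt_eqF// mule_ge0// lee_fin ltW//.
  - exact: Hmul (ltW vq0).
exists h; split=> //; first by rewrite mulrAC -mulrA.
exists (2 / (1 - z) * ((2 * pi) ^+ d + c / (1 - z `^ q))) => S.
have vS0 : 0 <= 2 / (1 - z) * z ^+ S by rewrite mulr_ge0 ?(ltW zz0)// ltW.
have mS : cmeas (fun x => h x - \sum_(s < S) del s x).
  under [X in cmeas X]eq_fun do rewrite -mulN1r.
  apply: cmeasD => //; apply: cmeasM; first exact: cmeas_cst.
  exact: cmeas_sum.
rewrite mulrAC.
apply: (@Rintegral_le_ereal _ (fun x => (2 / (1 - z) * z ^+ S)%:E * (1 + H x))%E).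
- exact: measurable_normc.
- by move=> x; exact: normc_ge0.
- by apply: measurable_funeM; apply: emeasurable_funD.
- move=> x; have [Ex|nEx] := pselect (E x).
    rewrite HE// -EFinD -EFinM lee_fin; apply: le_trans (tail x S Ex) _.
    rewrite mulrAC ler_wpM2l//.
    have Hx0 : 0 <= fine (H x) by rewrite fine_ge0.
    (* The tail is bounded by a multiple of H^(1/q), which is at most 1 + H and thus integrable. *)
    have [f1|f1] := leP (fine (H x)) 1.
      rewrite (@le_trans _ _ 1)// ?lerDl//.
      have <- : 1 `^ q^-1 = 1 :> R by rewrite powR1.
      by rewrite ge0_ler_powR ?nnegrE ?invr_ge0 ?(ltW q0).
    rewrite (@le_trans _ _ (fine (H x)))// ?lerDr//.
    rewrite -[leRHS]powRr1//; apply: ler_powR; first exact: ltW.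
    by rewrite invf_le1// ltW.
  have -> : H x = +oo%E.
    by apply/eqP; rewrite -leye_eq leNgt; apply/negP.
  rewrite addey// mulr_infty; move: vS0; rewrite le_eqVlt => /predU1P[e|vS].
    by move: e => /eqP; rewrite eq_sym mulf_eq0 !gt_eqF.
  by rewrite gtr0_sg// mul1e leey.
- have i1 : (\int[mu]_x (1%:E) = ((2 * pi) ^+ d)%:E)%E.
    by rewrite integral_cst// mul1e; exact: torus_measureT.
  have m1H : measurable_fun setT (fun x => 1 + H x)%E by exact: emeasurable_funD.
  have p1H x : (0 <= 1 + H x)%E by rewrite adde_ge0.
  rewrite ge0_integralZl//.
  rewrite ge0_integralD// i1.
  rewrite [leRHS]EFinM [in leRHS]EFinD lee_wpmul2l ?lee_fin// leeD2l//.
Qed.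

End Lq_series.

(** * Functionals given by functions *)

Section regular_functionals.
Variables (R : realType) (d : nat).
Local Notation C := R[i].
Local Notation mT := (measurableTypeR R).
Local Notation T := (d.-tuple mT).
Local Notation mu := (torus_measure R d).
Implicit Types (g h : T -> C) (F G : functional R d) (q : R).

Lemma cmeas_test (phi : test R d) : cmeas (fun x : T => phi (torus_point x)).
Proof.
by have [sp _] := smoothc_test phi; apply: cmeas_ccont; rewrite -(cD_nil phi); exact: ccont_cD.
Qed.

Lemma bounded_test (phi : test R d) : exists M : R, forall x, Normc.normc (phi x) <= M.
Proof.
have [M _ HM] := bounded_cD 0 phi.
by exists M => x; have := HM [::] isT x; rewrite cD_nil.
Qed.

Lemma cintegrable_mul_test g (phi : test R d) : cintegrable g ->
  cintegrable (fun x => g x * phi (torus_point x)).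
Proof.
move=> ig; have [M HM] := bounded_test phi.
by apply: (cintegrableM (M := M)) => //; exact: cmeas_test.
Qed.

Lemma linear_regular g : cintegrable g -> linear_functional (regular_functional g).
Proof.
move=> ig a phi psi chi E; rewrite /regular_functional -torus_integral_lin.
- by congr torus_integral; apply/funext => x; rewrite E; ring.
- exact: cintegrable_mul_test.
- exact: cintegrable_mul_test.
Qed.

Lemma continuous_regular g : cintegrable g -> continuous_functional (regular_functional g).
Proof.
move=> ig; exists 0%N, (\int[mu]_x Normc.normc (g x)) => phi B HB.
have HB0 x : Normc.normc (phi x) <= B.
  by have := HB [::] isT x; rewrite -[X in Normc.normc X]/(cD [::] phi x) cD_nil.
have i := cintegrable_mul_test phi ig.
apply: le_trans (normc_torus_integral i) _.
rewrite -RintegralZr//; last exact: integrable_normc.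
apply: le_Rintegral => //.
- exact: integrable_normc.
- have := integrableZl measurableT B (integrable_normc ig).
  by congr (mu.-integrable _ _); apply/funext => x /=; rewrite -EFinM mulrC.
- by move=> x _; rewrite Normc.normcM ler_wpM2l ?normc_ge0.
Qed.

Lemma regular_functional_lin g h (a : C) : cintegrable g -> cintegrable h ->
  regular_functional (fun x => a * g x + h x) =
  a *: (regular_functional g : functional R d) + regular_functional h.
Proof.
move=> ig ih; apply/funext => phi; rewrite /regular_functional.
transitivity (a * torus_integral (fun x => g x * phi (torus_point x)) +
    torus_integral (fun x => h x * phi (torus_point x))); last by [].
rewrite -torus_integral_lin; try exact: cintegrable_mul_test.
by congr torus_integral; apply/funext => x; ring.
Qed.

Lemma regular_functional_sum I (s : seq I) (c : I -> C) (G : I -> T -> C) :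
  (forall i, cintegrable (G i)) ->
  regular_functional (fun x => \sum_(i <- s) c i * G i x) =
  \sum_(i <- s) c i *: (regular_functional (G i) : functional R d).
Proof.
move=> iG; elim: s => [|i s IH].
  rewrite big_nil; apply/funext => phi; rewrite /regular_functional.
  under [X in torus_integral X]eq_fun do rewrite big_nil mul0r.
  by rewrite torus_integral0.
rewrite big_cons -IH -regular_functional_lin//.
  by congr regular_functional; apply/funext => x; rewrite big_cons.
by apply: cintegrable_sum => j; exact: cintegrableZ.
Qed.

Lemma linear_functionalB F G : linear_functional F -> linear_functional G ->
  linear_functional (F - G).
Proof.
move=> lF lG a phi psi chi E.
have -> : (F - G) chi = F chi - G chi by [].
have -> : (F - G) phi = F phi - G phi by [].
have -> : (F - G) psi = F psi - G psi by [].
by rewrite (lF _ _ _ _ E) (lG _ _ _ _ E); ring.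
Qed.

Lemma continuous_functionalB F G : continuous_functional F -> continuous_functional G ->
  continuous_functional (F - G).
Proof.
move=> [N [c cF]] [N' [c' cG]]; exists (maxn N N'), (c + c') => phi B HB.
have -> : (F - G) phi = F phi - G phi by [].
rewrite mulrDl; apply: le_trans (le_normcD _ _) _; rewrite normcN; apply: lerD.
- by apply: cF => s sN; apply: HB; apply: leq_trans sN _; exact: leq_maxl.
- by apply: cG => s sN; apply: HB; apply: leq_trans sN _; exact: leq_maxr.
Qed.

Lemma fcoef_regular g k :
  fcoef g k = ((2 * pi) ^- d)%:C * regular_functional g (fourier_test R (- k)).
Proof. by []. Qed.

Lemma distribution_eq F G : periodic_distribution F -> periodic_distribution G ->
  (forall k, fourier_coef F k = fourier_coef G k) -> F = G.
Proof.
move=> [lF cF] [lG cG] FG; apply/funext => phi; apply/eqP; rewrite -subr_eq0; apply/eqP.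
apply: (functional_eq0 (linear_functionalB lF lG) (continuous_functionalB cF cG)) => k.
have -> : (F - G) (fourier_test R k) = F (fourier_test R k) - G (fourier_test R k) by [].
apply/eqP; rewrite subr_eq0; apply/eqP.
have := FG (- k); rewrite /fourier_coef opprK; apply: mulfI.
by rewrite fmorph_eq0 invr_eq0 gt_eqF// twopi_gt0.
Qed.

Lemma fun_normE q g : 0 < q -> cmeas g ->
  mu.-integrable setT (EFin \o (fun x => Normc.normc (g x) `^ q)) ->
  fun_norm q g = ((\int[mu]_x (Normc.normc (g x) `^ q)) `^ q^-1)%:E.
Proof.
move=> q0 mg ig; rewrite /fun_norm unlock.
have -> : (\int[mu]_x (`|(Normc.normc (g x))%:E| `^ q) = (\int[mu]_x (Normc.normc (g x) `^ q))%:E)%E.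
  rewrite fineK; last exact: (integrable_fin_num measurableT ig).
  apply: eq_integral => x _.
  by rewrite abse_EFin ger0_norm ?normc_ge0// poweR_EFin.
by rewrite poweR_EFin.
Qed.

Lemma fun_norm_lt q g (c : R) : 0 < q -> 0 <= c -> cmeas g -> (fun_norm q g < c%:E)%E ->
  mu.-integrable setT (EFin \o (fun x => Normc.normc (g x) `^ q)) /\
  \int[mu]_x (Normc.normc (g x) `^ q) <= c `^ q.
Proof.
move=> q0 c0 mg Hc.
have mq : measurable_fun setT (fun x => Normc.normc (g x) `^ q).
  apply: (measurableT_comp (f := fun x : R => x `^ q)); first exact: measurable_powR.
  exact: measurable_normc.
apply: (@Rintegral_le_ereal _ _ _ (fun x => (Normc.normc (g x) `^ q)%:E)) => //.
- by move=> x; exact: powR_ge0.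
- exact/measurable_EFinP.
have E : (\int[mu]_x (Normc.normc (g x) `^ q)%:E = fun_norm q g `^ q)%E.
  rewrite /fun_norm poweR_Lnorm ?gt_eqF//; apply: eq_integral => x _.
  by rewrite abse_EFin ger0_norm ?normc_ge0// poweR_EFin.
rewrite E -poweR_EFin; apply: (gt0_ler_poweR (ltW q0)); last exact: ltW.
- by rewrite in_itv /= Lnorm_ge0 leey.
- by rewrite in_itv /= lee_fin c0 leey.
Qed.

(** On a space of finite measure this crude inequality takes the place of Holder's when lowering an
    exponent; only finiteness of the constant matters. *)
Lemma powR_le_1D (x a b : R) : 0 <= x -> 0 <= a -> a <= b -> x `^ a <= 1 + x `^ b.
Proof.
move=> x0 a0 ab; have [x1|x1] := leP x 1.
  rewrite (@le_trans _ _ 1)// ?lerDl ?powR_ge0//.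
  have <- : 1 `^ a = 1 :> R by rewrite powR1.
  by apply: (ge0_ler_powR a0); rewrite ?nnegrE.
rewrite (@le_trans _ _ (x `^ b))// ?lerDr//.
by apply: ler_powR => //; exact: ltW.
Qed.

Lemma Rintegral_powR_1D (G : T -> R) (a b B : R) : measurable_fun setT G -> (forall x, 0 <= G x) ->
  0 <= a -> a <= b -> mu.-integrable setT (EFin \o (fun x => G x `^ b)) ->
  \int[mu]_x (G x `^ b) <= B ->
  mu.-integrable setT (EFin \o (fun x => G x `^ a)) /\
  \int[mu]_x (G x `^ a) <= (2 * pi) ^+ d + B.
Proof.
move=> mG G0 a0 ab ib Ib.
have i1 : mu.-integrable setT (EFin \o (fun _ : T => 1 : R)).
  exact: (@bounded_integrable _ _ _ _ (fun=> 1) `|1|).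
have mq c : measurable_fun setT (fun x => G x `^ c).
  by apply: (measurableT_comp (f := fun x : R => x `^ c)); first exact: measurable_powR.
apply: (@Rintegral_le_ereal _ _ _ (fun x => (1 + G x `^ b)%:E)) => //.
- by move=> x; exact: powR_ge0.
- by apply/measurable_EFinP; apply: measurable_funD.
- by move=> x; rewrite lee_fin powR_le_1D.
have -> : (\int[mu]_x (1 + G x `^ b)%:E = ((2 * pi) ^+ d + \int[mu]_x (G x `^ b))%:E)%E.
  rewrite integralD_EFin// EFinD; congr (_ + _)%E.
    by rewrite integral_cst// mul1e; exact: torus_measureT.
  by rewrite fineK//; exact: (integrable_fin_num measurableT ib).
by rewrite lee_fin lerD2l.
Qed.

Lemma cintegrable_powR g (b : R) : 1 <= b -> cmeas g ->
  mu.-integrable setT (EFin \o (fun x => Normc.normc (g x) `^ b)) -> cintegrable g.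
Proof.
move=> b1 mg ib.
have [i _] := Rintegral_powR_1D (measurable_normc mg) (fun x => normc_ge0 _) ler01 b1 ib (lexx _).
apply: (cintegrable_le mg (b := fun x => Normc.normc (g x) `^ 1) i).
by move=> x; rewrite powRr1 ?normc_ge0.
Qed.

Lemma Lp_fun_integrable q g : 1 <= q -> Lp_fun q g ->
  [/\ cmeas g, cintegrable g & mu.-integrable setT (EFin \o (fun x => Normc.normc (g x) `^ q))].
Proof.
move=> q1 [m1 m2 fin]; have mg : cmeas g by [].
have q0 : 0 < q by lra.
have := fin; rewrite -ge0_fin_numE ?Lnorm_ge0// => fn.
have [c c0 Hc] : exists2 c : R, 0 <= c & (fun_norm q g < c%:E)%E.
  exists (fine (fun_norm q g) + 1); first by rewrite addr_ge0// fine_ge0// Lnorm_ge0.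
  by rewrite EFinD fineK// lteDl// lte_fin.
have [i _] := fun_norm_lt q0 c0 mg Hc.
by split=> //; exact: cintegrable_powR q1 mg i.
Qed.

Lemma bounded_Lp_fun q g (M : R) : 0 < q -> cmeas g -> (forall x, Normc.normc (g x) <= M) ->
  Lp_fun q g.
Proof.
move=> q0 mg HM; have [m1 m2] := mg; split=> //.
rewrite fun_normE ?ltry//; exact: integrable_powR_bounded (ltW q0) mg HM.
Qed.

Lemma Lp_norm_lt q F (c : R) : 1 <= q -> 0 <= c -> (Lp_norm q F < c%:E)%E -> exists g, [/\
  F = regular_functional g, cmeas g,
  mu.-integrable setT (EFin \o (fun x => Normc.normc (g x) `^ q)) &
  \int[mu]_x (Normc.normc (g x) `^ q) <= c `^ q].
Proof.
move=> q1 c0 /ereal_inf_lt[_ [g [[m1 m2 fin] E] <-] Hc].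
have mg : cmeas g by [].
have q0 : 0 < q by lra.
by have [i I] := fun_norm_lt q0 c0 mg Hc; exists g.
Qed.

(** Tested against one exponential, the series defining the Weyl derivative has at most one nonzero
    term, so its partial sums are eventually constant. *)
Lemma weyl_coef j (r : R) F g : cintegrable g -> is_weyl_derivative j r F (regular_functional g) ->
  forall k, fcoef g k = if nonzero_freq k then fourier_coef F k * weyl_factor r (k 0 j) else 0.
Proof.
move=> ig HF k.
have := HF (fourier_test R (- k)); set x := (X in partial_sum X) => Hx.
pose c := if nonzero_freq k then
   fourier_coef F k * weyl_factor r (k 0 j) * ((2 * pi) ^+ d)%:C else 0.
have xE l : x l = if l == k then c else 0.
  rewrite /x /c; case: eqP => [->|/eqP lk].
    case: ifP => // _; congr (_ * _); rewrite /regular_functional.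
    under [X in torus_integral X]eq_fun do rewrite -fourier_expD.
    by rewrite torus_integral_fourier_exp subrr eqxx.
  case: ifP => // _; rewrite /regular_functional.
  under [X in torus_integral X]eq_fun do rewrite -fourier_expD.
  by rewrite torus_integral_fourier_exp subr_eq0 (negPf lk) mulr0.
have Hc : partial_sum x @ totally --> (c : C^o).
  move=> A /nbhs_singleton Ac; exists [fset k]%fset => // B /= kB.
  have {}kB : k \in B by move: kB; rewrite fsub1set.
  suff -> : partial_sum x B = c by [].
  rewrite /partial_sum -(@big_seq_fsetE _ _ _ _ B xpredT x) (bigD1_seq k) ?fset_uniq//=.
  rewrite xE eqxx big1 ?addr0// => l lk.
  by rewrite xE (negPf lk).
have E : regular_functional g (fourier_test R (- k)) = c.
  by apply: (@cvg_unique _ (@norm_hausdorff _ C^o) _ (fmap_proper_filter _ _) _ _ Hx Hc);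
     exact: totally_filter.
have N : ((2 * pi) ^- d)%:C * ((2 * pi) ^+ d)%:C = 1 :> C.
  by rewrite -rmorphM mulVf ?rmorph1// gt_eqF// twopi_gt0.
rewrite fcoef_regular E /c; case: ifP => _; last by rewrite mulr0.
by rewrite mulrCA N mulr1.
Qed.

End regular_functionals.

(** * Trigonometric polynomials in several variables *)

Section trigonometric_polynomials.
Variables (R : realType) (d : nat).
Local Notation V := 'rV[R]_d.
Local Notation C := R[i].
Local Notation mT := (measurableTypeR R).
Local Notation T := (d.-tuple mT).
Local Notation mu := (torus_measure R d).
Implicit Types (K : nat) (c : 'rV[int]_d -> C) (k : 'rV[int]_d) (g : T -> C).
Local Notation box K := {ffun 'I_d -> 'I_(2 * K).+1}.

(** The factors are switched from [y] to [x] one index at a time, so each term contains exactly one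
    difference. *)
Lemma prod_telescope (x y : 'I_d -> C) : \prod_j x j - \prod_j y j =
  \sum_(j < d) \prod_(i < d) (if (i < j)%N then x i else if i == j then x i - y i else y i).
Proof.
pose P m := \prod_(i < d) (if (i < m)%N then x i else y i).
have -> : \prod_j x j = P d by apply: eq_bigr => i _; rewrite ltn_ord.
have -> : \prod_j y j = P 0%N by apply: eq_bigr.
rewrite -(telescope_sumr P) // big_mkord; apply: eq_bigr => j _.
rewrite /P !(bigD1 j (P := xpredT)) //= !ltnn ltnSn eqxx mulrBl.
congr (_ * _ - _ * _); apply: eq_bigr => i ij.
- rewrite (negPf ij) ltnS leq_eqVlt.
  by have /negPf -> : (i != j :> nat)%N by [].
- by rewrite (negPf ij).
Qed.

Definition trig K c (x : V) : C := \sum_(i : box K) c (box_freq i) * fourier_exp (box_freq i) x.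

Lemma convEtrig K a g : conv K a g = trig K (fun k => \prod_j a j (k ord0 j) * fcoef g k).
Proof.
apply/funext => x; apply: eq_bigr => i _; congr (_ * _ * _).
by apply: eq_bigr => j _; rewrite mxE.
Qed.

Lemma trig_sum K I (s : seq I) (F : I -> 'rV[int]_d -> C) x :
  trig K (fun k => \sum_(i <- s) F i k) x = \sum_(i <- s) trig K (F i) x.
Proof. by rewrite exchange_big /=; apply: eq_bigr => i _; rewrite mulr_suml. Qed.

Lemma cintegrable_trig K c : cintegrable (fun x : T => trig K c (torus_point x)).
Proof.
by apply: cintegrable_sum => i; apply: cintegrableZ; exact: cintegrable_fourier_exp.
Qed.

Lemma fcoef_sum I (s : seq I) (F : I -> T -> C) k : (forall i, cintegrable (F i)) ->
  fcoef (fun x => \sum_(i <- s) F i x) k = \sum_(i <- s) fcoef (F i) k.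
Proof.
move=> iF; rewrite /fcoef -mulr_sumr -torus_integral_sum.
  by congr (_ * torus_integral _); apply/funext => x; rewrite mulr_suml.
by move=> i; exact: cintegrable_mul_exp.
Qed.

Lemma fcoefZ g (a : C) k : cintegrable g -> fcoef (fun x => a * g x) k = a * fcoef g k.
Proof.
move=> ig; have := fcoef_lin a k ig (cintegrable0 R d).
have -> : (fun y : T => a * g y + 0) = (fun y => a * g y).
  by apply/funext => y; rewrite addr0.
move=> ->; rewrite {2}/fcoef; under [X in torus_integral X]eq_fun do rewrite mul0r.
by rewrite torus_integral0 mulr0 addr0.
Qed.

Lemma box_freqP K k : (forall j, (`|k ord0 j| <= K)%N) -> exists i : box K, box_freq i = k.
Proof.
move=> kK; have /choice[i Hi] : forall j, exists i : 'I_(2 * K).+1, freq i = k 0 j.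
  by move=> j; exact: freqP.
by exists [ffun j => i j]; apply/rowP => j; rewrite mxE ffunE.
Qed.

Lemma fcoef_trig K c k : (forall k, (exists j, (K < `|k ord0 j|)%N) -> c k = 0) ->
  fcoef (fun x => trig K c (torus_point x)) k = c k.
Proof.
move=> cK; rewrite fcoef_sum; last first.
  by move=> i; apply: cintegrableZ; exact: cintegrable_fourier_exp.
transitivity (\sum_(i : box K) c (box_freq i) * (box_freq i == k)%:R).
  by apply: eq_bigr => i _; rewrite fcoefZ ?fcoef_fourier_exp//; exact: cintegrable_fourier_exp.
have [kK|] := pselect (forall j, (`|k ord0 j| <= K)%N).
  have [i <-] := box_freqP kK.
  rewrite (bigD1 i)//= eqxx mulr1 big1 ?addr0// => i' i'i.
  by rewrite (inj_eq (@box_freq_inj d K)) (negPf i'i) mulr0.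
move=> /existsNP[j /negP]; rewrite -ltnNge => kj.
rewrite cK; last by exists j.
rewrite big1// => i _; case: eqP => [E|_]; last by rewrite mulr0.
by move: kj; rewrite -E mxE ltnNge absz_freq.
Qed.

Lemma normc_fcoef g k : cintegrable g ->
  Normc.normc (fcoef g k) <= (2 * pi) ^- d * \int[mu]_x Normc.normc (g x).
Proof.
move=> ig; rewrite /fcoef Normc.normcM.
have -> : Normc.normc ((2 * pi) ^- d : R)%:C = (2 * pi) ^- d.
  by rewrite /= expr0n addr0 sqrtr_sqr ger0_norm// invr_ge0 (ltW (twopi_gt0 R d)).
rewrite ler_wpM2l ?invr_ge0 ?(ltW (twopi_gt0 R d))//.
have := normc_torus_integral (cintegrable_mul_exp (- k) ig).
move=> /le_trans; apply; rewrite le_eqVlt; apply/orP; left; apply/eqP; congr Rintegral.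
apply/funext => x.
by rewrite Normc.normcM normc_fourier_exp mulr1.
Qed.

Lemma sum_powR_le (u : 'I_d -> R) (q : R) : 0 < q -> (forall j, 0 <= u j) ->
  (\sum_j u j) `^ q <= d%:R `^ q * \sum_j u j `^ q.
Proof.
move=> q0 u0; have [d0|d0] := posnP d.
  have h (i : 'I_d) : False by have : (i < 0)%N by rewrite -[X in (_ < X)%N]d0.
  rewrite big1 => [|i]; last by case: (h i).
  by rewrite powR0 ?gt_eqF// mulr_ge0 ?powR_ge0 ?sumr_ge0// => i; rewrite powR_ge0.
pose j0 := Ordinal d0; pose j := [arg max_(i > j0) u i]%O.
have uj i : u i <= u j by rewrite /j; case: arg_maxP => // m _; exact.
have s0 : 0 <= \sum_j u j by apply: sumr_ge0.
apply: (@le_trans _ _ ((d%:R * u j) `^ q)).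
  apply: ge0_ler_powR; rewrite ?nnegrE ?mulr_ge0//; first exact: ltW.
  apply: (@le_trans _ _ (\sum_(i < d) u j)); first exact: ler_sum.
  by rewrite sumr_const card_ord mulr_natl.
rewrite powRM// ler_wpM2l ?powR_ge0// (bigD1 j)//= lerDl sumr_ge0// => i _.
exact: powR_ge0.
Qed.

Lemma geometric_le0 (x B z : R) (S0 : nat) : 0 < z < 1 ->
  (forall S, (S0 <= S)%N -> x <= B * z ^+ S) -> x <= 0.
Proof.
move=> /andP[z0 z1] H.
have nz : `|z| < 1 by rewrite ger0_norm// ltW.
apply: (cvgr_to_ge (cvg_geometric B nz)); near=> S; rewrite /= H//; near: S.
exact: nbhs_infty_ge.
Unshelve. all: by end_near. Qed.

Lemma integrable_Rsum I (s : seq I) (F : I -> T -> R) :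
  (forall i, mu.-integrable setT (EFin \o F i)) ->
  mu.-integrable setT (EFin \o (fun x => \sum_(i <- s) F i x)) /\
  \int[mu]_x (\sum_(i <- s) F i x) = \sum_(i <- s) \int[mu]_x F i x.
Proof.
move=> iF; elim: s => [|i s [IH1 IH2]].
  under [X in EFin \o X]eq_fun do rewrite big_nil.
  under eq_Rintegral do rewrite big_nil.
  rewrite big_nil Rintegral_cst// mul0r; split=> //.
  by apply: (@bounded_integrable _ _ _ _ (fun=> 0) 0) => // x; rewrite normr0.
under [X in EFin \o X]eq_fun do rewrite big_cons.
under eq_Rintegral do rewrite big_cons.
rewrite big_cons -IH2; split; last exact: RintegralD.
have := integrableD measurableT (iF i) IH1.
by congr (mu.-integrable _ _); apply/funext => x /=; rewrite EFinD.
Qed.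

Lemma integral_sum_powR (G : 'I_d -> T -> C) (q : R) : 0 < q -> (forall j, cmeas (G j)) ->
  (forall j, mu.-integrable setT (EFin \o (fun x => Normc.normc (G j x) `^ q))) ->
  mu.-integrable setT (EFin \o (fun x => Normc.normc (\sum_j G j x) `^ q)) /\
  \int[mu]_x (Normc.normc (\sum_j G j x) `^ q) <=
  d%:R `^ q * \sum_j \int[mu]_x (Normc.normc (G j x) `^ q).
Proof.
move=> q0 mG iG; have [i1 <-] := integrable_Rsum (index_enum 'I_d) iG.
rewrite -RintegralZl//.
have mS := measurable_normc (cmeas_sum (index_enum 'I_d) mG).
have i2 : mu.-integrable setT (EFin \o (fun x => d%:R `^ q * \sum_j Normc.normc (G j x) `^ q)).
  exact: (integrableZl measurableT (d%:R `^ q) i1).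
have le x : Normc.normc (\sum_j G j x) `^ q <= d%:R `^ q * \sum_j Normc.normc (G j x) `^ q.
  apply: le_trans (sum_powR_le q0 _); last by move=> j; exact: normc_ge0.
  apply: ge0_ler_powR; rewrite ?nnegrE ?normc_ge0 ?(ltW q0)//.
    by apply: sumr_ge0 => j _; exact: normc_ge0.
  rewrite -lecR rmorph_sum -[leLHS]/(`|\sum_j G j x|); exact: ler_norm_sum.
have i3 : mu.-integrable setT (EFin \o (fun x => Normc.normc (\sum_j G j x) `^ q)).
  apply: (le_integrable measurableT _ _ i2).
    apply/measurable_EFinP; apply: (measurableT_comp (f := fun x : R => x `^ q)) mS.
    exact: measurable_powR.
  move=> x _ /=; rewrite lee_fin ger0_norm ?powR_ge0//.
  by apply: le_trans (le x) _; exact: ler_norm.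
by split=> //; apply: le_Rintegral.
Qed.

(** For x < 2 the level is 0 and the upper bound fails. This costs no dimension: at level 0 the mean
    keeps only frequency zero in that variable, which functions of the class do not have. *)
Lemma dyadic_level (x : R) : 1 <= x ->
  exists m, x / 4 <= (2 ^ m)%N%:R /\ ((0 < m)%N -> (2 * 2 ^ m)%N%:R <= x).
Proof.
move=> x1; set y := Num.truncn (x / 2); exists (trunc_log 2 y).
have x20 : 0 <= x / 2 by lra.
have /andP[yl yu] := truncn_itv x20.
split.
  have : (y.+1 <= 2 ^ (trunc_log 2 y).+1)%N by exact: trunc_log_ltn.
  rewrite -(ler_nat R) expnS natrM; rewrite -/y in yu; lra.
case: (posnP y) => [->//|y0 _].
have : (2 ^ trunc_log 2 y <= y)%N by exact: trunc_logP.
rewrite -(ler_nat R) natrM; rewrite -/y in yl; lra.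
Qed.

End trigonometric_polynomials.

(** * Upper bound *)

Section upper_bound.
Variables (R : realType) (d : nat).
Local Notation C := R[i].
Local Notation mT := (measurableTypeR R).
Local Notation T := (d.-tuple mT).
Local Notation mu := (torus_measure R d).
Variables (q rho : R) (p r : 'I_d -> R).
Hypotheses (q_gt1 : 1 < q) (p_ge_q : forall j, q <= p j).
Hypotheses (rho_gt0 : 0 < rho) (rho_le : forall j, rho <= r j).
Implicit Types (m : 'I_d -> nat) (k : 'rV[int]_d) (f : functional R d).

Let q_gt0 : 0 < q. Proof. exact: lt_trans ltr01 q_gt1. Qed.
Let r_gt0 j : 0 < r j. Proof. exact: lt_le_trans rho_gt0 (rho_le j). Qed.

(* The symbol of the de la Vallee Poussin mean at scale [2^m]. *)
Definition vp m k : C := \prod_j (tau R (m j) (k ord0 j))%:C.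

Lemma vp_out m k j : (2 ^ m j <= `|k ord0 j|)%N -> vp m k = 0.
Proof. by move=> H; rewrite /vp (bigD1 j)//= tau_out// mul0r. Qed.

Lemma vp1 m k : (forall j, (0 < m j)%N) -> (forall j, (`|k ord0 j| <= 2 ^ (m j).-1)%N) -> vp m k = 1.
Proof. by move=> m0 H; rewrite /vp big1// => j _; rewrite tau1. Qed.

(** Coordinates before [j] are already at the new scale and those after it still at the old one; in
    the [j]-th coordinate the Weyl derivative is undone. *)
Let symbol m m' (j i : 'I_d) : int -> C := if (i < j)%N then (fun l => (tau R (m' i) l)%:C)
  else if i == j then (fun l => (tau R (m' i) l - tau R (m i) l)%:C * (weyl_factor (r i) l)^-1)
  else (fun l => (tau R (m i) l)%:C).

Lemma vp_diff m m' f (gam : 'I_d -> T -> C) k :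
  (forall k, ~~ nonzero_freq k -> fourier_coef f k = 0) ->
  (forall j k, fcoef (gam j) k =
     if nonzero_freq k then fourier_coef f k * weyl_factor (r j) (k 0 j) else 0) ->
  (vp m' k - vp m k) * fourier_coef f k =
  \sum_j (\prod_i symbol m m' j i (k ord0 i)) * fcoef (gam j) k.
Proof.
move=> f0 fg; case nz : (nonzero_freq k); last first.
  by rewrite f0 ?nz// mulr0 big1// => j _; rewrite fg nz mulr0.
rewrite /vp prod_telescope mulr_suml; apply: eq_bigr => j _.
rewrite fg nz !(bigD1 j (P := xpredT))//= /symbol ltnn eqxx -rmorphB.
have w0 : weyl_factor (r j) (k 0 j) != 0.
  rewrite /weyl_factor mulf_neq0 ?expi_neq0// fmorph_eq0 gt_eqF// powR_gt0// normr_gt0 intr_eq0.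
  by move/forallP : nz => /(_ j).
set P := \prod_(i < d | _) _; set Q := \prod_(i < d | _) _.
have -> : Q = P.
  apply: eq_bigr => i ij; by rewrite (negPf ij); case: ifP.
set t := real_complex R _.
by field.
Qed.

(** Each coordinate other than the differentiated one contributes a mass of at most 3; the sum over
    [j] replaces a maximum, and the 1 makes the constant positive. *)
Definition step_const : R := 1 + 3 ^+ d * \sum_j tau_const (r j).

(** Young's inequality is applied to each of the [d] one-coordinate changes. As rho <= r_j, the
    decay 2^(-r_j s) is at most 2^(-rho s) in every direction. *)
Lemma vp_step_bound m f (gam : 'I_d -> T -> C) (beta : R) s K : 0 < beta ->
  (forall j, (2 ^ m j)%N%:R `^ (- r j) <= beta) ->
  (forall j, (2 ^ (m j + s).+1 <= K.+1)%N) ->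
  (forall j, cintegrable (gam j)) ->
  (forall j, mu.-integrable setT (EFin \o (fun x => Normc.normc (gam j x) `^ q))) ->
  (forall k, ~~ nonzero_freq k -> fourier_coef f k = 0) ->
  (forall j k, fcoef (gam j) k =
     if nonzero_freq k then fourier_coef f k * weyl_factor (r j) (k 0 j) else 0) ->
  let del x := trig K (fun k => (vp (fun j => m j + s.+1)%N k - vp (fun j => m j + s)%N k) *
     fourier_coef f k) (torus_point x) in
  mu.-integrable setT (EFin \o (fun x => Normc.normc (del x) `^ q)) /\
  \int[mu]_x (Normc.normc (del x) `^ q) <=
  d%:R `^ q * (step_const * (beta * (2 `^ (- rho)) ^+ s)) `^ q *
     \sum_j \int[mu]_x (Normc.normc (gam j x) `^ q).
Proof.
move=> b0 mb mK ig iq f0 fg /=.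
set m0 := (fun j => m j + s)%N; set m1 := (fun j => m j + s.+1)%N.
have E (x : T) : trig K (fun k => (vp m1 k - vp m0 k) * fourier_coef f k) (torus_point x) =
   \sum_j conv K (symbol m0 m1 j) (gam j) (torus_point x).
  have -> : (fun k => (vp m1 k - vp m0 k) * fourier_coef f k) =
     (fun k => \sum_j (\prod_i symbol m0 m1 j i (k ord0 i)) * fcoef (gam j) k).
    by apply/funext => k; exact: vp_diff.
  by rewrite trig_sum; apply: eq_bigr => j _; rewrite convEtrig.
have mc j : cmeas (fun x : T => conv K (symbol m0 m1 j) (gam j) (torus_point x)).
  exact: cmeas_conv.
have icq j : mu.-integrable setT (EFin \o (fun x : T =>
    Normc.normc (conv K (symbol m0 m1 j) (gam j) (torus_point x)) `^ q)).
  have [M HM] := bounded_conv K (symbol m0 m1 j) (gam j).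
  exact: (integrable_powR_bounded (ltW q_gt0) (mc j) (fun x => HM (torus_point x))).
have [I1 I2] := integral_sum_powR q_gt0 mc icq.
under [X in EFin \o X]eq_fun do rewrite E.
under eq_Rintegral do rewrite E.
split=> //; apply: le_trans I2 _.
rewrite -mulrA ler_wpM2l ?powR_ge0// mulr_sumr ler_sum// => j _.
have tc0 i : 0 <= tau_const (r i).
  by rewrite /tau_const !mulr_ge0 ?powR_ge0// addr_ge0// ltW.
pose A i := if i == j then tau_const (r j) * (2 ^ m0 j)%N%:R `^ (- r j) else 3.
have c0 : 0 < step_const by rewrite /step_const ltr_pwDl// mulr_ge0 ?exprn_ge0// sumr_ge0.
apply: (@young_conv _ _ K (symbol m0 m1 j) (gam j) (fun i => (2 ^ (m1 i))%N) A) => //.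
- move=> i; rewrite /symbol /A; have [->|ij] := eqVneq i j.
    rewrite ltnn /m1 addnS; apply: majorized_tau_step => //; exact: mK.
  case: ltnP => _.
    by apply: majorized_tau; rewrite /m1 addnS.
  have mi : (2 ^ m0 i <= 2 ^ m1 i)%N by rewrite leq_exp2l// /m1 addnS.
  apply: majorized_le mi (lexx _) (majorized_tau _ _).
  by apply: leq_trans (mK i); rewrite leq_exp2l.
- by rewrite !mulr_gt0// exprn_gt0// powR_gt0.
rewrite (bigD1 j)//= {1}/A eqxx.
have -> : \prod_(i < d | i != j) A i = 3 ^+ d.-1.
  under eq_bigr => i ij do rewrite /A (negPf ij).
  by rewrite prodr_const cardC1 card_ord.
have t0 : 0 <= 2 `^ (- rho) ^+ s :> R by rewrite exprn_ge0 ?powR_ge0.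
have -> : (2 ^ m0 j)%N%:R `^ (- r j) = (2 ^ m j)%N%:R `^ (- r j) * (2 `^ (- r j)) ^+ s.
  rewrite /m0 expnD natrM powRM//; congr (_ * _).
  by rewrite natrX -powR_mulrn// -powRrM mulrC powRrM powR_mulrn ?powR_ge0.
have H1 : (2 `^ (- r j)) ^+ s <= 2 `^ (- rho) ^+ s :> R.
  apply: lerXn2r; rewrite ?nnegrE ?powR_ge0//; apply: ler_powR; rewrite ?ler1n//.
  by rewrite lerN2.
have H2 : (2 ^ m j)%N%:R `^ (- r j) * (2 `^ (- r j)) ^+ s <= beta * 2 `^ (- rho) ^+ s.
  by apply: ler_pM; rewrite ?powR_ge0 ?exprn_ge0 ?powR_ge0.
have bt0 : 0 <= beta * 2 `^ (- rho) ^+ s by rewrite mulr_ge0// ltW.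
apply: (@le_trans _ _ (tau_const (r j) * (beta * 2 `^ (- rho) ^+ s) * 3 ^+ d)).
  apply: ler_pM; last by rewrite ler_eXn2l ?leq_pred// ltr1n.
  - by apply: mulr_ge0; [exact: tc0|apply: mulr_ge0; rewrite ?exprn_ge0 ?powR_ge0].
  - exact: exprn_ge0.
  - by rewrite ler_wpM2l.
rewrite mulrAC ler_wpM2r// /step_const mulrC.
apply: (@le_trans _ _ (3 ^+ d * \sum_j tau_const (r j))); last by rewrite lerDr.
rewrite ler_wpM2l ?exprn_ge0// (bigD1 j)//= lerDl sumr_ge0//.
Qed.

Lemma vp_eventually1 m k : exists S0, forall S, (S0 <= S)%N -> vp (fun j => m j + S)%N k = 1.
Proof.
exists (\max_j `|k ord0 j|).+1 => S HS; apply: vp1 => j; first by lia.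
have kj : (`|k ord0 j| <= \max_j `|k ord0 j|)%N by exact: leq_bigmax.
apply: leq_trans kj _; have h := ltn_expl (m j + S).-1 (isT : 1 < 2)%N.
by apply: leq_trans (ltnW h); lia.
Qed.

(** Half of the available decay: [Lq_series] asks for two factors z^s, and the step provides 2^(-rho
    s). *)
Let z : R := 2 `^ (- (rho / 2)).

Let z01 : 0 < z < 1.
Proof.
rewrite /z powRN invr_gt0 powR_gt0//= invf_lt1 ?powR_gt0//.
have e : 1 `^ (rho / 2) = 1 :> R by rewrite powR1.
by rewrite -[X in X < _]e; apply: gt0_ltr_powR; rewrite ?nnegrE ?divr_gt0 ?ltr1n.
Qed.

Let zz : z * z = 2 `^ (- rho).
Proof. by rewrite -powRD ?pnatr_eq0 ?implybT//; congr (_ `^ _); field. Qed.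

(** The steps are summed in L_q by [Lq_series]; that the sum is the error of the mean is expressed
    by Fourier coefficients, since [f] is only a distribution here. *)
Lemma sobolev_approx : exists2 c : R, 0 < c & forall f m (beta : R),
  sobolev_class r p f -> 0 < beta -> (forall j, (2 ^ m j)%N%:R `^ (- r j) <= beta) ->
  exists h : T -> C, [/\ cmeas h,
    mu.-integrable setT (EFin \o (fun x => Normc.normc (h x) `^ q)),
    \int[mu]_x (Normc.normc (h x) `^ q) <= c * beta `^ q &
    forall k, fcoef h k = (1 - vp m k) * fourier_coef f k].
Proof.
pose G := \sum_j ((2 * pi) ^+ d + 2 `^ p j).
have G0 : 0 <= G by apply: sumr_ge0 => j _; rewrite addr_ge0 ?powR_ge0 ?(ltW (twopi_gt0 R d)).
pose c0 := d%:R `^ q * step_const `^ q * G.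
have c00 : 0 <= c0 by rewrite !mulr_ge0 ?powR_ge0.
have sc0 : 0 <= step_const.
  rewrite /step_const addr_ge0// mulr_ge0 ?exprn_ge0// sumr_ge0// => j _.
  by rewrite /tau_const !mulr_ge0 ?powR_ge0// addr_ge0// ltW.
have /andP[z0 z1] := z01.
have zq : z `^ q < 1.
  have e : 1 `^ q = 1 :> R by rewrite powR1.
  by rewrite -[X in _ < X]e; apply: gt0_ltr_powR; rewrite ?nnegrE ?(ltW z0).
have e0 : 0 <= (2 / (1 - z)) `^ q / (1 - z `^ q).
  by rewrite divr_ge0 ?powR_ge0// subr_ge0 ltW.
exists (1 + (2 / (1 - z)) `^ q / (1 - z `^ q) * c0) => [|f m beta [[pf f0] Hf] b0 mb].
  by rewrite ltr_pwDl// mulr_ge0.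
(* The norm in the class is an infimum, so a representative of norm below 2 is taken, whence
   2^(p_j); the term (2 pi)^d pays for lowering the exponent from p_j to q. *)
have /choice[gam Hgam] : forall j, exists g : T -> C, [/\ cintegrable g,
    mu.-integrable setT (EFin \o (fun x => Normc.normc (g x) `^ q)),
    \int[mu]_x (Normc.normc (g x) `^ q) <= (2 * pi) ^+ d + 2 `^ p j &
    forall k, fcoef g k =
      if nonzero_freq k then fourier_coef f k * weyl_factor (r j) (k 0 j) else 0].
  move=> j; have [F HF NF] := Hf j.
  have p1 : 1 <= p j by rewrite (le_trans (ltW q_gt1)).
  have [|g [E mg ig Ig]] := @Lp_norm_lt _ _ (p j) F 2 p1 (ler0n _ 2).
    by apply: le_lt_trans NF _; rewrite lte_fin ltr1n.
  have cg := cintegrable_powR p1 mg ig.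
  have [i1 I1] := Rintegral_powR_1D (measurable_normc mg) (fun x => normc_ge0 _) (ltW q_gt0)
    (p_ge_q j) ig Ig.
  exists g; split; [exact: cg|exact: i1|exact: I1|move=> k].
  by apply: (weyl_coef cg); rewrite -E; exact: HF.
pose K s := \max_j 2 ^ (m j + s).+1.
have Ks s j : (2 ^ (m j + s).+1 <= (K s).+1)%N.
  by rewrite leqW//; exact: (leq_bigmax (F := fun j => 2 ^ (m j + s).+1)%N).
pose sym s k := (vp (fun j => m j + s.+1)%N k - vp (fun j => m j + s)%N k) * fourier_coef f k.
pose del s (x : T) := trig (K s) (sym s) (torus_point x).
have D s : mu.-integrable setT (EFin \o (fun x => Normc.normc (del s x) `^ q)) /\
   \int[mu]_x (Normc.normc (del s x) `^ q) <= (c0 * beta `^ q) * (z ^+ s) `^ q * (z ^+ s) `^ q.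
  have [|||I1 I2] := @vp_step_bound m f gam beta s (K s) b0 mb (Ks s) _ _ f0.
  - by move=> j; have [] := Hgam j.
  - by move=> j; have [] := Hgam j.
  - by move=> j; have [] := Hgam j.
  split; first exact: I1.
  apply: le_trans I2 _.
  have zs : 0 <= z ^+ s by rewrite exprn_ge0// ltW.
  have -> : c0 * beta `^ q * (z ^+ s) `^ q * (z ^+ s) `^ q =
    d%:R `^ q * (step_const * (beta * (2 `^ (- rho)) ^+ s)) `^ q * G.
    rewrite -zz exprMn !powRM ?mulr_ge0 ?(ltW b0)// /c0; ring.
  rewrite ler_wpM2l ?mulr_ge0 ?powR_ge0// ler_sum// => j _.
  by have [] := Hgam j.
have mdel s : cmeas (del s) by apply: cintegrable_cmeas; exact: cintegrable_trig.
have [|h [mh ih Ih [B HB]]] := Lq_series q_gt1 z01 _ mdel (fun s => (D s).1) (fun s => (D s).2).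
  by rewrite mulr_ge0 ?powR_ge0.
exists h; split=> //.
  apply: le_trans Ih _; rewrite mulrA ler_wpM2r ?powR_ge0// lerDr//.
move=> k; have ch := cintegrable_powR (ltW q_gt1) mh ih.
have fdel s : fcoef (del s) k = sym s k.
  apply: fcoef_trig => l [j Kj]; rewrite /sym.
  have h1 : (2 ^ (m j + s.+1) <= `|l ord0 j|)%N.
    by rewrite addnS; apply: leq_trans (Ks s j) _.
  rewrite (@vp_out _ _ j) // (@vp_out _ _ j) ?subrr ?mul0r//.
  by apply: leq_trans h1; rewrite leq_exp2l// leq_add2l.
(* From [S0] on, the telescoped partial sum has the required [k]-th coefficient exactly, so the
   discrepancy is a coefficient of the tail, whose L_1 norm decays like z^S. *)
have [S0 HS0] := vp_eventually1 m k.
apply/eqP; rewrite -subr_eq0; apply/eqP; apply: Normc.eq0_normc.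
apply/eqP; rewrite eq_le normc_ge0 andbT.
apply: (@geometric_le0 _ _ ((2 * pi) ^- d * B) z S0 z01) => S HS.
have [iS IS] := HB S.
have cS : cintegrable (fun x => \sum_(s < S) del s x).
  by apply: cintegrable_sum => s; exact: cintegrable_trig.
have -> : fcoef h k - (1 - vp m k) * fourier_coef f k = fcoef (fun x => h x - \sum_(s < S) del s x) k.
  have -> : (fun x => h x - \sum_(s < S) del s x) = (fun x => (-1) * (\sum_(s < S) del s x) + h x).
    by apply/funext => x; ring.
  rewrite fcoef_lin// fcoef_sum; last by move=> s; exact: cintegrable_trig.
  rewrite (eq_bigr (fun s : 'I_S => sym s k)) => [|s _]; last exact: fdel.
  rewrite /sym -mulr_suml.
  rewrite -(big_mkord xpredT (fun s => vp (fun j => m j + s.+1)%N k - vp (fun j => m j + s)%N k)).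
  rewrite (telescope_sumr (fun s => vp (fun j => m j + s)%N k))// HS0//.
  have -> : (fun j => m j + 0)%N = m by apply/funext => j; rewrite addn0.
  ring.
apply: le_trans (normc_fcoef k _) _.
  have := cintegrable_lin (-1) cS ch.
  by congr cintegrable; apply/funext => x; ring.
by rewrite -mulrA ler_wpM2l ?invr_ge0 ?(ltW (twopi_gt0 R d)).
Qed.

End upper_bound.

(** * The approximating subspace and its dimension *)

Section width_upper.
Variables (R : realType) (d : nat).
Local Notation C := R[i].
Local Notation mT := (measurableTypeR R).
Local Notation T := (d.-tuple mT).
Implicit Types (m : 'I_d -> nat) (k : 'rV[int]_d) (f : functional R d).
Local Notation box K := {ffun 'I_d -> 'I_(2 * K).+1}.

Lemma card_freq K M : (#|[pred l : 'I_(2 * K).+1 | (0 < `|freq l| < M)%N]| <= 2 * M)%N.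
Proof.
rewrite cardE -(size_map val) -(size_iota (K.+1 - M) (2 * M)); apply: uniq_leq_size.
  by rewrite (map_inj_uniq val_inj) enum_uniq.
move=> x /mapP[l]; rewrite mem_enum inE /freq => /andP[h1 h2] ->; rewrite mem_iota.
have := ltn_ord l; rewrite /=; lia.
Qed.

Definition low_freqs m K : {set box K} :=
  finset (fun i : box K => [forall j, (0 < `|freq (i j)| < 2 ^ m j)%N]).

Lemma card_low_freqs m K : (#|low_freqs m K| <= \prod_j (2 * 2 ^ m j))%N.
Proof.
pose F (j : 'I_d) := [pred l : 'I_(2 * K).+1 | (0 < `|freq l| < 2 ^ m j)%N].
have -> : #|low_freqs m K| = #|family F|.
  apply: eq_card => i; rewrite inE; apply/forallP/familyP => H j; have := H j; by rewrite !inE.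
by rewrite card_family foldrE big_map big_enum /=; apply: leq_prod => j _; exact: card_freq.
Qed.

Lemma low_freqs_eq0 m K j : m j = 0%N -> low_freqs m K = finset.set0.
Proof.
move=> mj; apply/setP => i; rewrite !inE; apply/negbTE/negP => /forallP/(_ j).
by rewrite mj expn0; lia.
Qed.

(** A subspace of dimension at most [n] is encoded by exactly [n] generators, so the family is
    padded with zero vectors. *)
Lemma sum_set_nth (I : finType) (W : lmodType C) (A : {set I}) (i0 : I) n (G : I -> W) (c : I -> C) :
  (#|A| <= n)%N ->
  \sum_(i in A) c i *: G i =
  \sum_(l < n) c (nth i0 (enum A) l) *: (if (l < #|A|)%N then G (nth i0 (enum A) l) else 0).
Proof.
move=> An; rewrite -big_enum (big_nth i0) -cardE big_mkord.
rewrite (big_ord_widen n (fun l => c (nth i0 (enum A) l) *: G (nth i0 (enum A) l)) An) big_mkcond.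
by apply: eq_bigr => l _; case: ifP => _; rewrite ?scaler0.
Qed.

(** The exponents rho/r_j add up to 1, so a box with sides x^(rho/r_j) has volume [x]; this ties the
    anisotropic scales to the dimension. *)
Lemma prod_powR_dual (rho x : R) (r : 'I_d -> R) : 0 < x -> 0 < rho -> \sum_j (r j)^-1 = rho^-1 ->
  \prod_j x `^ (rho / r j) = x.
Proof.
move=> x0 rho0 Hr.
transitivity (x `^ (\sum_j rho / r j)).
  elim/big_rec2: _ => [|j u v _ ->]; first by rewrite powRr0.
  by rewrite powRD ?(gt_eqF x0) ?implybT.
by rewrite -mulr_sumr Hr mulfV ?gt_eqF// powRr1// ltW.
Qed.

Lemma Lp_norm_le q (g : T -> C) : Lp_fun q g -> (Lp_norm q (regular_functional g : functional R d) <= fun_norm q g)%E.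
Proof. by move=> Lg; apply: ereal_inf_lbound; exists g. Qed.

Lemma fourier_coef_regular (g : T -> C) k : fourier_coef (regular_functional g) k = fcoef g k.
Proof. by []. Qed.

Lemma fourier_coefB (F G : functional R d) k :
  fourier_coef (F - G) k = fourier_coef F k - fourier_coef G k.
Proof.
rewrite /fourier_coef -mulrBr.
by have -> : (F - G) (fourier_test R (- k)) = F (fourier_test R (- k)) - G (fourier_test R (- k)) by [].
Qed.

Lemma kolmogorov_width_le (q rho : R) (p r : 'I_d -> R) : 1 < q -> (forall j, q <= p j) ->
  0 < rho -> (forall j, rho <= r j) -> \sum_j (r j)^-1 = rho^-1 ->
  exists2 c : R, 0 < c & forall n, (0 < n)%N ->
    (kolmogorov_width (@Lp_norm R d q) (sobolev_class r p) n <= (c * n%:R `^ (- rho))%:E)%E.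
Proof.
move=> q1 pq rho0 rho_le Hr; have q0 : 0 < q := lt_trans ltr01 q1.
have r0 j : 0 < r j by exact: lt_le_trans (rho_le j).
have [c c0 Hc] := @sobolev_approx _ d q rho p r q1 pq rho0 rho_le.
(* The scales satisfy 2^(m_j) >= n^(rho/r_j)/4, and raising to the power -r_j turns the 4 into
   4^(r_j). *)
pose c1 : R := 1 + \sum_j 4 `^ r j.
have c10 : 0 < c1 by rewrite ltr_pwDl// sumr_ge0// => j _; exact: powR_ge0.
exists (c `^ q^-1 * c1) => [|n n0]; first by rewrite mulr_gt0// powR_gt0.
have nR : 1 <= n%:R :> R by rewrite ler1n.
have nR0 : 0 < n%:R :> R by rewrite ltr0n.
have /choice[m Hm] : forall j, exists m : nat, n%:R `^ (rho / r j) / 4 <= (2 ^ m)%N%:R /\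
    ((0 < m)%N -> (2 * 2 ^ m)%N%:R <= n%:R `^ (rho / r j)).
  move=> j; apply: dyadic_level; have e : n%:R `^ 0 = 1 :> R by rewrite powRr0.
  by rewrite -[X in X <= _]e; apply: ler_powR => //; rewrite divr_ge0// ltW.
pose beta := c1 * n%:R `^ (- rho).
have b0 : 0 < beta by rewrite mulr_gt0// powR_gt0.
have mb j : (2 ^ m j)%N%:R `^ (- r j) <= beta.
  have [H1 _] := Hm j.
  have x0 : 0 < n%:R `^ (rho / r j) :> R by rewrite powR_gt0.
  have H2 : ((n%:R `^ (rho / r j)) / 4) `^ r j <= (2 ^ m j)%N%:R `^ r j.
    by apply: ge0_ler_powR; rewrite ?nnegrE ?(ltW (r0 j))// divr_ge0// ltW.
  rewrite !powRN.
  apply: (@le_trans _ _ (((n%:R `^ (rho / r j)) / 4) `^ r j)^-1).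
    by rewrite lef_pV2// posrE powR_gt0// ?divr_gt0// ltr0n expn_gt0.
  rewrite powRM ?(ltW x0)// -powRrM mulfVK ?gt_eqF// -[4^-1]powR_inv1// -powRrM mulN1r powRN.
  rewrite invfM invrK mulrC /beta powRN ler_wpM2r ?invr_ge0 ?powR_ge0//.
  rewrite /c1 (bigD1 j)//= addrCA lerDl addr_ge0// sumr_ge0// => i _; exact: powR_ge0.
pose K := \max_j 2 ^ m j.
have mK j : (2 ^ m j <= K)%N by exact: (leq_bigmax (F := fun j => 2 ^ m j)%N).
pose i0 : box K := [ffun => ord0].
pose A := low_freqs m K.
have An : (#|A| <= n)%N.
  have [[j /eqP mj]|/forallNP mpos] := pselect (exists j, m j == 0%N).
    by rewrite /A (@low_freqs_eq0 _ _ j)// cards0.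
  apply: leq_trans (card_low_freqs m K) _.
  rewrite -(ler_nat R) natr_prod -[leRHS](prod_powR_dual nR0 rho0 Hr).
  apply: ler_prod => j _; rewrite ler0n/=; apply: (Hm j).2.
  by rewrite lt0n; apply/negP; exact: mpos.
pose e (i : box K) := regular_functional (fun x : T => fourier_exp (box_freq i) (torus_point x)).
pose ev (l : 'I_n) : functional R d :=
  if (l < #|A|)%N then e (nth i0 (enum A) l) else 0.
pose g (l : 'I_n) (x : T) : C :=
  if (l < #|A|)%N then fourier_exp (box_freq (nth i0 (enum A) l)) (torus_point x) else 0.
have ig l : cintegrable (g l).
  by rewrite /g; case: (l < #|A|)%N; [exact: cintegrable_fourier_exp|exact: cintegrable0].
have evE l : ev l = regular_functional (g l).
  rewrite /ev /g; case: (l < #|A|)%N => //; apply/funext => phi; rewrite /regular_functional.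
  by under [X in torus_integral X]eq_fun do rewrite mul0r; rewrite torus_integral0.
have sub : subspaces_dim_le (@Lp_norm R d q) n (lin_span ev).
  split; last by exists ev.
  move=> _ [a _ <-]; rewrite /fin_space /=.
  under eq_bigr do rewrite evE.
  rewrite -regular_functional_sum//.
  have Lg : Lp_fun q (fun x => \sum_l a l * g l x).
    apply: (@bounded_Lp_fun _ _ _ _ (\sum_l Normc.normc (a l))) => //.
      by apply: cmeas_sum => l; apply: cintegrable_cmeas; exact: cintegrableZ.
    move=> x; rewrite -lecR rmorph_sum -[leLHS]/(`|\sum_l a l * g l x|).
    apply: le_trans (ler_norm_sum _ _ _) _; apply: ler_sum => l _.
    rewrite normrM -[leRHS]mulr1 ler_wpM2l// /g; case: ifP => _.
      by rewrite norm_fourier_exp.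
    by rewrite normr0.
  by apply: le_lt_trans (Lp_norm_le Lg) _; have [] := Lg.
apply: le_trans (ereal_inf_lbound _) _; first by exists (lin_span ev).
apply: ge_ereal_sup => _ [f ff <-].
have [h [mh ih Ih fh]] := Hc f m beta ff b0 mb.
have [[pf f0] _] := ff.
have ch := cintegrable_powR (ltW q1) mh ih.
pose y : functional R d := \sum_(i in A) (vp R m (box_freq i) * fourier_coef f (box_freq i)) *: e i.
have yL : lin_span ev y.
  by rewrite /y (sum_set_nth i0 _ _ An) => //; eexists.
apply: le_trans (ereal_inf_lbound _) _; first by exists y.
pose sym k := vp R m k * fourier_coef f k.
have yE : y = regular_functional (fun x => trig K sym (torus_point x)).
  rewrite /y /trig regular_functional_sum; last by move=> i; exact: cintegrable_fourier_exp.
  (* Outside [A] some coordinate is either zero, where [f] has no coefficient, or at least 2^(m_j)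
     in modulus, where the symbol vanishes. *)
  rewrite big_mkcond; apply: eq_bigr => i _; case: ifPn => //.
  rewrite inE => /forallPn[j]; rewrite negb_and -!leqNgt leqn0 absz_eq0 => H.
  rewrite /sym; suff -> : vp R m (box_freq i) * fourier_coef f (box_freq i) = 0 by rewrite scale0r.
  case/orP: H => H.
    rewrite f0 ?mulr0//; apply/forallPn; exists j; by rewrite mxE negbK.
  by rewrite (@vp_out _ _ _ _ j) ?mul0r// mxE.
have E : f - y = regular_functional h.
  have iy := cintegrable_trig K sym.
  apply: distribution_eq.
  - split; first by apply: linear_functionalB; [exact: pf.1|rewrite yE; exact: linear_regular].
    by apply: continuous_functionalB; [exact: pf.2|rewrite yE; exact: continuous_regular].
  - by split; [exact: linear_regular|exact: continuous_regular].
  move=> k; rewrite fourier_coefB yE !fourier_coef_regular fh fcoef_trig.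
    by rewrite mulrBl mul1r.
  move=> l [j Kj]; rewrite /sym (@vp_out _ _ _ _ j) ?mul0r//.
  exact: leq_trans (mK j) (ltnW Kj).
rewrite E; have FE := fun_normE q0 mh ih.
have Lh : Lp_fun q h by have [? ?] := mh; split=> //; rewrite FE ltry.
apply: le_trans (Lp_norm_le Lh) _; rewrite FE lee_fin.
have -> : c `^ q^-1 * c1 * n%:R `^ (- rho) = (c * beta `^ q) `^ q^-1.
  rewrite powRM ?powR_ge0 ?(ltW c0)// -powRrM mulfV ?gt_eqF// powRr1 ?(ltW b0)//.
  by rewrite mulrA.
apply: ge0_ler_powR; rewrite ?nnegrE ?invr_ge0 ?(ltW q0) ?mulr_ge0 ?powR_ge0 ?(ltW c0)//.
by apply: Rintegral_ge0 => x _; exact: powR_ge0.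
Qed.

End width_upper.

(** * Lower bound *)

Section extreme_point.
Variable R : realType.
Local Notation C := R[i].

Definition sqnorm (z : C) : R := complex.Re z ^+ 2 + complex.Im z ^+ 2.

Lemma sqnormE z : (sqnorm z)%:C = z * conjc z.
Proof. by case: z => a b; apply: complexP; rewrite /sqnorm /=; ring. Qed.

(** Along the ray the squared modulus minus 1 is a convex quadratic, negative at 0; [t0] is its
    positive root. *)
Lemma disc_exit (z w : C) : sqnorm z < 1 -> w != 0 -> exists t0 : R, [/\ 0 < t0,
  sqnorm (z + t0%:C * w) = 1 & forall t, 0 <= t <= t0 -> sqnorm (z + t%:C * w) <= 1].
Proof.
case: z w => [x y] [u v]; rewrite /sqnorm /= => xy w0.
pose a := u ^+ 2 + v ^+ 2; pose b := x * u + y * v; pose c := x ^+ 2 + y ^+ 2 - 1.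
have a0 : 0 < a.
  rewrite lt_def /a addr_ge0 ?sqr_ge0// andbT; apply: contra w0.
  rewrite paddr_eq0 ?sqr_ge0// !sqrf_eq0 => /andP[/eqP-> /eqP->]; exact: eqxx.
have c0 : c < 0 by rewrite /c subr_lt0.
have E t : (x + (t * u - 0 * v)) ^+ 2 + (y + (t * v + 0 * u)) ^+ 2 = 1 + (a * t ^+ 2 + 2 * b * t + c).
  by rewrite /a /b /c; ring.
pose D := b ^+ 2 - a * c.
have D0 : b ^+ 2 < D by rewrite /D; nra.
have sD : Num.sqrt D ^+ 2 = D by rewrite sqr_sqrtr//; have := sqr_ge0 b; lra.
pose t0 := (Num.sqrt D - b) / a.
have t00 : 0 < t0.
  rewrite divr_gt0// subr_gt0; have s0 := sqrtr_ge0 D.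
  have [b0|b0] := ltP b 0; first exact: lt_le_trans s0.
  by rewrite -ltr_sqr ?nnegrE// sD.
have F0 : a * t0 ^+ 2 + 2 * b * t0 + c = 0.
  have -> : a * t0 ^+ 2 + 2 * b * t0 + c = (Num.sqrt D ^+ 2 - b ^+ 2 + a * c) / a.
    by rewrite /t0; field; rewrite gt_eqF.
  by rewrite sD /D addrAC subrK subrr mul0r.
exists t0; split=> // [|t /andP[tl tu]]; rewrite E; first by rewrite F0 addr0.
(* Convexity between 0 and [t0], written as an identity with one term containing the value at [t0],
   which is zero, and two terms of visible sign. *)
have : t0 * (a * t ^+ 2 + 2 * b * t + c) <= 0.
  have -> : t0 * (a * t ^+ 2 + 2 * b * t + c) =
     a * t * t0 * (t - t0) + c * (t0 - t) + t * (a * t0 ^+ 2 + 2 * b * t0 + c) by ring.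
  rewrite F0 mulr0 addr0.
  have h1 : 0 <= a * t * t0 * (t0 - t)
    by apply: mulr_ge0; rewrite ?subr_ge0//; apply: mulr_ge0 (ltW t00); apply: mulr_ge0 (ltW a0) tl.
  have h2 : 0 <= - c * (t0 - t)
    by apply: mulr_ge0; rewrite ?subr_ge0// oppr_ge0; exact: ltW c0.
  lra.
rewrite pmulr_rle0//; lra.
Qed.

(** With the coordinates in [S] set to zero, [n] equations remain in more than [n] unknowns. *)
Lemma kernel_vector (I : finType) n (L : 'I_n -> I -> C) (S : {set I}) : (#|S| + n < #|I|)%N ->
  exists w : I -> C, [/\ forall i, \sum_l L i l * w l = 0, forall l, l \in S -> w l = 0 &
    exists l, w l != 0].
Proof.
move=> Sn; pose N := #|finset.setC S|.
have nN : (n < N)%N by rewrite /N cardsCs finset.setCK; lia.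
pose M : 'M[C]_(N, n) := \matrix_(j, i) L i (enum_val j).
have /rowV0Pn[u uM u0] : kermx M != 0.
  by rewrite -mxrank_eq0 mxrank_ker -lt0n subn_gt0 (leq_ltn_trans (rank_leq_col M)).
have {}uM : u *m M = 0 by apply/sub_kermxP.
pose w l := \sum_(j < N) u 0 j * (enum_val j == l)%:R.
have wE j : w (enum_val j) = u 0 j.
  rewrite /w (bigD1 j)//= eqxx mulr1 big1 ?addr0// => i ij.
  by rewrite (inj_eq enum_val_inj) (negPf ij) mulr0.
exists w; split.
- move=> i; have := congr1 (fun A : 'rV_n => A 0 i) uM; rewrite !mxE => H.
  rewrite -[RHS]H /w; under eq_bigr do rewrite mulr_sumr.
  rewrite exchange_big /=; apply: eq_bigr => j _; rewrite mxE.
  rewrite (bigD1 (enum_val j))//= eqxx mulr1 big1 ?addr0 1?mulrC// => l lj.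
  by rewrite eq_sym (negPf lj) !mulr0.
- move=> l lS; rewrite /w big1// => j _; case: eqP => [E|_]; last by rewrite mulr0.
  by have := enum_valP j; rewrite E finset.in_setC lS.
- have /rV0Pn[j uj] := u0; by exists (enum_val j); rewrite wE.
Qed.

(** Extremality is replaced by a finite maximum: among the feasible vectors, one with the most
    unimodular coordinates is chosen. If more than [n] coordinates were free, a kernel direction
    supported on them would allow moving until one more reaches the circle. *)
Lemma extreme_point (I : finType) n (L : 'I_n -> I -> C) : exists z : I -> C, [/\
  forall i, \sum_l L i l * z l = 0, forall l, sqnorm (z l) <= 1 &
  #|I|%:R - n%:R <= \sum_l sqnorm (z l)].
Proof.
pose feas (z : I -> C) := (forall i, \sum_l L i l * z l = 0) /\ (forall l, sqnorm (z l) <= 1).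
pose unit_set (z : I -> C) := finset (fun l => sqnorm (z l) == 1).
pose P k := `[< exists2 z, feas z & #|unit_set z| = k >].
have exP : exists k, P k.
  exists #|unit_set (fun=> 0)|; apply/asboolP; exists (fun=> 0) => //; split.
    by move=> i; rewrite big1// => l _; rewrite mulr0.
  by move=> l; rewrite /sqnorm /= !expr0n addr0.
have ubP k : P k -> (k <= #|I|)%N by move=> /asboolP[z _ <-]; exact: max_card.
have [k /asboolP[z [zL z1] zk] kmax] := ex_maxnP exP ubP.
exists z; split=> //.
have sq0 l : 0 <= sqnorm (z l) by rewrite addr_ge0 ?sqr_ge0.
suff kn : (#|I| <= k + n)%N.
  rewrite lerBlDr; apply: (@le_trans _ _ (k + n)%N%:R); first by rewrite ler_nat.
  rewrite natrD lerD2r -zk -sumr_const big_mkcond /=; apply: ler_sum => l _.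
  by rewrite inE; case: eqP => [->|].
rewrite leqNgt -zk; apply/negP => /(kernel_vector L)[w [wL wS [l0 wl0]]].
have zlt l : w l != 0 -> sqnorm (z l) < 1.
  move=> wl; rewrite lt_neqAle z1 andbT; apply: contra wl => zl.
  by rewrite wS// inE.
have /choice[t Ht] : forall l, exists t0 : R, w l != 0 -> [/\ 0 < t0,
  sqnorm (z l + t0%:C * w l) = 1 & forall t, 0 <= t <= t0 -> sqnorm (z l + t%:C * w l) <= 1].
  move=> l; have [->|wl] := eqVneq (w l) 0; first by exists 0.
  by have [t0 Ht0] := disc_exit (zlt l wl) wl; exists t0.
(* The coordinate that reaches the circle first; until then no other coordinate has left the
   disc. *)
pose l1 := [arg min_(l < l0 | w l != 0) t l]%O.
have [wl1 tmin] : w l1 != 0 /\ forall l, w l != 0 -> t l1 <= t l.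
  by rewrite /l1; case: arg_minP.
have [t0 tl1 _] := Ht _ wl1.
pose z' l := z l + (t l1)%:C * w l.
have fz' : feas z'.
  split=> [i|l].
    rewrite /z'; under eq_bigr do rewrite mulrDr mulrCA.
    by rewrite big_split/= zL add0r -mulr_sumr wL mulr0.
  rewrite /z'; have [->|wl] := eqVneq (w l) 0; first by rewrite mulr0 addr0.
  by have [_ _] := Ht _ wl; apply; rewrite (ltW t0) tmin.
have : (#|unit_set z'| <= k)%N by apply: kmax; apply/asboolP; exists z'.
rewrite leqNgt -zk => /negP; apply.
apply: proper_card; apply/properP; split.
  apply/fintype.subsetP => l; rewrite !inE /z' => zl.
  by rewrite wS ?inE// mulr0 addr0.
exists l1; rewrite inE; first by rewrite /z' tl1.
by rewrite lt_eqF// zlt.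
Qed.

End extreme_point.

(** * Product grids *)

Section grid.
Variables (R : realType) (d : nat).
Local Notation V := 'rV[R]_d.
Local Notation C := R[i].
Implicit Types (N : 'I_d -> nat) (K M : nat).

(** The Fejer kernel of order [n] vanishes at the multiples of 2 pi/n that are not multiples of 2
    pi; the shift of its coefficients by 2n only adds a phase, which is 1 at the origin. *)
Lemma grid_fejer K n (l l' : nat) : (0 < n)%N -> (3 * n <= K.+1)%N -> (l < n)%N -> (l' < n)%N ->
  tsum K (fun k => (tri R n (k + (2 * n)%N%:Z))%:C)
    (2 * pi * l%:R / n%:R - 2 * pi * l'%:R / n%:R) = if l == l' then n%:R else 0.
Proof.
move=> n0 nK ln ln'.
have nz : n%:R != 0 :> R by rewrite pnatr_eq0 -lt0n.
set t := _ - _.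
have -> : (fun k => (tri R n (k + (2 * n)%N%:Z))%:C) = (fun k => (tri R n (k - (- (2 * n)%N%:Z)))%:C).
  by apply/funext => k; rewrite opprK.
rewrite tsum_tri//; last by lia.
have E : \sum_(j < n) expi (j%:R * t) = if l == l' then n%:R else 0.
  transitivity (\sum_(j < n) expi ((l'%:Z - l%:Z)%:~R * (0 - 2 * pi * j%:R / n%:R) : R)).
    by apply: eq_bigr => j _; congr expi; rewrite /t intrB; field.
  rewrite sum_expi_grid// mulr0 expi0 mulr1.
  have -> : (n%:Z %| (l'%:Z - l%:Z))%Z = (l == l'); last by case: ifP; rewrite ?rmorph_nat.
  apply/idP/eqP => [/dvdzP[s Hs]|->]; last by rewrite subrr dvdz0.
  have : s = 0 by nia.
  by move=> s0; rewrite s0 mul0r in Hs; lia.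
rewrite E; case: eqP => [H|_]; last by rewrite normr0 expr0n mulr0.
rewrite /t H subrr mulr0 expi0 mulr1 normr_nat expr2 mulrA mulVf ?mul1r//.
by rewrite pnatr_eq0 -lt0n.
Qed.

(** The product of equidistant grids with [N j] points each. Since the [N j] differ, its points are
    indexed by functions into one ordinal of size the largest [N j], restricted by a family of
    predicates; both clauses then factor over the coordinates. *)
Lemma grid_exists N : (forall j, 0 < N j)%N -> exists pt : 'I_(\prod_j N j)%N -> V,
  (forall K M p (A : 'I_d -> R) x, (forall j k, `|p j k| <= (A j)%:C) ->
     (forall j k, (M * N j <= `|k|)%N -> p j k = 0) -> (forall j t, 0 <= tsum K (p j) t) ->
     \sum_a kernel_of K p (x - pt a) <= (\prod_j (A j * (N j * (2 * M).+1)%:R))%:C) /\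
  (forall K, (forall j, 3 * N j <= K.+1)%N -> forall a b,
     kernel_of K (fun j k => (tri R (N j) (k + (2 * N j)%N%:Z))%:C) (pt a - pt b) =
     if a == b then (\prod_j N j)%N%:R else 0).
Proof.
move=> N0; pose M := (\max_j N j)%N.
have NM j : (N j <= M)%N by exact: (leq_bigmax (F := N)).
pose Q (j : 'I_d) := [pred l : 'I_M | l < N j]%N.
pose A := [pred f : {ffun 'I_d -> 'I_M} | f \in family Q].
have cQ j : #|Q j| = N j.
  rewrite -sum1_card -[RHS](card_ord (N j)) -sum1_card (big_ord_widen M (fun=> 1%N) (NM j)).
  by apply: eq_bigl.
have cA : #|A| = (\prod_j N j)%N.
  have -> : #|A| = #|family Q| by apply: eq_card.
  by rewrite card_family foldrE big_map big_enum; apply: eq_bigr => j _; exact: cQ.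
rewrite -cA; pose pt (a : 'I_#|A|) : V := \row_j (2 * pi * (enum_val a j)%:R / (N j)%:R).
have Qa (a : 'I_#|A|) j : (enum_val a j < N j)%N.
  by have := enum_valP a; rewrite inE => /familyP/(_ j); rewrite inE.
exists pt; split=> [K m p B x pB pm p0|K NK a b].
  pose F (j : 'I_d) (l : 'I_M) := tsum K (p j) (x 0 j - 2 * pi * l%:R / (N j)%:R).
  have -> : \sum_a kernel_of K p (x - pt a) = \sum_(f in family Q) \prod_j F j (f j).
    transitivity (\sum_(f in A) \prod_j F j (f j)); last exact: eq_bigl.
    rewrite [RHS]big_enum_val; apply: eq_bigr => a _; apply: eq_bigr => j _.
    by rewrite !mxE.
  rewrite -(bigA_distr_big_dep Q F).
  rewrite rmorph_prod; apply: ler_prod => j _.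
  have -> : \sum_(l | Q j l) F j l =
      \sum_(l < N j) tsum K (p j) (x 0 j - 2 * pi * l%:R / (N j)%:R).
    by rewrite (big_ord_widen M (fun l : nat => tsum K (p j) (x 0 j - 2 * pi * l%:R / (N j)%:R)) (NM j)).
  have s0 : 0 <= \sum_(l < N j) tsum K (p j) (x 0 j - 2 * pi * l%:R / (N j)%:R).
    by apply: sumr_ge0 => l _; exact: p0.
  rewrite s0/=; have := norm_tsum_grid K (x 0 j) (N0 j) (pB j) (pm j).
  by rewrite ger0_norm.
have E j : tsum K (fun k => (tri R (N j) (k + (2 * N j)%N%:Z))%:C) ((pt a - pt b) 0 j) =
    if enum_val a j == enum_val b j then (N j)%:R else 0.
  by rewrite !mxE grid_fejer//; exact: Qa.
rewrite /kernel_of; under eq_bigr do rewrite E.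
case: eqVneq => [->|ab].
  by under eq_bigr do rewrite eqxx; rewrite cA natr_prod.
have [j abj] : exists j, enum_val a j != enum_val b j.
  apply: contrapT => /forallNP H; move/eqP : ab; apply; apply: enum_val_inj.
  by apply/ffunP => j; apply/eqP/negPn/negP; exact: H.
by rewrite (bigD1 j)//= (negPf abj) mul0r.
Qed.

End grid.

(** * Sums of translates over a grid *)

Section lower_tools.
Variables (R : realType) (d : nat).
Local Notation V := 'rV[R]_d.
Local Notation C := R[i].
Local Notation mT := (measurableTypeR R).
Local Notation T := (d.-tuple mT).
Local Notation mu := (torus_measure R d).
Local Notation box K := {ffun 'I_d -> 'I_(2 * K).+1}.
Implicit Types (K : nat) (k : 'rV[int]_d) (g : T -> C).

(** Fourier coefficients of the combination with weights [c] of the translates of a tensor kernel to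
    the points [pt]; see [trig_grid_coef]. *)
Definition grid_coef m (pt : 'I_m -> V) (a : 'I_d -> int -> C) (c : 'I_m -> C) k : C :=
  (\prod_j a j (k ord0 j)) * \sum_l c l * fourier_exp (- k) (pt l).

Lemma trig_grid_coef K m (pt : 'I_m -> V) (a : 'I_d -> int -> C) (c : 'I_m -> C) (x : V) :
  trig K (grid_coef pt a c) x = \sum_l c l * kernel_of K a (x - pt l).
Proof.
under [RHS]eq_bigr do rewrite kernel_ofB mulr_sumr.
rewrite exchange_big; apply: eq_bigr => i _; rewrite /grid_coef.
have -> : \prod_j a j (box_freq i ord0 j) = \prod_j a j (freq (i j)).
  by apply: eq_bigr => j _; rewrite mxE.
rewrite mulr_sumr mulr_suml; apply: eq_bigr => l _; ring.
Qed.

(** Each translate is dominated by its positive majorant before the grid estimate is used. This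
    keeps the sum of all translates at the order of the product of the [N j], which a single kernel
    may already reach. *)
Lemma normc_trig_grid_coef K M m (N : 'I_d -> nat) (pt : 'I_m -> V) (A : 'I_d -> R) (a : 'I_d -> int -> C)
  (c : 'I_m -> C) (x : V) :
  (forall (p : 'I_d -> int -> C) (A : 'I_d -> R) (x : V), (forall j l, `|p j l| <= (A j)%:C) ->
     (forall j l, (M * N j <= `|l|)%N -> p j l = 0) -> (forall j t, 0 <= tsum K (p j) t) ->
     \sum_l kernel_of K p (x - pt l) <= (\prod_j (A j * (N j * (2 * M).+1)%:R))%:C) ->
  (forall j, majorized K (M * N j) (A j) (a j)) -> (forall l, `|c l| <= 1) ->
  Normc.normc (trig K (grid_coef pt a c) x) <= \prod_j (A j * (N j * (2 * M).+1)%:R).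
Proof.
move=> Hpt /choice[p Hp] c1; rewrite -lecR trig_grid_coef.
apply: le_trans (Hpt p A x _ _ _); last first.
- by move=> j t; have [_ _ ap] := Hp j; exact: le_trans (normr_ge0 _) (ap t).
- by move=> j; have [_ pm _] := Hp j.
- by move=> j; have [pA _ _] := Hp j.
rewrite -[leLHS]/(`|\sum_l c l * kernel_of K a (x - pt l)|).
apply: le_trans (ler_norm_sum _ _ _) _; apply: ler_sum => l _.
rewrite normrM -[leRHS]mul1r; apply: ler_pM => //.
by apply: kernel_of_majorized => j t; have [_ _] := Hp j.
Qed.

Lemma regular_trig K (c : 'rV[int]_d -> C) : regular_functional (fun x : T => trig K c (torus_point x)) =
  \sum_(i : box K) c (box_freq i) *:
    (regular_functional (fun x : T => fourier_exp (box_freq i) (torus_point x)) : functional R d).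
Proof. by rewrite -regular_functional_sum// => i; exact: cintegrable_fourier_exp. Qed.

Lemma trig_nonzero_freq K (c : 'rV[int]_d -> C) : (forall k, (exists j, (K < `|k ord0 j|)%N) -> c k = 0) ->
  (forall k, ~~ nonzero_freq k -> c k = 0) ->
  distribution_nonzero_freq (regular_functional (fun x : T => trig K c (torus_point x))).
Proof.
move=> cK c0; have ic := cintegrable_trig K c; split.
  by split; [exact: linear_regular|exact: continuous_regular].
by move=> k nz; rewrite fourier_coef_regular fcoef_trig// c0.
Qed.

(** Only frequencies in the box contribute, so the partial sums are constant once the index set
    contains the box. *)
Lemma trig_weyl K (c : 'rV[int]_d -> C) j (r : R) : (forall k, (exists j, (K < `|k ord0 j|)%N) -> c k = 0) ->
  (forall k, ~~ nonzero_freq k -> c k = 0) ->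
  is_weyl_derivative j r (regular_functional (fun x : T => trig K c (torus_point x)))
    (regular_functional (fun x : T => trig K (fun k => c k * weyl_factor r (k 0 j)) (torus_point x))).
Proof.
move=> cK c0 phi.
set x := (X in partial_sum X).
pose y k := c k * weyl_factor r (k 0 j) *
  regular_functional (fun x : T => fourier_exp k (torus_point x)) phi.
have xE k : x k = y k.
  rewrite /x /y fourier_coef_regular fcoef_trig//; case nz : (nonzero_freq k) => //.
  by rewrite c0 ?nz// !mul0r.
have y0 k : (exists j, (K < `|k ord0 j|)%N) -> y k = 0 by move=> H; rewrite /y cK// !mul0r.
rewrite regular_trig.
have -> : (\sum_(i : box K) (c (box_freq i) * weyl_factor r (box_freq i 0 j)) *:
    (regular_functional (fun x : T => fourier_exp (box_freq i) (torus_point x)) : functional R d)) phi =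
    \sum_(i : box K) y (box_freq i).
  by elim/big_rec2: _ => // i u v _ <-.
move=> A /nbhs_singleton Ac; exists [fset (box_freq i) | i in box K]%fset => // B /= kB.
suff -> : partial_sum x B = \sum_(i : box K) y (box_freq i) by [].
rewrite /partial_sum -(@big_seq_fsetE _ _ _ _ B xpredT x).
rewrite (eq_bigr y) => [|k _]; last exact: xE.
have [s /= [us sE]] : exists s : seq 'rV[int]_d, uniq s /\ s = [seq box_freq i | i : box K].
  exists [seq box_freq i | i : box K]; split=> //.
  by rewrite map_inj_uniq ?enum_uniq//; exact: box_freq_inj.
have -> : \sum_(i : box K) y (box_freq i) = \sum_(k <- s) y k.
  by rewrite sE big_image.
rewrite (bigID (fun k => k \in s))/= [X in _ + X]big1 ?addr0 => [|k]; last first.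
  move=> ks; apply: y0; apply: contrapT => /forallNP H; move/negP : ks; apply.
  have [i <-] : exists i : box K, box_freq i = k.
    by apply: box_freqP => j'; rewrite leqNgt; apply/negP; exact: H.
  by rewrite sE; apply/mapP; exists i; rewrite ?mem_enum.
rewrite -big_filter; apply: perm_big; apply: uniq_perm => //.
  by rewrite filter_uniq// fset_uniq.
move=> k; rewrite mem_filter; case ks : (k \in s) => //=.
move: ks; rewrite sE => /mapP[i _ ->].
by apply: (fsubsetP kB); apply/imfsetP; exists i.
Qed.

Lemma fun_norm_bounded (p M : R) g : 1 <= p -> 0 <= M -> cmeas g ->
  (forall x, Normc.normc (g x) <= M) -> (fun_norm p g <= (M * (1 + (2 * pi) ^+ d))%:E)%E.
Proof.
move=> p1 M0 mg gM; have p0 : 0 < p := lt_le_trans ltr01 p1.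
have ig := integrable_powR_bounded (ltW p0) mg gM.
rewrite fun_normE// lee_fin.
have tp := twopi_gt0 R d.
have iM : mu.-integrable setT (EFin \o (fun _ : T => M `^ p)).
  by apply: (@bounded_integrable _ _ _ _ (fun=> M `^ p) `|M `^ p|).
have H : \int[mu]_x (Normc.normc (g x) `^ p) <= M `^ p * (2 * pi) ^+ d.
  have -> : M `^ p * (2 * pi) ^+ d = \int[mu]_x (M `^ p).
    by rewrite Rintegral_cst// [X in fine X]torus_measureT.
  apply: le_Rintegral => // x _.
  by apply: ge0_ler_powR; rewrite ?nnegrE ?normc_ge0 ?(ltW p0).
apply: (@le_trans _ _ ((M `^ p * (2 * pi) ^+ d) `^ p^-1)).
  apply: ge0_ler_powR; rewrite ?nnegrE ?invr_ge0 ?(ltW p0) ?mulr_ge0 ?powR_ge0 ?(ltW tp)//.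
  by apply: Rintegral_ge0 => x _; exact: powR_ge0.
rewrite powRM ?powR_ge0 ?(ltW tp)// -powRrM mulfV ?gt_eqF// powRr1// ler_wpM2l//.
apply: le_trans (powR_le_1D (ltW tp) _ (_ : p^-1 <= 1)) _.
- by rewrite invr_ge0 ltW.
- by rewrite invf_le1.
by rewrite powRr1 ?(ltW tp).
Qed.

(** The inequality x <= 1 + x^q is not homogeneous, so it is applied to [g] divided by [c]. *)
Lemma Lq_L1 (q c : R) g : 1 <= q -> 0 < c -> cmeas g ->
  mu.-integrable setT (EFin \o (fun x => Normc.normc (g x) `^ q)) ->
  \int[mu]_x (Normc.normc (g x) `^ q) <= c `^ q ->
  \int[mu]_x Normc.normc (g x) <= c * ((2 * pi) ^+ d + 1).
Proof.
move=> q1 c0 mg ig Ig.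
have E x : (c^-1 * Normc.normc (g x)) `^ q = (c `^ q)^-1 * (Normc.normc (g x) `^ q).
  by rewrite powRM ?invr_ge0 ?normc_ge0 ?(ltW c0)// -powR_inv1 ?(ltW c0)// -powRrM mulN1r powRN.
have i1 : mu.-integrable setT (EFin \o (fun x => (c^-1 * Normc.normc (g x)) `^ q)).
  under [X in EFin \o X]eq_fun do rewrite E.
  exact: (integrableZl measurableT (c `^ q)^-1 ig).
have I1 : \int[mu]_x ((c^-1 * Normc.normc (g x)) `^ q) <= 1.
  under eq_Rintegral do rewrite E.
  by rewrite RintegralZl// ler_pdivrMl ?powR_gt0// mulr1.
have m1 : measurable_fun setT (fun x => c^-1 * Normc.normc (g x)).
  by apply: measurable_funM => //; exact: measurable_normc.
have p1 x : 0 <= c^-1 * Normc.normc (g x) by rewrite mulr_ge0 ?normc_ge0// invr_ge0 ltW.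
have [i2 I2] := Rintegral_powR_1D m1 p1 ler01 q1 i1 I1.
have ig1 := integrable_normc (cintegrable_powR q1 mg ig).
rewrite -ler_pdivrMl// -RintegralZl//.
by apply: le_trans I2; under [leRHS]eq_Rintegral do rewrite powRr1//.
Qed.

End lower_tools.

(** * The dual pair of bumps and the lower estimate *)

Section width_lower.
Variables (R : realType) (d : nat).
Local Notation V := 'rV[R]_d.
Local Notation C := R[i].
Local Notation mT := (measurableTypeR R).
Local Notation T := (d.-tuple mT).
Local Notation mu := (torus_measure R d).
Local Notation box K := {ffun 'I_d -> 'I_(2 * K).+1}.
Implicit Types (K : nat) (N : 'I_d -> nat) (k : 'rV[int]_d).

(** The coefficients of phi. Centring the triangle at 2N keeps its support between N and 3N, away
    from the singularity of the Weyl factor. *)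
Definition bump N (j : 'I_d) (l : int) : C := (tri R (N j) (l - (2 * N j)%N%:Z))%:C.

(** The coefficients of psi: a de la Vallee Poussin symbol centred at -2N, equal to 1 on the
    reflected support of [bump]. *)
Definition plateau N (j : 'I_d) (l : int) : C :=
  (2 * tri R (2 * N j) (l + (2 * N j)%N%:Z) - tri R (N j) (l + (2 * N j)%N%:Z))%:C.

Lemma plateau_bump N j l : (0 < N j)%N ->
  plateau N j l * bump N j (- l) = (tri R (N j) (l + (2 * N j)%N%:Z))%:C.
Proof.
move=> N0; rewrite /plateau /bump.
have -> : tri R (N j) (- l - (2 * N j)%N%:Z) = tri R (N j) (l + (2 * N j)%N%:Z).
  by rewrite -triN opprB opprK addrC.
set x := l + _; rewrite -rmorphM; congr (_%:C).
have [xN|xN] := leqP (N j) `|x|; first by rewrite [tri R (N j) x]tri_out// mulr0.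
rewrite ![tri R _ x]tri_in//; try lia.
rewrite natrM; set t := _%:R / (N j)%:R.
have nz : (N j)%:R != 0 :> R by rewrite pnatr_eq0 -lt0n.
have -> : `|x|%N%:R / (2 * (N j)%:R) = t / 2 by rewrite /t; field.
by field.
Qed.

Lemma majorized_plateau K N j : (0 < N j)%N -> (4 * N j <= K.+1)%N ->
  majorized K (2 * N j) 3 (plateau N j).
Proof.
move=> N0 NK.
have H n : (0 < n)%N -> (n <= 2 * N j)%N ->
    majorized K n 1 (fun l => (tri R n (l + (2 * N j)%N%:Z))%:C).
  move=> n0 nN; have := @majorized_tri R K n (- (2 * N j)%N%:Z) n0.
  have h : (`|(- (2 * N j)%N%:Z)%R| + n <= K.+1)%N by lia.
  by move=> /(_ h); apply: majorized_ext => l _; rewrite opprK.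
have n2 : `|2%:R : C| <= (2 : R)%:C by rewrite normr_nat rmorph_nat.
have n1 : `|(-1) : C| <= (1 : R)%:C by rewrite normrN1 rmorph1.
have H2 := majorizedZ n2 (H (2 * N j)%N ltac:(lia) (leqnn _)).
have H1 := majorizedZ n1 (majorized_le (ltac:(lia) : (N j <= 2 * N j)%N) (lexx _) (H (N j) N0 ltac:(lia))).
apply: majorized_weaken (majorizedD H2 H1) (leqnn _) _ _; first by lra.
by move=> l; apply: complexP; rewrite /plateau /= ?oppr0; ring.
Qed.

(** The pairing is the double sum of z_l conj(z_l') times a shifted Fejer kernel at the difference
    of the two grid points, and only its diagonal survives. *)
Lemma grid_pairing K N (pt : 'I_(\prod_j N j)%N -> V) (z : 'I_(\prod_j N j)%N -> C) :
  (forall j, 0 < N j)%N ->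
  (forall a b, kernel_of K (fun j (x : int) => (tri R (N j) (x + (2 * N j)%N%:Z))%:C) (pt a - pt b) =
     if a == b then (\prod_j N j)%N%:R else 0) ->
  \sum_(s : box K) grid_coef pt (plateau N) z (box_freq s) *
     grid_coef pt (bump N) (fun l => conjc (z l)) (- box_freq s) =
  (\prod_j N j)%N%:R * (\sum_l sqnorm (z l))%:C.
Proof.
move=> N0 Hpt; set m := (\prod_j N j)%N in pt z Hpt *.
transitivity (\sum_l \sum_l' z l * conjc (z l') *
    kernel_of K (fun j (x : int) => (tri R (N j) (x + (2 * N j)%N%:Z))%:C) (pt l' - pt l)).
  under [RHS]eq_bigr do under eq_bigr do rewrite kernel_ofB mulr_sumr.
  under [RHS]eq_bigr do rewrite exchange_big.
  rewrite [RHS]exchange_big; apply: eq_bigr => s _; rewrite /grid_coef.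
  set X := \sum_l z l * _; set Y := \sum_l conjc _ * _.
  have -> : \sum_i \sum_i0 z i * conjc (z i0) *
     ((\prod_j (tri R (N j) (freq (s j) + (2 * N j)%N%:Z))%:C) * fourier_exp (box_freq s) (pt i0) *
      fourier_exp (- box_freq s) (pt i)) =
     (\prod_j (tri R (N j) (freq (s j) + (2 * N j)%N%:Z))%:C) * (X * Y).
    rewrite /X mulr_suml mulr_sumr; apply: eq_bigr => l _.
    rewrite /Y !mulr_sumr; apply: eq_bigr => l' _; rewrite opprK; ring.
  rewrite mulrACA; congr (_ * _); rewrite -big_split; apply: eq_bigr => j _.
  by rewrite /= !mxE plateau_bump.
rewrite rmorph_sum mulr_sumr; apply: eq_bigr => l _.
rewrite (bigD1 l)//= Hpt eqxx big1 ?addr0 => [|l' ll']; last by rewrite Hpt (negPf ll') mulr0.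
by rewrite sqnormE mulrC.
Qed.

Lemma trigZ K (a : C) (c : 'rV[int]_d -> C) x : trig K (fun k => a * c k) x = a * trig K c x.
Proof. by rewrite mulr_sumr; apply: eq_bigr => i _; rewrite mulrA. Qed.

Lemma bump_out N k j : (forall j, 0 < N j)%N -> k ord0 j = 0 \/ (3 * N j <= `|k ord0 j|)%N ->
  \prod_j bump N j (k ord0 j) = 0.
Proof.
move=> N0 H; rewrite (bigD1 j)//= /bump tri_out ?mul0r//.
by have := N0 j; case: H => [->|]; lia.
Qed.

Lemma weyl_const_ge0 (r : R) : 0 < r -> 0 <= weyl_const r.
Proof.
move=> r0; rewrite /weyl_const mulr_ge0 ?exprn_ge0//.
by have := truncnS_gt r; lra.
Qed.

(** Duality: [h] annihilates the span, so [f h] is the value at [h] of [f - y], which is at most the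
    supremum of |h| times the L_1 norm of a representative, and the L_q norm controls the latter. *)
Lemma Lp_norm_sub_ge (q M delta : R) n (e : 'I_n -> functional R d) (f y : functional R d)
    (h : test R d) : 1 < q -> 0 <= M -> 0 < delta -> (forall i, e i h = 0) -> lin_span e y ->
  (forall x, Normc.normc (h x) <= M) ->
  M * (delta * ((2 * pi) ^+ d + 1)) < Normc.normc (f h) ->
  (delta%:E <= Lp_norm q (f - y)%R)%E.
Proof.
move=> q1 M0 d0 eh [a _ ya] hM Hf; rewrite leNgt; apply/negP => HL.
have [g [E mg ig Ig]] := Lp_norm_lt (ltW q1) (ltW d0) HL.
have yh : y h = 0.
  rewrite -ya; have -> : (\sum_i a i *: e i) h = \sum_i a i * e i h.
    by elim/big_rec2: _ => // i u v _ <-.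
  by rewrite big1// => i _; rewrite eh mulr0.
have fh : f h = regular_functional g h.
  rewrite -E; have -> : (f - y) h = f h - y h by [].
  by rewrite yh subr0.
have cg := cintegrable_powR (ltW q1) mg ig.
move: Hf; rewrite ltNge => /negP; apply; rewrite fh.
apply: le_trans (normc_torus_integral (cintegrable_mul_test h cg)) _.
have ing := integrable_normc cg.
apply: (@le_trans _ _ (M * \int[mu]_x Normc.normc (g x))).
  rewrite -RintegralZl//; apply: le_Rintegral => //.
  - exact: integrable_normc (cintegrable_mul_test h cg).
  - exact: (integrableZl measurableT M ing).
  - by move=> x _; rewrite Normc.normcM mulrC ler_wpM2r ?normc_ge0.
by rewrite ler_wpM2l//; exact: (Lq_L1 (ltW q1) d0 mg ig Ig).
Qed.

(** The generators of the subspace are functionals on test functions and serve themselves as the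
    constraints: [L i l] is the value of [e i] at the translate of psi to the point [pt l]. *)
Lemma annihilated_test K N n (pt : 'I_(\prod_j N j)%N -> V) (e : 'I_n -> functional R d) :
  (forall i, linear_functional (e i)) ->
  exists z : 'I_(\prod_j N j)%N -> C, exists h : test R d, [/\ forall l, sqnorm (z l) <= 1,
    (\prod_j N j)%N%:R - n%:R <= \sum_l sqnorm (z l),
    forall x, h x = trig K (grid_coef pt (plateau N) z) x,
    forall F, linear_functional F -> F h =
      \sum_(s : box K) grid_coef pt (plateau N) z (box_freq s) * F (fourier_test R (box_freq s)) &
    forall i, e i h = 0].
Proof.
move=> le.
pose L i l : C := \sum_(s : box K) (\prod_j plateau N j (box_freq s ord0 j)) *
  fourier_exp (- box_freq s) (pt l) * e i (fourier_test R (box_freq s)).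
have [z [Lz z1 zn]] := extreme_point L.
rewrite card_ord in zn.
have [h [hE hF]] := trig_test (index_enum (box K))
  (fun s => grid_coef pt (plateau N) z (box_freq s)) (@box_freq d K).
exists z, h; split=> // i.
rewrite hF//; rewrite -[RHS](Lz i) /L.
under [RHS]eq_bigr do rewrite mulr_suml.
rewrite exchange_big; apply: eq_bigr => s _; rewrite /grid_coef mulr_sumr mulr_suml.
apply: eq_bigr => l _; ring.
Qed.

(** A Weyl derivative in the [j]-th variable changes only the [j]-th factor of the bump, at the cost
    given by [majorized_weyl]; the other factors keep mass 1. All supports lie below 3 N_j, so the
    grid estimate gives 2 * 3 + 1 = 7 in each variable. *)
Lemma bump_sum_class K N (pt : 'I_(\prod_j N j)%N -> V) (z : 'I_(\prod_j N j)%N -> C)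
    (p r : 'I_d -> R) (eps : R) :
  (forall j, 1 < p j) -> (forall j, 0 < r j) -> (forall j, 0 < N j)%N -> (forall j, 3 * N j <= K)%N ->
  (forall l, sqnorm (z l) <= 1) -> 0 <= eps ->
  (forall (p : 'I_d -> int -> C) (A : 'I_d -> R) (x : V), (forall j l, `|p j l| <= (A j)%:C) ->
     (forall j l, (3 * N j <= `|l|)%N -> p j l = 0) -> (forall j t, 0 <= tsum K (p j) t) ->
     \sum_l kernel_of K p (x - pt l) <= (\prod_j (A j * (N j * (2 * 3).+1)%:R))%:C) ->
  (forall j, eps * (weyl_const (r j) * (N j)%:R `^ r j * (7 ^+ d * (\prod_j N j)%N%:R)) <=
     (1 + (2 * pi) ^+ d)^-1) ->
  sobolev_class r p (regular_functional (fun x : T =>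
    trig K (fun k => eps%:C * grid_coef pt (bump N) (fun l => conjc (z l)) k) (torus_point x))).
Proof.
move=> p1 r0 N0 NK z1 eps0 Hpt Heps.
set c := (fun k => _ * _).
have cK k : (exists j, (K < `|k ord0 j|)%N) -> c k = 0.
  move=> [j Kj]; rewrite /c /grid_coef (@bump_out _ _ j)// ?mul0r ?mulr0//.
  by right; apply: leq_trans (NK j) (ltnW Kj).
have c0 k : ~~ nonzero_freq k -> c k = 0.
  move=> /forallPn[j]; rewrite negbK => /eqP kj.
  by rewrite /c /grid_coef (@bump_out _ _ j)// ?mul0r ?mulr0//; left.
split; first exact: trig_nonzero_freq.
move=> j; eexists; first exact: (@trig_weyl _ _ K c j (r j) cK c0).
pose a (i : 'I_d) (l : int) := if i == j then bump N i l * weyl_factor (r i) l else bump N i l.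
have cE : (fun k => c k * weyl_factor (r j) (k 0 j)) =
    (fun k => eps%:C * grid_coef pt a (fun l => conjc (z l)) k).
  apply/funext => k; rewrite /c /grid_coef.
  rewrite [in LHS](bigD1 j)//= [in RHS](bigD1 j)//= /a eqxx.
  have -> : k 0 j = k ord0 j by [].
  have -> : \prod_(i < d | i != j) (if i == j then bump N i (k ord0 i) *
      weyl_factor (r i) (k ord0 i) else bump N i (k ord0 i)) =
      \prod_(i < d | i != j) bump N i (k ord0 i).
    by apply: eq_bigr => i /negPf ->.
  ring.
rewrite cE.
set g := fun x : T => _.
have cz l : `|conjc (z l)| <= 1.
  rewrite norm_conjC -(@ler_pXn2r _ 2)// ?nnegrE ?ler01// expr1n.
  have -> : `|z l| ^+ 2 = (sqnorm (z l))%:C by rewrite sqnormE sqr_normc.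
  by rewrite -(rmorph1 (real_complex R)) lecR.
pose A i : R := if i == j then weyl_const (r i) * (N i)%:R `^ r i else 1.
have aA i : majorized K (3 * N i) (A i) (a i).
  rewrite /a /A; have NKi := NK i.
  case: eqP => _; first by apply: majorized_weyl => //; lia.
  have H : (`|(2 * N i)%N%:Z| + N i <= K.+1)%N by rewrite absz_nat; lia.
  have B : majorized K (N i) 1 (bump N i) by exact: (@majorized_tri R K _ _ (N0 i) H).
  by apply: majorized_le B => //; lia.
have gM x : Normc.normc (g x) <= (1 + (2 * pi) ^+ d)^-1.
  rewrite /g trigZ Normc.normcM.
  have -> : Normc.normc (eps%:C) = eps by rewrite /= expr0n addr0 sqrtr_sqr ger0_norm.
  apply: le_trans (Heps j); rewrite ler_wpM2l//.
  apply: le_trans (normc_trig_grid_coef (torus_point x) Hpt aA cz) _.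
  rewrite big_split /= (bigD1 j)//= {1}/A eqxx big1 ?mulr1 => [|i ij]; last by rewrite /A (negPf ij).
  apply: ler_wpM2l; first exact: mulr_ge0 (weyl_const_ge0 (r0 j)) (powR_ge0 _ _).
  have -> : 7 ^+ d = \prod_(i < d) 7 :> R by rewrite prodr_const card_ord.
  rewrite natr_prod -big_split /=.
  by rewrite le_eqVlt; apply/orP; left; apply/eqP; apply: eq_bigr => i _; rewrite natrM mulrC.
have mg : cmeas g by apply: cintegrable_cmeas; exact: cintegrable_trig.
have tp := twopi_gt0 R d.
have i0 : 0 <= (1 + (2 * pi) ^+ d)^-1 :> R by rewrite invr_ge0 addr_ge0// ltW.
have Fg := fun_norm_bounded (ltW (p1 j)) i0 mg gM.
have Lg : Lp_fun (p j) g by apply: bounded_Lp_fun mg gM; apply: lt_trans (p1 j).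
apply: le_trans (Lp_norm_le Lg) _; apply: le_trans Fg _.
by rewrite mulVf// gt_eqF// addr_gt0.
Qed.

Lemma grid_level (x : R) : 1 <= x -> exists n : nat, [/\ (0 < n)%N, x <= n%:R & n%:R <= 2 * x].
Proof.
move=> x1; exists (Num.truncn x).+1; split=> //; first by apply/ltW; exact: truncnS_gt.
have : (Num.truncn x)%:R <= x by rewrite truncn_le; lra.
by rewrite -natr1; lra.
Qed.

(** Elements of the ambient space are arbitrary maps on test functions. Finite norm makes each
    generator the functional of an L_q function, and so linear. *)
Lemma fin_space_span q n (e : 'I_n -> functional R d) i : 1 < q ->
  lin_span e `<=` fin_space (@Lp_norm R d q) -> linear_functional (e i).
Proof.
move=> q1 He.
have /He : lin_span e (e i).
  exists (fun l => (l == i)%:R) => //.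
  rewrite (bigD1 i)//= eqxx scale1r big1 ?addr0// => l /negPf ->.
  by rewrite scale0r.
move=> /ereal_inf_lt[_ [g [Lg ->] _] _].
have [_ cg _] := Lp_fun_integrable (ltW q1) Lg.
exact: linear_regular.
Qed.

Lemma kolmogorov_width_ge (q rho : R) (p r : 'I_d -> R) : 1 < q -> (forall j, 1 < p j) ->
  0 < rho -> (forall j, 0 < r j) -> \sum_j (r j)^-1 = rho^-1 ->
  exists2 c : R, 0 < c & forall n, (0 < n)%N ->
    ((c * n%:R `^ (- rho))%:E <= kolmogorov_width (@Lp_norm R d q) (sobolev_class r p) n)%E.
Proof.
move=> q1 p1 rho0 r0 Hr.
have tp := twopi_gt0 R d; set t := (2 * pi) ^+ d in tp *.
(* As N_j <= 2 (2n)^(rho/r_j), the power N_j^(r_j) is at most 2^(r_j) 2^rho n^rho; 7^d is the grid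
   factor of [bump_sum_class], and the sum replaces a maximum over [j]. *)
pose W := \sum_j weyl_const (r j) * (2 `^ r j * 2 `^ rho) * 7 ^+ d.
have W_ge0 j : 0 <= weyl_const (r j) * (2 `^ r j * 2 `^ rho) * 7 ^+ d.
  apply: mulr_ge0; last exact: exprn_ge0.
  by apply: mulr_ge0; [exact: weyl_const_ge0|apply: mulr_ge0; exact: powR_ge0].
pose Lam := 1 + W.
have Lam0 : 0 < Lam by rewrite ltr_pwDl// sumr_ge0.
(* Here 15 = 3 (2 * 2 + 1) is the grid bound for [plateau] in one variable, 1 + t comes from the
   normalisation of [f], and t + 1 from the passage to L_1. The pairing loses only a factor 2, so
   the 4 leaves room for a strict inequality. *)
pose D := 4 * Lam * (1 + t) * (t + 1) * 15 ^+ d.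
have t1 : 0 < 1 + t by rewrite addr_gt0.
have t1' : 0 < t + 1 by rewrite addrC.
have D0 : 0 < D by rewrite !mulr_gt0 ?exprn_gt0.
exists (t / D) => [|n n0]; first by rewrite divr_gt0.
have n2 : 1 <= (2 * n)%N%:R :> R by rewrite ler1n; lia.
have n20 : 0 < (2 * n)%N%:R :> R by exact: lt_le_trans n2.
have nR0 : 0 < n%:R :> R by rewrite ltr0n.
have /choice[N HN] : forall j, exists l : nat, [/\ (0 < l)%N,
    (2 * n)%N%:R `^ (rho / r j) <= l%:R & l%:R <= 2 * (2 * n)%N%:R `^ (rho / r j)].
  move=> j; apply: grid_level; have e : (2 * n)%N%:R `^ 0 = 1 :> R by rewrite powRr0.
  by rewrite -[X in X <= _]e; apply: ler_powR => //; rewrite divr_ge0// ltW.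
have N0 j : (0 < N j)%N by have [] := HN j.
pose m := (\prod_j N j)%N.
have nm : (2 * n <= m)%N.
  rewrite -(ler_nat R) /m natr_prod -[leLHS](prod_powR_dual n20 rho0 Hr).
  by apply: ler_prod => j _; rewrite powR_ge0; have [] := HN j.
have m0 : 0 < m%:R :> R by rewrite ltr0n; apply: leq_trans nm; rewrite muln_gt0.
have Nr j : (N j)%:R `^ r j <= (2 `^ r j * 2 `^ rho) * n%:R `^ rho.
  have [_ _ Nu] := HN j.
  apply: (@le_trans _ _ ((2 * (2 * n)%N%:R `^ (rho / r j)) `^ r j)).
    by apply: ge0_ler_powR; rewrite ?nnegrE ?mulr_ge0 ?powR_ge0// ltW.
  rewrite powRM ?powR_ge0// -powRrM divfK ?gt_eqF// natrM powRM//.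
  by rewrite mulrA.
pose K := (\max_j 4 * N j)%N.
have NK j : (4 * N j <= K)%N by exact: (leq_bigmax (F := fun j => 4 * N j)%N).
have NK3 j : (3 * N j <= K)%N by apply: leq_trans (NK j); rewrite leq_mul2r orbT.
have [pt [Hpt1 Hpt2]] := @grid_exists R d N N0.
pose eps := (m%:R * Lam * n%:R `^ rho * (1 + t))^-1.
have nr0 : 0 < n%:R `^ rho :> R by rewrite powR_gt0.
have eps0 : 0 < eps by rewrite invr_gt0 !mulr_gt0.
have Heps j : eps * (weyl_const (r j) * (N j)%:R `^ r j * (7 ^+ d * m%:R)) <= (1 + t)^-1.
  have H : weyl_const (r j) * (N j)%:R `^ r j * (7 ^+ d * m%:R) <= Lam * n%:R `^ rho * m%:R.
    apply: (@le_trans _ _ ((weyl_const (r j) * (2 `^ r j * 2 `^ rho) * 7 ^+ d) * n%:R `^ rho * m%:R)).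
      have -> : weyl_const (r j) * (2 `^ r j * 2 `^ rho) * 7 ^+ d * n%:R `^ rho * m%:R =
        weyl_const (r j) * (2 `^ r j * 2 `^ rho * n%:R `^ rho) * (7 ^+ d * m%:R) by ring.
      apply: ler_wpM2r; first by rewrite mulr_ge0 ?exprn_ge0 ?ltW.
      by apply: ler_wpM2l; [exact: weyl_const_ge0|exact: Nr].
    apply: ler_wpM2r; first exact: ltW.
    apply: ler_wpM2r; first exact: ltW.
    by rewrite /Lam /W (bigD1 j)//= addrCA lerDl addr_ge0// sumr_ge0.
  apply: le_trans (ler_wpM2l (ltW eps0) H) _.
  rewrite le_eqVlt; apply/orP; left; apply/eqP; rewrite /eps.
  by field; rewrite !gt_eqF.
apply: le_ereal_inf_tmp => _ [L [Lfin [e eL]] <-].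
have le i : linear_functional (e i) by apply: fin_space_span q1 _; rewrite -eL.
have [z [h [z1 zn hE hF eh]]] := annihilated_test K pt le.
set f := regular_functional (fun x : T =>
    trig K (fun k => eps%:C * grid_coef pt (bump N) (fun l => conjc (z l)) k) (torus_point x)).
have ff : sobolev_class r p f.
  apply: (@bump_sum_class K N pt z p r eps) => //.
  - exact: ltW.
  - by move=> s A x; exact: Hpt1.
have lf : linear_functional f by have [[[]]] := ff.
have fhE : f h = ((t * eps * m%:R) * \sum_l sqnorm (z l))%:C.
  rewrite hF//.
  have H2 : forall a b, kernel_of K (fun j (x : int) => (tri R (N j) (x + (2 * N j)%N%:Z))%:C)
      (pt a - pt b) = if a == b then (\prod_j N j)%N%:R else 0.
    by apply: Hpt2 => j; exact: leqW.
  have P := grid_pairing z N0 H2.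
  have fe k : f (fourier_test R k) =
      (t * eps)%:C * grid_coef pt (bump N) (fun l => conjc (z l)) (- k).
    have cK (k' : 'rV[int]_d) : (exists j, (K < `|k' ord0 j|)%N) ->
        eps%:C * grid_coef pt (bump N) (fun l => conjc (z l)) k' = 0.
      move=> [j Kj]; rewrite /grid_coef (@bump_out _ _ j)// ?mul0r ?mulr0//.
      by right; apply: leq_trans (NK3 j) (ltnW Kj).
    have := fcoef_trig (- k) cK; rewrite fcoef_regular opprK -/f => H.
    have tz : t%:C != 0 :> C by rewrite fmorph_eq0 gt_eqF.
    apply: (mulfI (invr_neq0 tz)); rewrite -fmorphV [LHS]H.
    by rewrite [RHS]mulrA -rmorphM mulKf ?gt_eqF.
  transitivity ((t * eps)%:C * \sum_(s : box K) grid_coef pt (plateau N) z (box_freq s) *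
     grid_coef pt (bump N) (fun l => conjc (z l)) (- box_freq s)).
    by rewrite mulr_sumr; apply: eq_bigr => s _; rewrite fe mulrCA.
  by rewrite P [RHS]rmorphM [in RHS]rmorphM rmorph_nat mulrA.
apply: le_trans (ereal_sup_ubound _) => /=; last by exists f.
apply: le_ereal_inf_tmp => _ [y yL <-].
have n_r : 0 < n%:R `^ (- rho) :> R by rewrite powR_gt0.
apply: (@Lp_norm_sub_ge q (15 ^+ d * m%:R) (t / D * n%:R `^ (- rho)) n e f y h) => //.
- by rewrite !mulr_gt0 ?invr_gt0.
- by rewrite -eL.
- move=> x; rewrite hE.
  have aA j : majorized K (2 * N j) 3 (plateau N j).
    by apply: majorized_plateau => //; exact: leqW.
  have z1' l : `|z l| <= 1.
    rewrite -(@ler_pXn2r _ 2)// ?nnegrE ?ler01// expr1n.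
    have -> : `|z l| ^+ 2 = (sqnorm (z l))%:C by rewrite sqnormE sqr_normc.
    by rewrite -(rmorph1 (real_complex R)) lecR.
  apply: le_trans (normc_trig_grid_coef (A := fun=> 3) x _ aA z1') _.
    by move=> s A y' *; exact: (Hpt1 K 2%N).
  have -> : 15 ^+ d = \prod_(i < d) 15 :> R by rewrite prodr_const card_ord.
  rewrite /m natr_prod -big_split /= le_eqVlt; apply/orP; left; apply/eqP.
  by apply: eq_bigr => i _; rewrite natrM; ring.
rewrite fhE -/t.
have S0 : 0 <= \sum_l sqnorm (z l) by apply: sumr_ge0 => l _; rewrite addr_ge0 ?sqr_ge0.
have -> : Normc.normc ((t * eps * m%:R) * \sum_l sqnorm (z l))%:C = (t * eps * m%:R) * \sum_l sqnorm (z l).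
  rewrite /= expr0n addr0 sqrtr_sqr ger0_norm//.
  by apply: mulr_ge0 S0; apply: mulr_ge0 (ltW m0); apply: mulr_ge0; exact: ltW.
have Sm : m%:R / 2 <= \sum_l sqnorm (z l).
  apply: le_trans zn; rewrite -/m.
  have : (2 * n)%N%:R <= m%:R :> R by rewrite ler_nat.
  by rewrite natrM; lra.
have c0 : 0 < t * eps * m%:R by rewrite !mulr_gt0.
apply: lt_le_trans (ler_wpM2l (ltW c0) Sm).
have -> : 15 ^+ d * m%:R * (t / D * n%:R `^ (- rho) * (t + 1)) =
    (t * m%:R / (Lam * n%:R `^ rho * (1 + t))) / 4.
  rewrite powRN /D; have e15 : 15 ^+ d != 0 :> R by rewrite expf_neq0.
  by field; rewrite !gt_eqF// ?exprn_gt0.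
have -> : t * eps * m%:R * (m%:R / 2) = (t * m%:R / (Lam * n%:R `^ rho * (1 + t))) / 2.
  by rewrite /eps; field; rewrite !gt_eqF.
set X := _ / (_ * _ * _).
have : 0 < X by rewrite divr_gt0 ?mulr_gt0.
lra.
Qed.

End width_lower.

Local Close Scope complex_scope.
Local Close Scope classical_set_scope.

Theorem mainTheorem5 (R : realType) (d : nat) (q : R) (p r : 'I_d -> R)
    (d_ge2 : (2 <= d)%N)
    (q_gt1 : 1 < q)
    (p_gt1 : forall j, 1 < p j)
    (r_gt0 : forall j, 0 < r j)
    (embedding : 0 < vec_harmonic_mean r / d%:R + q^-1 -
       vec_harmonic_mean r / vec_harmonic_mean (fun j => p j * r j))
    (p_ge_q : forall j, q <= p j)
    (condition_fails : ~ (forall j : 'I_d,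
       \sum_(i < d) (r i)^-1 * ((p i)^-1 - (p j)^-1) < 1)) :
  exists c1 c2 : R, [/\ 0 < c1, 0 < c2 &
    forall n : nat, (0 < n)%N ->
      let w := kolmogorov_width (@Lp_norm R d q) (sobolev_class r p) n in
      let b := n%:R `^ (- (vec_harmonic_mean r / d%:R)) in
      ((c1 * b)%:E <= w)%E /\ (w <= (c2 * b)%:E)%E].
Proof.
set rho := vec_harmonic_mean r / d%:R.
have d0 : (0 < d)%N by apply: leq_trans d_ge2.
have le_sum j : (r j)^-1 <= \sum_i (r i)^-1.
  by rewrite (bigD1 j)//= lerDl sumr_ge0// => i _; rewrite invr_ge0 ltW.
have s0 : 0 < \sum_i (r i)^-1.
  by apply: lt_le_trans (le_sum (Ordinal d0)); rewrite invr_gt0.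
have rhoE : rho = (\sum_i (r i)^-1)^-1.
  by rewrite /rho /vec_harmonic_mean mulrAC mulfV ?mul1r// pnatr_eq0 -lt0n.
have rho0 : 0 < rho by rewrite rhoE invr_gt0.
have rho_le j : rho <= r j.
  by rewrite rhoE -[r j]invrK lef_pV2// posrE invr_gt0.
have Hr : \sum_i (r i)^-1 = rho^-1 by rewrite rhoE invrK.
have [c1 c10 lower] := kolmogorov_width_ge q_gt1 p_gt1 rho0 r_gt0 Hr.
have [c2 c20 upper] := kolmogorov_width_le q_gt1 p_ge_q rho0 rho_le Hr.
by exists c1, c2; split=> // n n0 w b; split; [exact: lower|exact: upper].
Qed.
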